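(* Let $C: f=0$ be a degree $N$ nodal curve in $\mathbb{P}^2$ and let $\mathcal{N}$ denote the set of its nodes. Then $\operatorname{def} S_k(\mathcal{N})=0$ for $k>N-3$ and $\operatorname{def} S_{N-3}(\mathcal{N})=r-1$, where $r$ is the number of irreducible components of $C$. Moreover, if the curve $C$ is in addition rational, all the defects $\operatorname{def} S_k(\mathcal{N})$ are completely determined by the degree $N$ and the number of nodes $n(C)=|\mathcal{N}|$ (that is, two rational nodal curves of the same degree with the same number of nodes have the same defects for every $k$).
   Context: We work over $\mathbb{C}$. Let $S=\mathbb{C}[x,y,z]$ with its standard grading, $S_m$ the space of homogeneous polynomials of degree $m$ ($S_m=0$ for $m<0$). A nodal curve is a reduced plane curve (possibly reducible) all of whose singularities are nodes (ordinary double points $A_1$). A nodal curve is called rational if the normalization of each of its irreducible components has genus $0$. For a finite set $\mathcal{N}\subset\mathbb{P}^2$, the defect is $$\operatorname{def} S_m(\mathcal{N})=|\mathcal{N}|-\operatorname{codim}\{h\in S_m : h(a)=0\text{ for any }a\in\mathcal{N}\},$$ the codimension being taken in $S_m$. *)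

(* Defs.v *)
From HB Require Import structures.
From mathcomp Require Import all_boot all_order all_algebra.
From mathcomp Require Import finmap mpoly complex.
From mathcomp Require Import boolp classical_sets cardinality reals.

Set Implicit Arguments.
Unset Strict Implicit.
Unset Printing Implicit Defensive.

Import GRing.Theory.
Local Open Scope ring_scope.
Local Open Scope complex_scope.

(* The projective plane over R[i], as the set of lines through 0 in the
   3-dimensional space of row vectors. *)
Definition P2 (R : realType) := {a : {vspace 'rV[R[i]]_3} | \dim a == 1%N}.

(* Some homogeneous coordinates of a: all the conditions evaluated at them
   below are invariant under rescaling. *)
Definition hcoord (R : realType) (a : P2 R) : 'I_3 -> R[i] :=
  fun i => vpick (val a) 0 i.

(* [dhomog 3 R[i] m] is the space of homogeneous polynomials of degree m. *)
Definition eval_at (R : realType) (m : nat) (a : P2 R)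
    (h : dhomog 3 R[i] m) : R[i]^o :=
  (mpoly_of_dhomog h).@[hcoord a].

Lemma eval_at_is_linear (R : realType) (m : nat) (a : P2 R) :
  linear (@eval_at R m a).
Proof. by move=> c h1 h2; rewrite /eval_at -[RHS]/(_ * _ + _) -mevalZ -mevalD. Qed.

HB.instance Definition _ (R : realType) (m : nat) (a : P2 R) :=
  GRing.isLinear.Build R[i] (dhomog 3 R[i] m) R[i]^o _ (@eval_at R m a)
    (@eval_at_is_linear R m a).

Definition vanishing_on (R : realType) (m : nat) (A : {fset P2 R}) :
    {vspace (dhomog 3 R[i] m)} :=
  (\bigcap_(a <- enum_fset A) lker (linfun (@eval_at R m a)))%VS.

(* For m < 0 the space of forms of degree m is 0, hence the codimension is 0. *)
Definition codim_vanishing (R : realType) (m : int) (A : {fset P2 R}) : int :=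
  match m with
  | Posz m' => (\dim {: dhomog 3 R[i] m'})%:Z - (\dim (vanishing_on m' A))%:Z
  | Negz _ => 0
  end.

Definition defect (R : realType) (m : int) (A : {fset P2 R}) : int :=
  (#|` A|)%:Z - codim_vanishing m A.

Definition singular_point (R : realType) (f : {mpoly R[i][3]}) (a : P2 R) :
    Prop :=
  f.@[hcoord a] = 0 /\ forall i : 'I_3, f^`M(i).@[hcoord a] = 0.

(* Ordinary double point: in each affine chart X_i <> 0 containing a, the
   dehomogenized equation has a nondegenerate critical point. Its Hessian is the
   minor of the homogeneous Hessian obtained by deleting row and column i, since
   the derivatives in the other two variables commute with setting X_i to a
   constant. *)
Definition hessian (R : realType) (f : {mpoly R[i][3]}) (a : P2 R) :
    'M[R[i]]_3 :=
  \matrix_(i < 3, j < 3) f^`M(i)^`M(j).@[hcoord a].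

Definition node (R : realType) (f : {mpoly R[i][3]}) (a : P2 R) : Prop :=
  singular_point f a /\
  forall i : 'I_3, hcoord a i != 0 -> \det (row' i (col' i (hessian f a))) != 0.

Definition reduced_form (R : realType) (f : {mpoly R[i][3]}) : Prop :=
  forall g h : {mpoly R[i][3]}, f = g ^+ 2 * h -> g \is a GRing.unit.

Definition nodal_curve (R : realType) (N : nat) (f : {mpoly R[i][3]}) : Prop :=
  [/\ (0 < N)%N, f != 0, f \is N.-homog, reduced_form f
    & forall a : P2 R, singular_point f a -> node f a].

(* [fset_set] is the finite set with the given elements; it would be empty on an
   infinite set, but a reduced curve has finitely many singular points. *)
Definition nodes (R : realType) (f : {mpoly R[i][3]}) : {fset P2 R} :=
  fset_set [set a : P2 R | node f a]%classic.

Definition irreducible_form (R : realType) (p : {mpoly R[i][3]}) : Prop :=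
  [/\ p != 0, p \isn't a GRing.unit
    & forall g h : {mpoly R[i][3]},
        p = g * h -> g \is a GRing.unit \/ h \is a GRing.unit].

(* The irreducible components of f = 0 are the curves p = 0 with p an
   irreducible factor of f; the leading coefficient is normalized so that each
   component is represented by exactly one p. *)
Definition component (R : realType) (f p : {mpoly R[i][3]}) : Prop :=
  [/\ irreducible_form p, mleadc p = 1
    & exists q : {mpoly R[i][3]}, f = q * p].

Definition ncomponents (R : realType) (f : {mpoly R[i][3]}) : nat :=
  #|` fset_set [set p : {mpoly R[i][3]} | component f p]%classic|.

(* K, with structure morphism c, is the function field of the curve p = 0, with
   generic point t: a homogeneous form vanishes at t iff it vanishes on the
   curve, and K consists of the quotients of forms of the same degree. This
   determines K up to isomorphism as the degree 0 part of the homogeneous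
   localization of S/(p) at its zero ideal. *)
Definition function_field (R : realType) (p : {mpoly R[i][3]}) (K : fieldType)
    (c : {rmorphism R[i] -> K}) (t : 'I_3 -> K) : Prop :=
  (forall (d : nat) (g : {mpoly R[i][3]}), g \is d.-homog ->
     (mmap c t g = 0 <-> exists q : {mpoly R[i][3]}, g = q * p)) /\
  (forall u : K, exists (d : nat) (g h : {mpoly R[i][3]}),
     [/\ g \is d.-homog, h \is d.-homog, mmap c t h != 0
       & u = mmap c t g / mmap c t h]).

(* The points of the normalization of a projective curve with function field K
   correspond to the nontrivial valuation rings of K over the base field, each
   point to its local ring. *)
Definition valuation_ring_over (F K : fieldType) (c : {rmorphism F -> K})
    (O : set K) : Prop :=
  [/\ forall a : F, O (c a),
      forall u v : K, O u -> O v -> O (u - v) /\ O (u * v),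
      forall u : K, O u \/ O u^-1
    & exists u : K, ~ O u].

Definition derivation_over (F K : fieldType) (c : {rmorphism F -> K})
    (D : K -> K) : Prop :=
  [/\ forall u v : K, D (u + v) = D u + D v,
      forall u v : K, D (u * v) = u * D v + v * D u
    & forall a : F, D (c a) = 0].

(* The sequence of the (u_j, v_j) stands for the Kaehler differential
   \sum_j u_j dv_j of K over F. As the derivations of K over F form the K-dual of
   the space of Kaehler differentials, two such sums are equal iff their
   contractions with every derivation agree. *)
Definition contract (K : fieldType) (D : K -> K) (w : seq (K * K)) : K :=
  \sum_(uv <- w) uv.1 * D uv.2.

Definition differential_eq (F K : fieldType) (c : {rmorphism F -> K})
    (w1 w2 : seq (K * K)) : Prop :=
  forall D : K -> K, derivation_over c D -> contract D w1 = contract D w2.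

(* w is in the image of the differentials of O. *)
Definition regular_at (F K : fieldType) (c : {rmorphism F -> K})
    (O : set K) (w : seq (K * K)) : Prop :=
  exists w' : seq (K * K),
    (forall uv, uv \in w' -> O uv.1 /\ O uv.2) /\ differential_eq c w w'.

Definition regular_differential (F K : fieldType) (c : {rmorphism F -> K})
    (w : seq (K * K)) : Prop :=
  forall O : set K, valuation_ring_over c O -> regular_at c O w.

Definition scale_differential (K : fieldType) (l : K) (w : seq (K * K)) :
    seq (K * K) :=
  [seq (l * uv.1, uv.2) | uv <- w].

(* The genus is the dimension over F of the space of everywhere regular
   differentials: b is a basis of that space. *)
Definition has_genus (F K : fieldType) (c : {rmorphism F -> K}) (g : nat) :
    Prop :=
  exists b : 'I_g -> seq (K * K),
    (forall j, regular_differential c (b j)) /\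
    (forall w, regular_differential c w ->
       exists! l : {ffun 'I_g -> F},
         differential_eq c w
           (flatten [seq scale_differential (c (l j)) (b j) | j <- enum 'I_g])).

Definition normalization_has_genus (R : realType) (p : {mpoly R[i][3]})
    (g : nat) : Prop :=
  exists (K : fieldType) (c : {rmorphism R[i] -> K}) (t : 'I_3 -> K),
    function_field p c t /\ has_genus c g.

Definition rational_curve (R : realType) (f : {mpoly R[i][3]}) : Prop :=
  forall p : {mpoly R[i][3]}, component f p -> normalization_has_genus p 0.

(* Main.v *)
From HB Require Import structures.
Require Import Defs.
From mathcomp Require Import all_boot all_order all_algebra.
From mathcomp Require Import finmap mpoly complex reals boolp classical_sets cardinality.
From mathcomp Require Import ring zify.

(**
Let p_1, ..., p_r be the irreducible factors of f and let A be the set of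
nodes. A defect in degree k is a space of linear relations
sum_a l_a h(a) = 0 between the values of all forms h of degree k at the
points of A ([defect_relations]), so the theorem is a bound from above and a
bound from below for such relations.

Upper bound ([independent_relations_ltn], [relation_succ_eq0],
[defect_upper]). In an affine chart where f is monic in y and the points of A
have distinct abscissas X_a, write f = K_a (x - X_a) + Q_a (y - Y_a). As f is
singular at a, both K_a and Q_a vanish at a, and the rational function
Q_a / (x - X_a) = - K_a / (y - Y_a) on the curve sends, by multiplication, the
functions vanishing on A to functions vanishing on A. Hence so does
phi_l = sum_a l_a Q_a / (x - X_a) = g_l / Pi, with Pi = prod_a (x - X_a). The
relations in degree N - 3 guarantee that g_l has total degree at most
deg Pi, so that phi_l has no pole at infinity: multiplication by phi_l then
preserves a finite dimensional space of functions, and phi_l is constant on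
each component. This maps the relations to C^r. If the image of l is
(c, ..., c) then g_l - c Pi is divisible by f, hence zero since its degree
in y is less than N, and g_l = c Pi forces l = 0 ([multiplier_injective]). So
the map is injective and misses (1, ..., 1): there are at most r - 1
independent relations in degree N - 3. A relation l in degree N - 2 gives two
constant functions, phi_l and x phi_l up to a constant, which forces
phi_l = 0: there is no relation.

Lower bound ([defect_lower]), by adding one component at a time. If p is
irreducible of degree d and does not divide q of degree e, the nodes of p q
are those of p, those of q and the points of p = q = 0, which are at least
d e many: as the intersection is transversal, every form of degree d + e
vanishing there is in the ideal (p, q) ([vanishing_in_ideal]), and dimensions
are counted ([bezout_lower]). On the other hand (u, v) |-> q u + p v embeds
the sum of the spaces of forms of degrees d - 3 and e - 3 vanishing on the
nodes of p and of q into the one for p q. Together with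
dim S_{d+e-3} = dim S_{d-3} + dim S_{e-3} + d e - 1 this gives
def (p q) >= def p + def q + 1 ([defect_product]).

Rational curves ([genus_zero_no_adjoint], [rational_no_adjoint]). A nonzero
form of degree k <= N - 3 vanishing on A yields one, h, of degree N - 3. Some
component p does not divide it, and with f = p q the residue (h / q) dx / p_y
of h / f is a nonzero differential on the normalization of p. It is regular:
at each point of f = 0 the affine partial derivatives of f are not both zero
or, at a node, generate the maximal ideal, so that locally
h = u f_x + v f_y up to a unit, and the differential equals
v dx - u dy ([chart_regular]). In genus 0 there is no such differential.
Hence no nonzero form of degree k <= N - 3 vanishes on A, and the defect is
|A| - dim S_k, which depends on N and |A| only.
*)

Set Implicit Arguments. Unset Strict Implicit. Unset Printing Implicit Defensive.
Import GRing.Theory.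
Local Open Scope ring_scope.

(** * Bivariate polynomials and their total degree *)

Section Bivariate.
Variable C : fieldType.
Implicit Types (f g h p q : {poly {poly C}}) (a : C * C).

(** Elements of {poly {poly C}} are polynomials in y over C[x]. *)
Definition ev a h : C := h.[a.2%:P].[a.1].

Lemma evD a g h : ev a (g + h) = ev a g + ev a h.
Proof. by rewrite /ev !hornerD. Qed.
Lemma evN a h : ev a (- h) = - ev a h.
Proof. by rewrite /ev !hornerN. Qed.
Lemma evB a g h : ev a (g - h) = ev a g - ev a h.
Proof. by rewrite evD evN. Qed.
Lemma evM a g h : ev a (g * h) = ev a g * ev a h.
Proof. by rewrite /ev !hornerM. Qed.
Lemma evX a : ev a 'X = a.2.
Proof. by rewrite /ev hornerX hornerC. Qed.
Lemma evC a (s : {poly C}) : ev a s%:P = s.[a.1].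
Proof. by rewrite /ev hornerC. Qed.
Lemma ev_sum a (I : Type) (r : seq I) (P : pred I) (F : I -> {poly {poly C}}) :
  ev a (\sum_(i <- r | P i) F i) = \sum_(i <- r | P i) ev a (F i).
Proof. by apply: (big_morph _ (evD a)); rewrite /ev !horner0. Qed.

(** The quotient of s by X - b, by Horner's scheme; the explicit coefficients
    are what the later degree estimates need. *)
Definition hquo (R : nzRingType) (s : {poly R}) (b : R) : {poly R} :=
  \poly_(j < size s) \sum_(i < size s) s`_(i + j.+1) * b ^+ i.

Lemma coef_hquo (R : nzRingType) (s : {poly R}) (b : R) j :
  (hquo s b)`_j = \sum_(i < size s) s`_(i + j.+1) * b ^+ i.
Proof.
rewrite coef_poly; case: ltnP => // le; rewrite big1 // => i _.
by rewrite nth_default ?mul0r // (leq_trans le) // (leq_trans (leqnSn _)) ?leq_addl.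
Qed.

Lemma hquoP (R : comNzRingType) (s : {poly R}) (b : R) :
  s = s.[b]%:P + hquo s b * ('X - b%:P).
Proof.
apply/polyP => j; rewrite coefD mulrBr coefB coefMX coefC coefMC !coef_hquo.
have shift (k : nat) : \sum_(i < size s) s`_(i + k) * b ^+ i =
    s`_k + \sum_(i < size s) s`_(i + k.+1) * b ^+ i * b.
  case E: (size s) => [|m].
    by rewrite !big_ord0 nth_default ?E // addr0.
  rewrite big_ord_recl expr0 mulr1 add0n; congr (_ + _).
  rewrite big_ord_recr /= [X in _ + X * _ * _]nth_default ?E; last by lia.
  rewrite !mul0r addr0; apply: eq_bigr => i _.
  by rewrite /bump /= add1n exprSr mulrA addnS addSn.
case: j => [|j] /=.
  rewrite horner_coef sub0r.
  rewrite (eq_bigr (fun i : 'I__ => s`_(i + 0) * b ^+ i)) => [|i _]; last first.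
    by rewrite addn0.
  by rewrite shift big_distrl /= addrK.
by rewrite add0r shift big_distrl /= addrK.
Qed.

(** A polynomial vanishing at a point is in the maximal ideal of that point; the
    cofactors are the two successive Horner quotients. *)
Lemma split_at h (x y : C) : ev (x, y) h = 0 ->
  h = (hquo h.[y%:P] x)%:P * ('X - x%:P)%:P + hquo h y%:P * ('X - y%:P%:P).
Proof.
move=> h0; rewrite {1}(hquoP h y%:P) -polyCM; congr (_%:P + _).
by rewrite {1}(hquoP h.[y%:P] x) [h.[_].[_]]h0 polyC0 add0r.
Qed.

(** h (T, y T): the outer variable of the result is T, the inner one is y. The
    coefficient of T ^ k is the homogeneous part of h of degree k, dehomogenized
    at x = 1. The total degree becomes an ordinary degree, and inherits its
    multiplicativity. *)
Definition Phi h : {poly {poly C}} :=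
  (map_poly (map_poly polyC) h).['X * 'X%:P].

Lemma PhiD g h : Phi (g + h) = Phi g + Phi h.
Proof. by rewrite /Phi rmorphD hornerD. Qed.
Lemma PhiN h : Phi (- h) = - Phi h.
Proof. by rewrite /Phi rmorphN hornerN. Qed.
Lemma PhiM g h : Phi (g * h) = Phi g * Phi h.
Proof. by rewrite /Phi rmorphM hornerM. Qed.

Lemma coef_Phi h k j :
  (Phi h)`_k`_j = if (j <= k)%N then h`_j`_(k - j) else 0.
Proof.
rewrite /Phi horner_coef coef_sum coef_sum.
have le : (size (map_poly (map_poly polyC) h) <= size h)%N.
  by rewrite size_poly.
rewrite (eq_bigr (fun i : 'I__ => if (nat_of_ord i == j) && (j <= k)%N then
    h`_j`_(k - j) else 0)); last first.
  move=> i _; rewrite coef_map exprMn_comm; last exact: mulrC.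
  rewrite -rmorphXn /= mulrA coefMC !coefMXn coef_map /=.
  case: (ltngtP j i) => [//|ij|->] /=.
    case: ltnP => [_|_]; rewrite ?coef0 // coefC.
    by rewrite subn_eq0 leqNgt ij.
  by rewrite ltnNge; case: (leqP i k) => ik /=; rewrite ?coef0 // subnn coefC.
case: (leqP j k) => jk; last by rewrite big1 // => i _; rewrite andbF.
case: (ltnP j (size (map_poly (map_poly polyC) h))) => jh.
  rewrite (bigD1 (Ordinal jh)) //= eqxx /= big1 ?addr0 // => i.
  by rewrite -val_eqE /= => /negbTE ->.
rewrite big1 => [|i _]; last first.
  by rewrite ltn_eqF //; case: i => i /= ilt; apply: (leq_trans ilt).
have /(congr1 (fun s : {poly _} => s`_(k - j))) := nth_default 0 jh.
rewrite coef_map coef_map coef0 => /eqP.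
by rewrite polyC_eq0 => /eqP.
Qed.

(** One more than the total degree, and 0 for h = 0, like [size]. *)
Definition tsz h := size (Phi h).

Lemma tszP h k :
  reflect (forall i j, (k <= i + j)%N -> h`_j`_i = 0) (tsz h <= k)%N.
Proof.
apply: (iffP idP) => [le i j ij|H].
  have := coef_Phi h (i + j) j; rewrite leq_addl addnK => <-.
  by rewrite [(Phi h)`_(i + j)]nth_default ?coef0 // (leq_trans le).
apply/leq_sizeP => l kl; apply/polyP => j; rewrite coef_Phi coef0.
by case: leqP => // jl; apply: H; rewrite subnK.
Qed.

Lemma tsz_eq0 h : (tsz h == 0%N) = (h == 0).
Proof.
apply/idP/eqP => [|->]; last by rewrite /tsz /Phi rmorph0 horner0 size_poly0.
rewrite -leqn0 => /tszP H; apply/polyP => j; apply/polyP => i.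
by rewrite H ?coef0 // coef0.
Qed.

Lemma tsz0 : tsz 0 = 0%N. Proof. by apply/eqP; rewrite tsz_eq0. Qed.

Lemma Phi_eq0 h : (Phi h == 0) = (h == 0).
Proof. by rewrite -(tsz_eq0 h) /tsz size_poly_eq0. Qed.

Lemma tsz_gt0 h : (0 < tsz h)%N = (h != 0).
Proof. by rewrite lt0n tsz_eq0. Qed.

Lemma tszM g h : g != 0 -> h != 0 -> tsz (g * h) = (tsz g + tsz h).-1.
Proof. by move=> g0 h0; rewrite /tsz PhiM size_mul ?Phi_eq0. Qed.

Lemma tszM_leq g h : (tsz (g * h) <= (tsz g + tsz h).-1)%N.
Proof. by rewrite /tsz PhiM; apply: size_polyMleq. Qed.

Lemma tszD_leq g h k : (tsz g <= k)%N -> (tsz h <= k)%N -> (tsz (g + h) <= k)%N.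
Proof.
by move=> gk hk; rewrite /tsz PhiD (leq_trans (size_polyD _ _)) // geq_max gk.
Qed.

Lemma tszN h : tsz (- h) = tsz h.
Proof. by rewrite /tsz PhiN size_polyN. Qed.

Lemma tszC (s : {poly C}) : tsz s%:P = size s.
Proof.
have [->|s0] := eqVneq s 0; first by rewrite polyC0 tsz0 size_poly0.
rewrite /tsz /Phi map_polyC hornerC size_map_poly_id0 //.
by rewrite polyC_eq0 lead_coef_eq0.
Qed.
End Bivariate.

(** * The multiplier attached to a relation between points *)

Section Top.
Variable C : fieldType.
Implicit Types (f g h p q : {poly {poly C}}) (a : C * C).
(** The leading form, dehomogenized at x = 1: it describes the points at
    infinity of the curve h = 0 other than the one on the line x = 0. *)
Definition top h : {poly C} := lead_coef (Phi h).

Lemma topM g h : top (g * h) = top g * top h.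
Proof. by rewrite /top PhiM lead_coefM. Qed.

Lemma top_eq0 h : (top h == 0) = (h == 0).
Proof. by rewrite lead_coef_eq0 Phi_eq0. Qed.

Lemma size_top h : (size (top h) <= size h)%N.
Proof.
apply/leq_sizeP => j jh; rewrite /top lead_coefE coef_Phi; case: ifP => // _.
by rewrite [h`_j]nth_default ?coef0.
Qed.

Lemma size_top_monic p : p \is monic -> (tsz p <= size p)%N ->
  size (top p) = size p.
Proof.
move=> mp tp; have p0 := monic_neq0 mp.
have sp : (0 < size p)%N by rewrite size_poly_gt0.
have pE : p`_(size p).-1 = 1 by move/monicP: mp; rewrite lead_coefE.
have E : tsz p = size p.
  apply/eqP; rewrite eqn_leq tp -(prednK sp) ltnNge; apply/negP => /tszP.
  by move=> /(_ 0%N (size p).-1 (leqnn _)) /eqP; rewrite pE coef1 oner_eq0.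
apply/eqP; rewrite eqn_leq size_top -(prednK sp) ltnNge; apply/negP.
move=> /leq_sizeP /(_ _ (leqnn _)) /eqP.
rewrite /top lead_coefE -/(tsz p) E coef_Phi leqnn subnn pE coef1.
by rewrite oner_eq0.
Qed.

(** If the leading forms have no common factor, those of u p and v q can only
    cancel when top p divides top v; this is excluded by the degree of v in y. *)
Lemma tsz_coprime_top (p q u v h : {poly {poly C}}) :
  coprimep (top p) (top q) -> (size v < size (top p))%N ->
  h = u * p + v * q -> (tsz (v * q) <= tsz h)%N.
Proof.
move=> cop sv eh; rewrite leqNgt; apply/negP => lt.
have v0 : v != 0 by apply/eqP => v0; move: lt; rewrite v0 mul0r tsz0.
have : top p %| top v * top q.
  have -> : top v * top q = top u * - top p.
    have e : Phi (u * p) = - Phi (v * q) + Phi h by rewrite eh PhiD addrC addrK.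
    rewrite -topM mulrN -topM /top e lead_coefDl ?size_polyN //.
    by rewrite lead_coefN opprK.
  by rewrite mulrN dvdpNr dvdp_mull.
rewrite Gauss_dvdpl // => /dvdp_leq; rewrite top_eq0 => /(_ v0).
by move=> /(leq_trans sv); rewrite ltnNge size_top.
Qed.

(** Division by a polynomial which is monic in y and of the same total degree
    does not raise the total degree. *)
Lemma tsz_rmodp f h : f \is monic -> (tsz f <= size f)%N ->
  (tsz (Pdiv.Ring.rmodp h f) <= tsz h)%N.
Proof.
move=> mf tf; rewrite -[Pdiv.Ring.rmodp h f]mulr1.
apply: (@tsz_coprime_top f 1 (Pdiv.Ring.rdivp h f)); last first.
- by rewrite mulr1; exact: Pdiv.RingMonic.rdivp_eq.
- by rewrite size_top_monic // Pdiv.Ring.ltn_rmodpN0 // monic_neq0.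
- by rewrite /top /Phi rmorph1 hornerC lead_coef1 coprimep1.
Qed.
End Top.

Section Moments.
Variables (C : fieldType) (f : {poly {poly C}}) (N : nat).
Hypotheses (fm : f \is monic) (sf : size f = N.+1) (tf : (tsz f <= N.+1)%N).
Variables (n : nat) (X Y : 'I_n -> C).

Definition PiX : {poly C} := \prod_a ('X - (X a)%:P).
Definition Pi_ (a : 'I_n) : {poly C} := \prod_(b | b != a) ('X - (X b)%:P).
Definition quoY (a : 'I_n) : {poly {poly C}} := hquo f (Y a)%:P.
Definition quoX (a : 'I_n) : {poly C} := hquo f.[(Y a)%:P] (X a).
(** Divided by PiX, this is the rational function sum_a l_a Q_a / (x - X_a). *)
Definition multiplier (l : 'I_n -> C) : {poly {poly C}} :=
  \sum_a (l a *: Pi_ a)%:P * quoY a.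
(** Its coefficients are combinations of the sums sum_a l_a X_a ^ m Y_a ^ i, by
    [Pi_E]; a relation makes the ones of high degree vanish. *)
Definition moment (l : 'I_n -> C) (i : nat) : {poly C} :=
  \sum_a (l a * Y a ^+ i) *: Pi_ a.
(** The monomials of degree at most N - 3, with an addition in place of N - 3 so
    that there is no condition for N < 3. *)
Definition relation (N : nat) (l : 'I_n -> C) : Prop :=
  forall i j, (i + j + 3 <= N)%N -> \sum_a l a * (X a ^+ i * Y a ^+ j) = 0.

Lemma size_PiX : size PiX = n.+1.
Proof. by rewrite size_prod_XsubC /index_enum -enumT size_enum_ord. Qed.

Lemma PiX_monic : PiX \is monic. Proof. exact: monic_prod_XsubC. Qed.

Lemma PiXE a : PiX = Pi_ a * ('X - (X a)%:P).
Proof. by rewrite /PiX (bigD1 a) //= mulrC. Qed.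

Lemma Pi_E a : Pi_ a = hquo PiX (X a).
Proof.
have := hquoP PiX (X a); rewrite {1 2}(PiXE a) hornerM hornerXsubC subrr mulr0 add0r.
by move/mulIf; apply; rewrite polyXsubC_eq0.
Qed.

(** By Horner's scheme, the coefficient of x ^ k in Pi_ a is a combination of
    the X_a ^ m with m + k < n, so each vanishing sum removes one degree. *)
Lemma size_moment l s i : (forall m, (m < s)%N -> \sum_a l a * (X a ^+ m * Y a ^+ i) = 0) ->
  (size (moment l i) <= n - s)%N.
Proof.
move=> H; apply/leq_sizeP => k kn; rewrite coef_sum.
under eq_bigr => a _ do rewrite coefZ Pi_E coef_hquo mulr_sumr.
rewrite exchange_big /= big1 // => m _.
case: (ltnP m s) => ms; last first.
  rewrite big1 // => a _; rewrite nth_default ?mul0r ?mulr0 //.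
  by apply: (@leq_trans n.+1); [rewrite size_PiX | lia].
transitivity (PiX`_(m + k.+1) * \sum_a l a * (X a ^+ m * Y a ^+ i)).
  by rewrite mulr_sumr; apply: eq_bigr => a _; ring.
by rewrite H ?mulr0.
Qed.

Lemma coef_multiplier l j : (multiplier l)`_j = \sum_(i < N.+1) f`_(i + j.+1) * moment l i.
Proof.
rewrite coef_sum; under eq_bigr => a _ do rewrite coefCM coef_hquo mulr_sumr sf.
rewrite exchange_big /=; apply: eq_bigr => i _; rewrite mulr_sumr.
apply: eq_bigr => a _; rewrite -rmorphXn /= -!mul_polyC !polyCM; ring.
Qed.

Lemma size_multiplier l : (size (multiplier l) <= N)%N.
Proof.
apply/leq_sizeP => j jN; rewrite coef_multiplier big1 // => i _.
by rewrite nth_default ?mul0r // sf addnS ltnS (leq_trans jN) ?leq_addl.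
Qed.

(** A pole at infinity of the multiplier would come from the moments of l up to
    degree N - 3; a relation removes them. *)
Lemma tsz_multiplier l : relation N l -> (tsz (multiplier l) <= n.+1)%N.
Proof.
move=> rl; apply/tszP => k j nkj; rewrite coef_multiplier coef_sum big1 // => i _.
have [big|ij] := ltnP N (i + j.+1).
  by rewrite [f`_(_)]nth_default ?mul0r ?coef0 // sf.
have sM : (size (moment l i) <= n - (N - 2 - i))%N.
  by apply: size_moment => m mN; apply: rl; lia.
have sfi : (size (f`_(i + j.+1))%R <= N - i - j)%N.
  by apply/leq_sizeP => m mN; have /tszP := tf; apply; lia.
have [M0|M0] := posnP (size (moment l i)).
  by move/eqP: M0; rewrite size_poly_eq0 => /eqP ->; rewrite mulr0 coef0.
rewrite nth_default // (leq_trans (size_polyMleq _ _)) //.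
lia.
Qed.

Hypothesis Xinj : injective X.

Lemma horner_Pi_ a b : (Pi_ a).[X b] = 0 <-> a != b.
Proof.
split=> [|ab]; last first.
  by rewrite /Pi_ (bigD1 b) 1?eq_sym //= hornerM hornerXsubC subrr mul0r.
apply: contra_eqN => /eqP <-; rewrite horner_prod; apply/prodf_neq0 => c ca.
by rewrite hornerXsubC subr_eq0 (inj_eq Xinj) eq_sym.
Qed.

(** The coefficients of the multiplier in y are triangular in the moments of l,
    as f is monic in y. All moments of index below N - 1 vanish, and the last
    one equals c PiX, whose degree is too large unless c = 0. Then the moment of
    index 0, a combination of the Lagrange polynomials Pi_ a, is zero. *)
Lemma multiplier_injective l c : (0 < N)%N -> multiplier l = (c *: PiX)%:P -> l =1 fun=> 0.
Proof.
move=> N0 gc.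
have fN : f`_N = 1 by move/monicP: fm; rewrite lead_coefE sf.
have cg j : (multiplier l)`_j = \sum_(i < N - j) f`_(i + j.+1) * moment l i.
  rewrite coef_multiplier [RHS](big_ord_widen_cond N.+1 xpredT
    (fun i => f`_(i + j.+1) * moment l i)); last by lia.
  rewrite [RHS]big_mkcond; apply: eq_bigr => i _ /=.
  by case: ltnP => // ij; rewrite nth_default ?mul0r // sf; lia.
have M0 : forall i, (i.+1 < N)%N -> moment l i = 0.
  elim/ltn_ind => i IH iN; have := cg (N - i.+1)%N.
  have -> : (N - (N - i.+1) = i.+1)%N by lia.
  rewrite big_ord_recr /= big1 ?add0r; last first.
    by case=> m /= mi _; rewrite IH ?mulr0 //; lia.
  rewrite gc coefC; have -> : (N - i.+1 == 0)%N = false by lia.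
  have -> : (i + (N - i.+1).+1 = N)%N by lia.
  by rewrite fN mul1r.
have Mall i : (i < N)%N -> moment l i = 0.
  move=> iN; have [|] := ltnP i.+1 N; first exact: M0.
  move=> Ni; have {Ni iN} -> : i = N.-1 by lia.
  have := cg 0%N; rewrite subn0 -(prednK N0) big_ord_recr /= big1 ?add0r; last first.
    by case=> m /= mi _; rewrite M0 ?mulr0 //; lia.
  rewrite addn1 (prednK N0) fN mul1r gc coefC /= => <-.
  have [->|c0] := eqVneq c 0; first by rewrite scale0r.
  have : (size (moment l N.-1) <= n - 0)%N by apply: size_moment.
  have := cg 0%N; rewrite subn0 -(prednK N0) big_ord_recr /= big1 ?add0r; last first.
    by case=> m /= mi _; rewrite M0 ?mulr0 //; lia.
  rewrite addn1 (prednK N0) fN mul1r gc coefC /= => <-.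
  by rewrite size_scale // size_PiX subn0 ltnn.
move=> a; have /(congr1 (fun s => s.[X a])) := Mall 0%N N0.
rewrite horner0 horner_sum (bigD1 a) //= big1 ?addr0 => [|b ba].
  rewrite hornerZ mulr1 => /eqP; rewrite mulf_eq0 => /orP[/eqP//|/eqP].
  by move/horner_Pi_; rewrite eqxx.
by rewrite hornerZ (horner_Pi_ b a).2 ?mulr0.
Qed.
End Moments.

(** * Multipliers are constant on the components *)

Lemma linear_dependence (F : fieldType) (T : finType) (m : nat) (V : 'I_m -> T -> F) :
  (#|T| < m)%N ->
  exists2 u : 'I_m -> F, exists i, u i != 0 & forall t, \sum_i u i * V i t = 0.
Proof.
move=> Tm; pose A := \matrix_(i < m, j < #|T|) V i (enum_val j).
have /rowV0Pn[v vA v0] : kermx A != 0.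
  by rewrite kermx_eq0 /row_free neq_ltn (leq_ltn_trans (rank_leq_col A)).
exists (v 0) => [|t]; first by apply/rV0Pn.
have /sub_kermxP/rowP/(_ (enum_rank t)) := vA; rewrite !mxE => e; rewrite -[RHS]e.
by apply: eq_bigr => i _; rewrite mxE enum_rankK.
Qed.

Lemma irreducible_coprimep (R : idomainType) (p a : {poly R}) :
  irreducible_poly p -> ~~ (p %| a) -> coprimep p a.
Proof.
move=> [_ irr]; apply: contraNT => nc; have := irr (gcdp p a).
rewrite -coprimep_def nc dvdp_gcdl => /(_ isT isT) e.
by rewrite -(eqp_dvdl _ e) dvdp_gcdr.
Qed.

Lemma irreducible_dvdpM (R : idomainType) (p a b : {poly R}) :
  irreducible_poly p -> p %| a * b -> (p %| a) || (p %| b).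
Proof.
move=> ip pab; have [//|/(irreducible_coprimep ip) cp] := boolP (p %| a).
by rewrite -(Gauss_dvdpr b cp).
Qed.

Lemma irreducible_dvdX (R : idomainType) (p a : {poly R}) n :
  irreducible_poly p -> p %| a ^+ n -> p %| a.
Proof.
move=> ip; elim: n => [|n IH]; last first.
  by rewrite exprS => /(irreducible_dvdpM ip)/orP[].
by rewrite expr0 dvdp1 => /eqP e; case: ip; rewrite e.
Qed.

Section Components.
Variables (C : closedFieldType).
Local Notation P := {poly {poly C}}.

(** h ^ K s (g / h), for deg s <= K. *)
Definition homogenized_value (g h : P) (s : {poly C}) (K : nat) : P :=
  \sum_(m < K.+1) (s`_m)%:P%:P * (g ^+ m * h ^+ (K - m)).

(** If s (g / h) = 0 on the curve p = 0, then g / h is a root of s there, as s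
    splits over an algebraically closed field. *)
Lemma dvdp_homogenized_value (p g h : P) : irreducible_poly p -> ~~ (p %| h) ->
  forall (K : nat) (s : {poly C}), s != 0 -> (size s <= K.+1)%N ->
    p %| homogenized_value g h s K -> exists c : C, p %| g - c%:P%:P * h.
Proof.
move=> ip nh; elim=> [|K IH] s s0 sK.
  rewrite /homogenized_value big_ord1 !expr0 !mulr1.
  rewrite (size1_polyC sK) coefC eqxx in s0 *.
  move=> /dvdp_leq; rewrite !polyC_eq0; move: s0; rewrite polyC_eq0 => s0 /(_ s0).
  by rewrite size_polyC polyC_eq0 s0 leqNgt; case: ip => ->.
have [/eqP s1|] := boolP (size s == 1%N).
  have e : s = (s`_0)%:P by apply: size1_polyC; rewrite s1.
  rewrite /homogenized_value big_ord_recl big1 ?addr0; last first.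
    by move=> i _; rewrite e coefC /= !polyC0 mul0r.
  rewrite expr0 mul1r => /(irreducible_dvdpM ip)/orP[|/(irreducible_dvdX ip)].
    move=> /dvdp_leq; rewrite !polyC_eq0; move: s0.
    rewrite {1}e polyC_eq0 => s0 /(_ s0).
    by rewrite size_polyC polyC_eq0 s0 leqNgt; case: ip => ->.
  by rewrite (negbTE nh).
move=> /closed_rootP[c /factor_theorem[s' es]].
have s'0 : s' != 0 by apply: contraNneq s0 => e; rewrite es e mul0r.
have s'K : (size s' <= K.+1)%N.
  by move: sK; rewrite es size_Mmonic ?monicXsubC // size_XsubC addn2.
have -> : homogenized_value g h s K.+1 =
    (g - c%:P%:P * h) * homogenized_value g h s' K.
  pose t (m : nat) : P := g ^+ m * h ^+ (K.+1 - m).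
  have sE m : (s`_m)%:P%:P * t m =
      (('X * s')`_m)%:P%:P * t m - ((c%:P * s')`_m)%:P%:P * t m.
    have -> : s = 'X * s' - c%:P * s' by rewrite es; ring.
    by rewrite coefB !polyCB mulrBl.
  transitivity (\sum_(m < K.+2) ((('X * s')`_m)%:P%:P * t m -
                                 ((c%:P * s')`_m)%:P%:P * t m)).
    by apply: eq_bigr => m _; exact: sE.
  rewrite sumrB mulrBl /t; congr (_ - _).
    rewrite big_ord_recl coefXM /= !polyC0 mul0r add0r mulr_sumr.
    apply: eq_bigr => i _.
    by rewrite coefXM /= /bump /= add1n subSS exprS; ring.
  rewrite big_ord_recr coefCM [s'`_K.+1]nth_default // mulr0 !polyC0 mul0r /= addr0.
  rewrite mulr_sumr; apply: eq_bigr => i _; rewrite coefCM !polyCM.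
  by rewrite subSn ?exprS; [ring | rewrite -ltnS].
move=> /(irreducible_dvdpM ip)/orP[pc|]; first by exists c.
exact: IH.
Qed.

Variables (f : P) (N : nat).
Hypotheses (fm : f \is monic) (sf : size f = N.+1) (tf : (tsz f <= N.+1)%N).
Variables (n : nat) (X Y : 'I_n -> C).
Hypothesis Xinj : injective X.
Local Notation pt a := (X a, Y a).
Local Notation Q := (quoY f Y).
Local Notation k := (quoX f X Y).
Local Notation Pi := (PiX X).
Local Notation g := (multiplier f X Y).
Hypothesis f0 : forall a, ev (pt a) f = 0.
Hypothesis Q0 : forall a, ev (pt a) (Q a) = 0.
Hypothesis k0 : forall a, (k a).[X a] = 0.

Let vanish (h : P) := forall a, ev (pt a) h = 0.

(** Multiplication by phi = g l / PiX preserves the functions vanishing at all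
    the points: at the point a the function Q_a h / (x - X_a) equals h1 Q_a - h2
    K_a for h = h1 (x - X_a) + h2 (y - Y_a), where Q_a and K_a vanish at a.
    Reducing modulo f keeps the total degree down. *)
Lemma multiplier_step l (h : P) : relation X Y N l -> vanish h ->
    (tsz h <= n.+1)%N ->
  exists w, [/\ vanish w, (tsz w <= n.+1)%N & f %| g l * h - Pi%:P * w].
Proof.
move=> rl h0 th.
pose h1 a := (hquo h.[(Y a)%:P] (X a))%:P; pose h2 a := hquo h (Y a)%:P.
pose w0 := \sum_a (l a)%:P%:P * (h1 a * Q a - h2 a * (k a)%:P).
have fE a : f = (k a)%:P * ('X - (X a)%:P)%:P + Q a * ('X - (Y a)%:P%:P).
  exact: split_at.
have hE a : h = h1 a * ('X - (X a)%:P)%:P + h2 a * ('X - (Y a)%:P%:P).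
  exact: split_at.
have key1 (Qx kx H1 H2 x y F H : P) : F = kx * x + Qx * y -> H = H1 * x + H2 * y ->
    x * (H1 * Qx - H2 * kx) = H * Qx - H2 * F by move=> -> ->; ring.
have key2 (L Pa Qx kx H1 H2 x y F H : P) :
    F = kx * x + Qx * y -> H = H1 * x + H2 * y ->
    L * Pa * Qx * H - Pa * x * (L * (H1 * Qx - H2 * kx)) = L * (Pa * H2) * F.
  by move=> -> ->; ring.
(* w0 represents phi h. At a point b other than a, the term of a is
   h Q_a / (x - X_a) modulo f, with X_b <> X_a. *)
have w00 : vanish w0.
  move=> b; rewrite /w0 ev_sum big1 // => a _; rewrite evM.
  have [<-|ab] := eqVneq a b.
    by rewrite evB !evM Q0 [ev _ (k a)%:P]evC k0 !mulr0 subrr mulr0.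
  have : ev (pt b) (('X - (X a)%:P)%:P * (h1 a * Q a - h2 a * (k a)%:P)) = 0.
    rewrite (key1 _ _ _ _ _ _ _ _ (fE a) (hE a)).
    by rewrite evB !evM h0 f0 mul0r mulr0 subrr.
  rewrite evM [ev _ (_ - _)%:P]evC hornerXsubC => /eqP; rewrite mulf_eq0 subr_eq0 (inj_eq Xinj).
  by rewrite eq_sym (negbTE ab) => /eqP ->; rewrite mulr0.
have gh : f %| g l * h - Pi%:P * w0.
  have -> : g l * h - Pi%:P * w0 =
      (\sum_a (l a)%:P%:P * ((Pi_ X a)%:P * h2 a)) * f.
    rewrite /multiplier /w0 mulr_sumr !mulr_suml -sumrB; apply: eq_bigr => a _.
    rewrite (PiXE X a) -mul_polyC !polyCM; exact: key2 (fE a) (hE a).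
  exact: dvdp_mulIr.
pose w := w0 %% f.
have ww : f %| w0 - w.
  have := Pdiv.IdomainMonic.divp_eq fm w0; rewrite -/w => {1}->.
  by rewrite addrK dvdp_mulIr.
have fw : f %| g l * h - Pi%:P * w.
  have -> : g l * h - Pi%:P * w = (g l * h - Pi%:P * w0) + Pi%:P * (w0 - w).
    by ring.
  by rewrite dvdp_add // dvdp_mull.
exists w; split=> //.
  move=> a; move: ww => /(Pdiv.IdomainMonic.dvdpP fm)[q e].
  have -> : w = w0 - q * f by rewrite -e; ring.
  by rewrite evB evM f0 w00 mulr0 subrr.
have [->|wn0] := eqVneq w 0; first by rewrite tsz0.
have Pi0 : Pi != 0 by rewrite monic_neq0 ?PiX_monic.
have : (tsz (Pi%:P * w) <= tsz (g l * h))%N.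
  have -> : Pi%:P * w = Pdiv.Ring.rmodp (g l * h) f.
    move: fw => /(Pdiv.IdomainMonic.dvdpP fm)[q e].
    have -> : g l * h = q * f + Pi%:P * w by rewrite -e; ring.
    rewrite Pdiv.RingMonic.rmodp_addl_mul_small // mul_polyC.
    by rewrite (leq_ltn_trans (size_scale_leq _ _)) // ltn_modp monic_neq0.
  by apply: tsz_rmodp => //; rewrite sf.
have -> : tsz (Pi%:P * w) = (n.+1 + tsz w).-1.
  by rewrite tszM ?polyC_eq0 // tszC size_PiX.
move=> /leq_trans/(_ (tszM_leq _ _)).
pose proof (tsz_multiplier fm sf tf rl) as tg.
lia.
Qed.

(** The powers of phi times PiX stay in the space of polynomials of total degree
    at most n, whose dimension does not depend on m. *)
Lemma multiplier_powers l : relation X Y N l -> forall m,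
  exists h, (tsz h <= n.+1)%N /\ f %| g l ^+ m * Pi%:P - Pi%:P ^+ m * h.
Proof.
move=> rl m; suff [h [_ ? ?]] : exists h, [/\ vanish h, (tsz h <= n.+1)%N &
    f %| g l ^+ m * Pi%:P - Pi%:P ^+ m * h] by exists h.
elim: m => [|m [h [h0 th fh]]].
  exists Pi%:P; split; last by rewrite !expr0 !mul1r subrr dvdp0.
    by move=> a; rewrite evC (PiXE X a) hornerM hornerXsubC subrr mulr0.
  by rewrite tszC size_PiX.
have [w [w0 tw fw]] := multiplier_step rl h0 th.
exists w; split=> //.
have -> : g l ^+ m.+1 * Pi%:P - Pi%:P ^+ m.+1 * w =
  g l * (g l ^+ m * Pi%:P - Pi%:P ^+ m * h) + Pi%:P ^+ m * (g l * h - Pi%:P * w).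
  by rewrite !exprS; ring.
by rewrite dvdp_add // dvdp_mull.
Qed.

Lemma irreducible_ndvdC (p : P) (s : {poly C}) :
  irreducible_poly p -> s != 0 -> ~~ (p %| s%:P).
Proof.
move=> [sp _] s0; apply/negP => /dvdp_leq; rewrite polyC_eq0 => /(_ s0).
by rewrite size_polyC s0 leqNgt sp.
Qed.

(** The functions phi ^ m PiX lie in a finite dimensional space, so phi
    satisfies a polynomial equation over C on every component, and takes there a
    single value. *)
Lemma multiplier_constant l p : relation X Y N l -> irreducible_poly p -> p %| f ->
  exists c : C, p %| g l - c%:P%:P * Pi%:P.
Proof.
move=> rl ip pf.
(* More powers of phi than monomials x ^ i y ^ j with i, j <= n. *)
pose K := (n.+1 * n.+1)%N.
have Hm (m : 'I_K.+1) : exists h, (tsz h <= n.+1)%N /\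
    f %| g l ^+ m * Pi%:P - Pi%:P ^+ m * h by exact: multiplier_powers.
have [h hP] := fin_all_exists Hm.
pose V (m : 'I_K.+1) (ij : 'I_n.+1 * 'I_n.+1) := (h m)`_(ij.2)`_(ij.1).
have [|u [m0 um0] uV] := @linear_dependence _ _ _ V.
  by rewrite card_prod !card_ord.
have uh : \sum_m (u m)%:P%:P * h m = 0.
  apply/polyP => j; apply/polyP => i; rewrite !coef0 !coef_sum.
  under eq_bigr => m _ do rewrite !coefCM.
  case: (ltnP i n.+1) => [ilt|ige]; last first.
    rewrite big1 // => m _; have [/tszP th _] := hP m.
    by rewrite th ?mulr0 // (leq_trans ige) ?leq_addr.
  case: (ltnP j n.+1) => [jlt|jge]; last first.
    rewrite big1 // => m _; have [/tszP th _] := hP m.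
    by rewrite th ?mulr0 // (leq_trans jge) ?leq_addl.
  exact: (uV (Ordinal ilt, Ordinal jlt)).
pose s := \poly_(m < K.+1) u (inord m).
apply: (@dvdp_homogenized_value p (g l) Pi%:P ip _ K s).
- by rewrite irreducible_ndvdC // monic_neq0 ?PiX_monic.
- apply: contraNneq um0 => s0; have := coef_poly K.+1 (fun m => u (inord m)) m0.
  by rewrite -/s s0 coef0 ltn_ord inord_val => <-.
- exact: size_poly.
apply: (dvdp_trans pf).
have : f %| Pi *: homogenized_value (g l) Pi%:P s K.
  have -> : Pi *: homogenized_value (g l) Pi%:P s K =
    \sum_(m < K.+1) (u m)%:P%:P * Pi%:P ^+ (K - m) *
        (g l ^+ m * Pi%:P - Pi%:P ^+ m * h m) +
    Pi%:P ^+ K * \sum_m (u m)%:P%:P * h m.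
    rewrite -mul_polyC /homogenized_value !mulr_sumr -big_split.
    apply: eq_bigr => m _; rewrite coef_poly ltn_ord inord_val /=.
    have <- : Pi%:P ^+ (K - m) * Pi%:P ^+ m = Pi%:P ^+ K.
      by rewrite -exprD subnK // -ltnS.
    by ring.
  rewrite uh mulr0 addr0; apply: (big_ind (fun s => f %| s)) => [|a b|m _]; first exact: dvdp0.
    exact: dvdp_add.
  by rewrite dvdp_mull //; have [] := hP m.
by rewrite dvdpZr // monic_neq0 ?PiX_monic.
Qed.

Variables (r : nat) (p : 'I_r -> P).
Hypothesis p_irr : forall t, irreducible_poly (p t).
Hypothesis p_f : forall t, p t %| f.
Hypothesis f_p : forall h : P, (forall t, p t %| h) -> f %| h.

Lemma components_dvdp_eq0 (h : P) :
  (forall t, p t %| h) -> (size h <= N)%N -> h = 0.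
Proof.
move=> ph sh; apply/eqP; apply: contraT => h0.
by have := dvdp_leq h0 (f_p ph); rewrite sf leqNgt ltnS sh.
Qed.

Hypothesis N0 : (0 < N)%N.

Lemma multiplier_sum (m : nat) (u : 'I_m -> C) (l : 'I_m -> 'I_n -> C) :
  g (fun a => \sum_i u i * l i a) = \sum_i (u i)%:P%:P * g (l i).
Proof.
rewrite /multiplier; under [RHS]eq_bigr => i _ do rewrite mulr_sumr.
rewrite exchange_big /=; apply: eq_bigr => a _; rewrite scaler_suml.
rewrite rmorph_sum /= mulr_suml; apply: eq_bigr => i _.
by rewrite -!mul_polyC !polyCM; ring.
Qed.

(** Each relation has r constants, its values on the components. If m >= r, some
    combination of the m vectors of constants and of (1, ..., 1) vanishes; the
    corresponding combination of the multipliers and PiX is 0 by its degree in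
    y, and [multiplier_injective] makes the relations dependent. *)
Theorem independent_relations_ltn (m : nat) (l : 'I_m -> 'I_n -> C) :
  (forall i, relation X Y N (l i)) ->
  (forall u : 'I_m -> C, (forall a, \sum_i u i * l i a = 0) -> u =1 fun=> 0) ->
  (m < r)%N.
Proof.
move=> rl free_l; rewrite ltnNge; apply/negP => rm.
have Hc (it : 'I_m * 'I_r) : exists c : C, p it.2 %| g (l it.1) - c%:P%:P * Pi%:P.
  exact: multiplier_constant.
have [c cP] := fin_all_exists Hc.
(* The row of index 0 is the vector (1, ..., 1). *)
pose V (i : 'I_m.+1) (t : 'I_r) := if unlift ord0 i is Some j then c (j, t) else 1.
have [|u [i0 ui0] uV] := @linear_dependence _ _ _ V; first by rewrite card_ord.
pose v i := u (lift ord0 i).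
have gv : g (fun a => \sum_i v i * l i a) + (u ord0)%:P%:P * Pi%:P = 0.
  apply: components_dvdp_eq0 => [t|]; last first.
    rewrite (leq_trans (size_polyD _ _)) // geq_max size_multiplier // -polyCM.
    by rewrite (leq_trans (size_polyC_leq1 _)).
  have -> : (u ord0)%:P%:P = - (\sum_i (v i)%:P%:P * (c (i, t))%:P%:P) :> P.
    have := uV t; rewrite big_ord_recl /V unlift_none mulr1 => /eqP.
    rewrite addr_eq0 => /eqP ->; rewrite !polyCN !rmorph_sum /=; congr (- _).
    by apply: eq_bigr => i _; rewrite liftK !polyCM.
  rewrite multiplier_sum mulNr mulr_suml -sumrB.
  apply: (big_ind (fun s => p t %| s)) => [|a b|i _]; [exact: dvdp0 | exact: dvdp_add |].
  by rewrite -mulrA -mulrBr dvdp_mull // (cP (i, t)).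
have g0 : g (fun a => \sum_i v i * l i a) = (- u ord0 *: Pi)%:P.
  by move/eqP: gv; rewrite addr_eq0 => /eqP ->; rewrite -mul_polyC !polyCM !polyCN mulNr.
have v0 := free_l v (multiplier_injective fm sf tf Xinj N0 g0).
have u0 : u ord0 = 0.
  move/eqP: gv; rewrite multiplier_sum big1 ?add0r => [|i _]; last first.
    by rewrite v0 !polyC0 mul0r.
  by rewrite mulf_eq0 !polyC_eq0 (negbTE (monic_neq0 (PiX_monic X))) orbF => /eqP.
move: ui0; case: (unliftP ord0 i0) => [j|] ->; last by rewrite u0 eqxx.
by rewrite -/(v j) v0 eqxx.
Qed.

(** Both l and X l are relations in degree N - 3, and their multipliers are
    proportional up to a multiple s of PiX: phi_(X l) = x phi_l - s. On a
    component both are constants c' and c, so c x = c' + s there, whence c = 0. *)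
Theorem relation_succ_eq0 (l : 'I_n -> C) : relation X Y N.+1 l -> l =1 fun=> 0.
Proof.
move=> rl.
have rl0 : relation X Y N l by move=> i j ij; apply: rl; rewrite leqW.
have rl1 : relation X Y N (fun a => X a * l a).
  move=> i j ij; rewrite -[RHS](rl i.+1 j) //.
  by apply: eq_bigr => a _; rewrite exprS; ring.
(* The sum of the l_a Q_a is the constant s: its coefficients in y are
   combinations of the sums of l_a Y_a ^ i with i < N, and all but the last
   of these vanish. *)
pose s := \sum_a l a * Y a ^+ N.-1.
have gX : g (fun a => X a * l a) = 'X%:P * g l - s%:P%:P * Pi%:P.
  have sQ : \sum_a (l a)%:P%:P * Q a = s%:P%:P.
    apply/polyP => j; rewrite coef_sum coefC.
    under eq_bigr => a _ do rewrite coefCM coef_hquo sf mulr_sumr.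
    rewrite exchange_big /=.
    have H i : (i < N)%N -> \sum_a (l a)%:P * (f`_(i + j.+1) * (Y a)%:P ^+ i) =
        if i == N.-1 then f`_(i + j.+1) * s%:P else 0.
      move=> iN; transitivity (f`_(i + j.+1) * (\sum_a l a * Y a ^+ i)%:P).
        rewrite rmorph_sum mulr_sumr; apply: eq_bigr => a _.
        by rewrite /= polyCM rmorphXn /=; ring.
      case: eqP => [->//|iN1]; have := rl 0%N i.
      under eq_bigr do rewrite expr0 mul1r.
      by move=> ->; rewrite ?polyC0 ?mulr0 //; lia.
    rewrite big_ord_recr /= [X in _ + X]big1 ?addr0; last first.
      by move=> a _; rewrite [f`_(_)]nth_default ?mul0r ?mulr0 // sf addnS ltnS leq_addr.
    rewrite (eq_bigr (fun i : 'I_N => if nat_of_ord i == N.-1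
        then f`_(i + j.+1) * s%:P else 0)) => [|i _]; last exact: H.
    rewrite -big_mkcond /=.
    have N1 : (N.-1 < N)%N by rewrite prednK.
    rewrite (big_pred1 (Ordinal N1)) //=.
    rewrite addnS -addSn (prednK N0); case: j {H} => [|j] /=.
      by rewrite addn0 -[X in f`_X]/(N.+1.-1) -sf -lead_coefE (monicP fm) mul1r.
    by rewrite nth_default ?mul0r // sf addnS ltnS leq_addr.
  rewrite -sQ /multiplier mulr_sumr mulr_suml -sumrB; apply: eq_bigr => a _.
  by rewrite (PiXE X a) -!mul_polyC !polyCM polyCB; ring.
have gl0 : g l = 0.
  apply: components_dvdp_eq0 => [t|]; last exact: size_multiplier.
  (* On the component p t, the functions phi_l = c and x phi_l - s = c' are
     constant, so that c x - (s + c') is divisible by p t. *)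
  have [c pc] := multiplier_constant rl0 (p_irr t) (p_f t).
  have [c' pc'] := multiplier_constant rl1 (p_irr t) (p_f t).
  suff c0 : c = 0 by move: pc; rewrite c0 !polyC0 mul0r subr0.
  have : p t %| Pi *: (c *: 'X - (s + c')%:P)%:P.
    have -> : Pi *: (c *: 'X - (s + c')%:P)%:P =
      (g (fun a => X a * l a) - c'%:P%:P * Pi%:P) -
        'X%:P * (g l - c%:P%:P * Pi%:P).
      by rewrite gX -!mul_polyC !polyCB !polyCM !polyCD; ring.
    by rewrite dvdp_sub // dvdp_mull.
  rewrite dvdpZr ?monic_neq0 ?PiX_monic //; apply: contraTeq => c0.
  apply: irreducible_ndvdC => //; apply/eqP => /(congr1 (fun q : {poly C} => q`_1)).
  rewrite coefB coefZ coefX coefC coef0 mulr1 subr0; exact/eqP.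
apply: (multiplier_injective (Y := Y) fm sf tf Xinj N0 (c := 0)).
by rewrite gl0 scale0r polyC0.
Qed.
End Components.

(** * Gauss's lemma *)

Section Gauss.
Variable C : closedFieldType.
Local Notation P := {poly {poly C}}.
Implicit Types (p q a b : P).

(** All coefficients of a vanish at c, so each of them is divisible by X - c. *)
Lemma linear_content a (c : C) :
  map_poly (horner_eval c) a = 0 -> exists a', a = ('X - c%:P) *: a'.
Proof.
move=> a0; exists (map_poly (fun s : {poly C} => s %/ ('X - c%:P)) a).
apply/polyP => j; rewrite coefZ coef_map_id0 ?div0p //.
have /polyP/(_ j) := a0; rewrite coef_map coef0 /= /horner_eval => aj.
by rewrite mulrC divpK // dvdp_XsubCl; apply/rootP.
Qed.

(** Gauss's lemma: the linear factors of d are removed one by one, each of them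
    being prime in {poly {poly C}}. *)
Lemma clear_content (d : {poly C}) p a b : d != 0 -> d *: p = a * b ->
  exists a' b' : P, exists d1 d2 : {poly C},
    [/\ p = a' * b', a = d1 *: a' & b = d2 *: b'].
Proof.
have [m] := ubnP (size d); elim: m => // m IH in d p a b *.
rewrite ltnS => dm d0 e.
have [/eqP s1|] := boolP (size d == 1%N).
  have ed : d = (d`_0)%:P by apply: size1_polyC; rewrite s1.
  have c0 : d`_0 != 0 by apply: contraNneq d0 => z; rewrite ed z.
  exists ((d`_0)^-1%:P *: a), b, d, 1; split; last by rewrite scale1r.
    by rewrite -scalerAl -e scalerA ed coefC /= -polyCM mulVf // polyC1 scale1r.
  by rewrite scalerA ed coefC /= -polyCM mulfV // polyC1 scale1r.
move=> /closed_rootP[c /factor_theorem[d' ed]].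
have d'0 : d' != 0 by apply: contraNneq d0 => z; rewrite ed z mul0r.
have sd' : (size d' < m)%N.
  by move: dm; rewrite ed size_Mmonic ?monicXsubC // size_XsubC addn2.
have : map_poly (horner_eval c) (a * b) = 0.
  rewrite -e -mul_polyC rmorphM /= map_polyC /= /horner_eval ed hornerM.
  by rewrite hornerXsubC subrr mulr0 polyC0 mul0r.
have X0 : 'X - c%:P != 0 :> {poly C} by rewrite polyXsubC_eq0.
have scalI (s t : P) : ('X - c%:P) *: s = ('X - c%:P) *: t -> s = t.
  by rewrite -!mul_polyC; apply: mulfI; rewrite polyC_eq0.
rewrite rmorphM => /eqP; rewrite mulf_eq0.
move=> /orP[] /eqP/linear_content[s es].
  have [|a' [b' [d1 [d2 [e1 e2 e3]]]]] := IH d' p s b sd' d'0.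
    by apply: scalI; rewrite scalerA mulrC -ed e es scalerAl.
  by exists a', b', (('X - c%:P) * d1), d2; split=> //; rewrite es e2 scalerA.
have [|a' [b' [d1 [d2 [e1 e2 e3]]]]] := IH d' p a s sd' d'0.
  by apply: scalI; rewrite scalerA mulrC -ed e es scalerAr.
by exists a', b', d1, (('X - c%:P) * d2); split=> //; rewrite es e3 scalerA.
Qed.

(** [irreducible_poly] is about divisibility up to nonzero factors in {poly C},
    that is about C(x)[y]; Gauss's lemma brings it back to factorizations in
    C[x, y]. *)
Lemma gauss_irreducible p : (1 < size p)%N ->
  (forall a b, p = a * b -> size a = 1%N \/ size b = 1%N) -> irreducible_poly p.
Proof.
move=> sp fac; split=> // q sq /Pdiv.Idomain.dvdpP[[c u] /= c0].
have p0 : p != 0 by rewrite -size_poly_gt0 ltnW.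
move=> E; have [a [b [d1 [d2 [e1 e2 e3]]]]] := clear_content c0 E.
have d20 : d2 != 0.
  apply: contraNneq p0 => d0; move/eqP: E.
  by rewrite e3 d0 scale0r mulr0 -mul_polyC mulf_eq0 polyC_eq0 (negbTE c0).
have sb : size b != 1%N by rewrite -(size_scale b d20) -e3.
have [sa|/eqP] := fac _ _ e1; last by rewrite (negbTE sb).
apply/Pdiv.Idomain.eqpP; exists (a`_0, d2) => /=.
  rewrite d20 andbT; apply: contraNneq p0 => a0.
  by rewrite e1 (size1_polyC (eq_leq sa)) a0 polyC0 mul0r.
by rewrite e1 (size1_polyC (eq_leq sa)) coefC /= mul_polyC e3 !scalerA mulrC.
Qed.
End Gauss.

(** * Ideals of transversal intersections *)

Section Partial.
Variable C : fieldType.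
Local Notation P := {poly {poly C}}.
Implicit Types (h s : P) (a : C * C).

(** The derivative in x; the one in y is [deriv]. *)
Definition dx h : P := map_poly (@deriv C) h.

Lemma coef_dx h j : (dx h)`_j = (h`_j)^`().
Proof. by rewrite coef_map. Qed.

Lemma dxD s h : dx (s + h) = dx s + dx h.
Proof. by apply/polyP => j; rewrite coefD !coef_dx coefD derivD. Qed.

Lemma dxC (s : {poly C}) : dx s%:P = (s^`())%:P.
Proof. by rewrite /dx map_polyC. Qed.

Lemma dxX : dx 'X = 0.
Proof.
apply/polyP => j; rewrite coef_dx coefX coef0.
by case: eqP => _ /=; rewrite -?polyC1 -?polyC0 derivC.
Qed.

Lemma dxM s h : dx (s * h) = dx s * h + s * dx h.
Proof.
apply/polyP => j; rewrite coef_dx coefD !coefM raddf_sum -big_split.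
by apply: eq_bigr => i _; rewrite /= derivM !coef_dx.
Qed.

Lemma ev_split a h (s t : P) :
  h = s * ('X - a.1%:P)%:P + t * ('X - a.2%:P%:P) ->
  ev a (dx h) = ev a s /\ ev a h^`() = ev a t.
Proof.
set U := ('X - a.1%:P)%:P; set W := 'X - a.2%:P%:P; move=> ->.
have U0 : ev a U = 0 by rewrite evC hornerXsubC subrr.
have W0 : ev a W = 0 by rewrite evB evX evC hornerC subrr.
have dU : dx U = 1 by rewrite dxC derivXsubC.
have dW : dx W = 0 by rewrite /W -polyCN -polyCN dxD dxX dxC derivC polyC0 addr0.
have U' : U^`() = 0 := derivC _.
have W' : W^`() = 1 := derivXsubC _.
rewrite dxD !dxM derivD !derivM dU dW U' W' !mulr0 !mulr1 !addr0.
by rewrite !evD !evM U0 W0 !mulr0 !add0r addr0.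
Qed.
End Partial.

Section Radical.
Variable C : closedFieldType.
Local Notation P := {poly {poly C}}.
Variables p q : P.

Definition in_ideal (h : P) : Prop := exists u v : P, h = u * p + v * q.

Lemma in_idealD s t : in_ideal s -> in_ideal t -> in_ideal (s + t).
Proof.
by move=> [u [v ->]] [u' [v' ->]]; exists (u + u'), (v + v'); ring.
Qed.

Lemma in_idealM s t : in_ideal t -> in_ideal (s * t).
Proof. by move=> [u [v ->]]; exists (s * u), (s * v); ring. Qed.

Lemma in_idealMr s t : in_ideal t -> in_ideal (t * s).
Proof. by rewrite mulrC; apply: in_idealM. Qed.

(** Multiply h by the F z one after the other, and stop at the first product
    that lies in the ideal. *)
Lemma last_factor (T : eqType) (F : T -> P) (s : seq T) (h : P) :
  ~ in_ideal h -> in_ideal (h * \prod_(z <- s) F z) ->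
  exists z g, ~ in_ideal (h * g) /\ in_ideal (h * g * F z).
Proof.
elim: s h => [|z s IH] h nh; first by rewrite big_nil mulr1.
rewrite big_cons mulrA; case: (pselect (in_ideal (h * F z))) => [hz _|nz hs].
  by exists z, 1; rewrite mulr1.
have [z' [g [ng hg]]] := IH _ nz hs.
by exists z', (F z * g); rewrite !mulrA.
Qed.

(** The ideal (p, q) is radical when the curves meet transversally. If h is not
    in it, the eliminant R and then the fibre of p over a root of R yield a
    multiple k of h outside the ideal and a point a such that (x - a1) k and
    (y - a2) k are in it. Then every polynomial multiplying k into the ideal
    vanishes at a; so p and q vanish at a, and so do h and k. By Cramer's rule a
    polynomial whose value at a is the Jacobian determinant of p and q also
    multiplies k into the ideal, contradicting transversality. *)
Lemma transversal_radical (R : {poly C}) (h : P) :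
  p \is monic -> R != 0 -> in_ideal R%:P ->
  (forall a, ev a p = 0 -> ev a q = 0 ->
     ev a (dx p) * ev a q^`() - ev a p^`() * ev a (dx q) != 0) ->
  (forall a, ev a p = 0 -> ev a q = 0 -> ev a h = 0) -> in_ideal h.
Proof.
move=> mp R0 IR trans h0; case: (pselect (in_ideal h)) => // nh; exfalso.
have [rs eR] := closed_field_poly_normal R.
have IhR : in_ideal (h * \prod_(z <- rs) ('X - z%:P)%:P).
  have lR : lead_coef R != 0 by rewrite lead_coef_eq0.
  have <- : (lead_coef R)^-1%:P%:P * R%:P = \prod_(z <- rs) ('X - z%:P)%:P :> P.
    rewrite {2}eR -polyCM mul_polyC scalerA mulVf // scale1r.
    by rewrite (big_morph _ (@polyCM _) (polyC1 _)).
  by do 2!apply: in_idealM.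
have [x [g1 [ng1 Ig1]]] := last_factor nh IhR.
pose px : {poly C} := map_poly (horner_eval x) p.
have px_mod : exists s : P, p = map_poly polyC px + ('X - x%:P)%:P * s.
  have [|s es] := @linear_content C (p - map_poly polyC px) x.
    rewrite rmorphB /= -/px -map_poly_comp map_poly_id ?subrr // => c _ /=.
    by rewrite /horner_eval hornerC.
  by exists s; rewrite mul_polyC -es addrC subrK.
have mpx : px \is monic by rewrite monic_map.
have [ys epx] := closed_field_poly_normal px.
have Ipx : in_ideal (h * g1 * \prod_(z <- ys) ('X - z%:P%:P)).
  have -> : \prod_(z <- ys) ('X - z%:P%:P) = map_poly polyC px :> P.
    rewrite epx (monicP mpx) scale1r rmorph_prod /=; apply: eq_bigr => z _.
    by rewrite rmorphB /= map_polyX map_polyC.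
  have [s es] := px_mod.
  have -> : h * g1 * map_poly polyC px =
      (h * g1) * p + (- s) * (h * g1 * ('X - x%:P)%:P) by rewrite {1}es; ring.
  apply: in_idealD; last exact: in_idealM.
  by apply: in_idealM; exists 1, 0; ring.
have [y [g2 [ng2 Ig2]]] := last_factor ng1 Ipx.
pose a := (x, y); set k := h * g1 * g2 in ng2 Ig2.
have Ikx : in_ideal (k * ('X - x%:P)%:P).
  by rewrite /k mulrAC; apply: in_idealMr.
have split (s : P) : exists s1 s2 : P, s = (ev a s)%:P%:P +
    (s1 * ('X - a.1%:P)%:P + s2 * ('X - a.2%:P%:P)).
  have e : ev (x, y) (s - (ev a s)%:P%:P) = 0.
    by rewrite evB [X in _ - X]evC hornerC subrr.
  exists (hquo (s - (ev a s)%:P%:P).[y%:P] x)%:P.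
  exists (hquo (s - (ev a s)%:P%:P) y%:P).
  by rewrite -(split_at e) addrC subrK.
have key (K S E A B t1 t2 : P) : S = E + (A * t1 + B * t2) ->
    K * S + - A * (K * t1) + - B * (K * t2) = E * K by move=> ->; ring.
have Ikev (s : P) : in_ideal (k * s) -> ev a s = 0 \/ in_ideal k.
  move=> Is; have [s1 [s2 es]] := split s.
  case: (eqVneq (ev a s) 0) => [|e0]; [by left | right].
  have -> : k = (ev a s)^-1%:P%:P * (k * s + - s1 * (k * ('X - a.1%:P)%:P) +
      - s2 * (k * ('X - a.2%:P%:P))).
    by rewrite (key _ _ _ _ _ _ _ es) mulrA -!polyCM mulVf // !polyC1 mul1r.
  apply: in_idealM; apply: in_idealD; last exact: in_idealM.
  by apply: in_idealD; last exact: in_idealM.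
have p0 : ev a p = 0.
  by have [] // := Ikev p; apply: in_idealM; exists 1, 0; ring.
have q0 : ev a q = 0.
  by have [] // := Ikev q; apply: in_idealM; exists 0, 1; ring.
have k0 : ev a k = 0 by rewrite /k !evM (h0 a) // !mul0r.
have [p1 [p2 ep]] := split p; rewrite p0 !polyC0 add0r in ep.
have [q1 [q2 eq]] := split q; rewrite q0 !polyC0 add0r in eq.
have [k1 [k2 ek]] := split k; rewrite k0 !polyC0 add0r in ek.
have := trans a p0 q0.
have [-> ->] := ev_split ep; have [-> ->] := ev_split eq.
rewrite -!evM -evB => /eqP D0.
have [] // := Ikev (p1 * q2 - p2 * q1).
exists (k1 * q2 - k2 * q1), (k2 * p1 - k1 * p2).
by rewrite {1}ek ep eq; ring.
Qed.

(** Reducing v modulo p, no cancellation of leading forms remains possible: p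
    and q have no common point at infinity. *)
Lemma in_ideal_bounded (h : P) : p \is monic -> (tsz p <= size p)%N ->
    coprimep (top p) (top q) -> in_ideal h ->
  exists u v : P, [/\ h = u * p + v * q, (size v < size p)%N,
    (tsz (u * p) <= tsz h)%N & (tsz (v * q) <= tsz h)%N].
Proof.
move=> mp tp cop [u [v eh]].
have ev := Pdiv.IdomainMonic.divp_eq mp v.
have sv : (size (v %% p)%R < size p)%N by rewrite ltn_modp monic_neq0.
have e : h = (u + v %/ p * q) * p + v %% p * q.
  by rewrite mulrDl mulrAC -addrA -mulrDl -ev -eh.
have tv : (tsz (v %% p * q)%R <= tsz h)%N.
  by apply: (tsz_coprime_top cop _ e); rewrite size_top_monic.
exists (u + v %/ p * q), (v %% p); split=> //.
have -> : (u + v %/ p * q) * p = h - v %% p * q by rewrite [in RHS]e addrK.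
by apply: tszD_leq => //; rewrite tszN.
Qed.
End Radical.

(** * Multivariate polynomials *)

Section Mpoly.
Variables (n : nat) (C : fieldType).
Implicit Types (g h : {mpoly C[n]}).

Lemma mpoly_generated (Pr : {mpoly C[n]} -> Prop) :
  (forall c, Pr c%:MP) -> (forall i, Pr 'X_i) ->
  (forall g h, Pr g -> Pr h -> Pr (g + h)) ->
  (forall g h, Pr g -> Pr h -> Pr (g * h)) -> forall g, Pr g.
Proof.
move=> HC HX HD HM; elim/mpolyind => [|c m g _ _ IH]; first by rewrite -mpolyC0.
apply: (HD) => //; rewrite -mul_mpolyC; apply: (HM) => //.
rewrite mpolyXE_id; apply: (big_ind Pr) => [||i _]; [by rewrite -mpolyC1 | exact: HM |].
elim: (m i) => [|k IHk]; first by rewrite expr0 -mpolyC1.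
by rewrite exprS; apply: HM.
Qed.

Lemma mmap_homog_scale (K : comNzRingType) (c : {rmorphism C -> K})
    (t : 'I_n -> K) (s : K) d g : g \is d.-homog ->
  mmap c (fun i => s * t i) g = s ^+ d * mmap c t g.
Proof.
move=> /dhomogP hg; rewrite /mmap mulr_sumr; apply: eq_big_seq => m /hg <-.
rewrite mulrCA; congr (_ * _); rewrite /mmap1 /= mdegE -prodrXr -big_split.
by apply: eq_bigr => i _; rewrite exprMn.
Qed.

Lemma mmap_eq (K : comNzRingType) (c : {rmorphism C -> K}) (t t' : 'I_n -> K) g :
  t =1 t' -> mmap c t g = mmap c t' g.
Proof. by move=> e; apply: eq_bigr => m _; rewrite (mmap1_eq _ e). Qed.

Lemma mmap_comp (K L : comNzRingType) (c : {rmorphism C -> K})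
    (F : {rmorphism K -> L}) (t : 'I_n -> K) g :
  F (mmap c t g) = mmap (F \o c) (F \o t) g.
Proof.
rewrite /mmap rmorph_sum; apply: eq_bigr => m _; rewrite rmorphM rmorph_prod.
by congr (_ * _); apply: eq_bigr => i _; rewrite rmorphXn.
Qed.

(** The chain rule for a derivation of any algebra; it serves for the
    derivatives in a chart and for Euler's identity. *)
Lemma mmap_derivation (K : comNzRingType) (c : {rmorphism C -> K})
    (t : 'I_n -> K) (D : K -> K) :
  (forall u v, D (u + v) = D u + D v) ->
  (forall u v, D (u * v) = u * D v + v * D u) -> (forall a, D (c a) = 0) ->
  forall g, D (mmap c t g) = \sum_i mmap c t g^`M(i) * D (t i).
Proof.
move=> DD DM DC; apply: mpoly_generated => [a|i|g h Hg Hh|g h Hg Hh].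
- rewrite mmapC DC big1 // => i _.
  by rewrite mderivC mmap0 mul0r.
- rewrite mmapX mmap1U (bigD1 i) //= big1 ?addr0.
    have e : (U_(i) - U_(i))%MM = 0%MM :> 'X_{1..n} by rewrite -{1}[U_(i)%MM]add0m addmK.
    by rewrite mderivX mnm1E eqxx e scale1r mpolyX0 rmorph1 mul1r.
  move=> j ji; rewrite mderivX mnm1E eq_sym (negbTE ji) scale0r mmap0.
  by rewrite mul0r.
- rewrite rmorphD DD Hg Hh -big_split; apply: eq_bigr => i _.
  by rewrite /= mderivD rmorphD mulrDl.
- rewrite rmorphM DM Hg Hh !mulr_sumr -big_split; apply: eq_bigr => i _.
  by rewrite /= mderivM rmorphD !rmorphM /=; ring.
Qed.

Lemma coefM_top (K : nzRingType) (a b : {poly K}) d e :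
  (size a <= d.+1)%N -> (size b <= e.+1)%N ->
  (size (a * b)%R <= (d + e).+1)%N /\ (a * b)`_(d + e) = a`_d * b`_e.
Proof.
move=> sa sb; split.
  by rewrite (leq_trans (size_polyMleq _ _)) //; lia.
have dde : (d < (d + e).+1)%N by rewrite ltnS leq_addr.
rewrite coefM (bigD1 (Ordinal dde)) //= big1 ?addr0 ?addKn // => i.
rewrite -val_eqE /= neq_ltn => /orP[id|di].
  by rewrite [b`_(_)]nth_default ?mulr0 // (leq_trans sb) //; lia.
by rewrite [a`_(_)]nth_default ?mul0r // (leq_trans sa).
Qed.

Lemma coefX_top (K : nzRingType) (a : {poly K}) k : (size a <= 2)%N ->
  (size (a ^+ k)%R <= k.+1)%N /\ (a ^+ k)`_k = a`_1 ^+ k.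
Proof.
move=> sa; elim: k => [|k [sk ck]]; first by rewrite !expr0 size_poly1 coef1.
by rewrite !exprS -ck -[k.+1]add1n; apply: coefM_top.
Qed.

Lemma coef_prod_top (I : Type) (r : seq I) (K : nzRingType)
    (a : I -> {poly K}) (m : I -> nat) : (forall i, (size (a i) <= 2)%N) ->
  (size (\prod_(i <- r) a i ^+ m i)%R <= (\sum_(i <- r) m i).+1)%N /\
  (\prod_(i <- r) a i ^+ m i)`_(\sum_(i <- r) m i) =
    \prod_(i <- r) (a i)`_1 ^+ m i.
Proof.
move=> sa; elim: r => [|i r [IH1 IH2]]; first by rewrite !big_nil size_poly1 coef1.
rewrite !big_cons; have [s1 c1] := coefX_top (m i) (sa i).
by rewrite -c1 -IH2; apply: coefM_top.
Qed.

Lemma homog_mmap_poly (K : comNzRingType) (c : {rmorphism C -> K})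
    (t : 'I_n -> {poly K}) d g :
  (forall i, (size (t i) <= 2)%N) -> g \is d.-homog ->
  (size (mmap (polyC \o c) t g) <= d.+1)%N /\
  (mmap (polyC \o c) t g)`_d = mmap c (fun i => (t i)`_1) g.
Proof.
move=> st /dhomogP hg.
have H m : m \in msupp g -> (size (mmap1 t m) <= d.+1)%N /\
    (mmap1 t m)`_d = mmap1 (fun i => (t i)`_1) m.
  by move=> /hg <-; rewrite /= mdegE; apply: coef_prod_top.
split.
  rewrite /mmap; apply: (leq_trans (size_sum _ _ _)).
  apply/bigmax_leqP_seq => m /H[sm _] _.
  by rewrite /= mul_polyC (leq_trans (size_scale_leq _ _)).
rewrite /mmap coef_sum; apply: eq_big_seq => m /H[_ <-].
by rewrite /= coefCM.
Qed.
End Mpoly.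

Lemma poly_nonroot (C : numFieldType) (p : {poly C}) :
  p != 0 -> exists x, p.[x] != 0.
Proof.
move=> p0; pose rs := [seq i%:R : C | i <- iota 0 (size p)].
case: (boolP (all (root p) rs)) => [ar|/allPn[x _ nx]]; last by exists x.
have us : uniq rs.
  by rewrite map_inj_uniq ?iota_uniq // => i j /eqP; rewrite Num.Theory.eqr_nat => /eqP.
by have := max_poly_roots p0 ar us; rewrite size_map size_iota ltnn.
Qed.

Lemma mpoly_nonroot (C : numFieldType) (n : nat) (p : {mpoly C[n]}) :
  p != 0 -> exists v, p.@[v] != 0.
Proof.
(* Kronecker substitution X_i := x ^ (B ^ i): since all exponents are below B,
   distinct monomials of p become distinct powers of x. *)
move=> p0; pose B := (msize p).+1.
pose e (m : 'X_{1..n}) := (\sum_(i < n) m i * B ^ i)%N.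
have digits k (a b : nat -> nat) :
    (forall i, a i < B)%N -> (forall i, b i < B)%N ->
    (\sum_(i < k) a i * B ^ i = \sum_(i < k) b i * B ^ i)%N ->
    forall i, (i < k)%N -> a i = b i.
  elim: k a b => [//|k IH] a b aB bB; rewrite !big_ord_recl !expn0 !muln1 => E.
  have E' (c : nat -> nat) : (\sum_(i < k) c (bump 0 i) * B ^ bump 0 i =
      (\sum_(i < k) c i.+1 * B ^ i) * B)%N.
    by rewrite big_distrl; apply: eq_bigr => i _; rewrite /bump expnS /= mulnCA mulnC.
  rewrite /= !E' in E.
  have e0 : a 0%N = b 0%N.
    have := congr1 (modn^~ B) E.
    by rewrite /= ![(_ 0 + _)%N]addnC !modnMDl !modn_small.
  have := E; rewrite e0 => /addnI /eqP; rewrite eqn_pmul2r // => /eqP Es.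
  case=> [|i] // ik; apply: (IH (a \o succn) (b \o succn)) => [j|j||] //=.
have einj m m' : m \in msupp p -> m' \in msupp p -> e m = e m' -> m = m'.
  move=> mp mp' E.
  have lt (m1 : 'X_{1..n}) i : m1 \in msupp p -> (m1 i < B)%N.
    move=> /msize_mdeg_lt; rewrite mdegE (bigD1 i) //= /B; lia.
  pose a (m1 : 'X_{1..n}) (i : nat) := if insub i is Some j then m1 j else 0%N.
  have aE (m1 : 'X_{1..n}) (i : 'I_n) : a m1 i = m1 i by rewrite /a valK.
  have aB (m1 : 'X_{1..n}) : m1 \in msupp p -> forall i, (a m1 i < B)%N.
    by move=> h i; rewrite /a; case: insub => // j; apply: lt.
  apply/mnmP => i; rewrite -!aE; apply: (digits n) => //; try exact: aB.
  rewrite (eq_bigr (fun i : 'I_n => m i * B ^ i)%N) => [|j _]; last by rewrite aE.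
  by rewrite -/(e m) E; apply: eq_bigr => j _; rewrite aE.
pose q : {poly C} := mmap polyC (fun i : 'I_n => 'X^(B ^ i)) p.
have q0 : q != 0.
  have [m mp] : exists m, m \in msupp p.
    by exists (mlead p); apply: mlead_supp.
  apply/eqP => /polyP /(_ (e m)); rewrite coef0 /q /mmap coef_sum.
  rewrite (bigD1_seq m) //= big1_seq ?addr0.
    rewrite coefCM /mmap1 (eq_bigr (fun i : 'I_n => 'X^(m i * B ^ i))).
      rewrite prodrXr coefXn eqxx mulr1 => /eqP.
      by apply/negP; rewrite -mcoeff_msupp.
    by move=> i _; rewrite -exprM mulnC.
  move=> m' /andP[nm mp']; rewrite coefCM /mmap1.
  rewrite (eq_bigr (fun i : 'I_n => 'X^(m' i * B ^ i))); last first.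
    by move=> i _; rewrite -exprM mulnC.
  rewrite prodrXr coefXn; case: eqP => [E|_]; last by rewrite mulr0.
  by rewrite (einj _ _ mp mp' E) eqxx in nm.
have [x qx] := poly_nonroot q0.
exists (fun i : 'I_n => x ^+ (B ^ i)); apply: contraNneq qx => px.
rewrite /q -[_.[x]]/(horner_eval x _) mmap_comp /=; apply/eqP; rewrite -[RHS]px.
rewrite /meval /mmap; apply: eq_bigr => m _; rewrite /= /horner_eval hornerC.
by congr (_ * _); apply: eq_bigr => i _; rewrite /= /horner_eval hornerXn.
Qed.

(** * Factors of forms *)

Section HomogFactors.
Variables (n : nat) (C : fieldType).
Implicit Types (g h : {mpoly C[n]}).

Lemma monomial_factor (D : idomainType) (a b : {poly D}) (c : D) N : c != 0 ->
  a * b = c%:P * 'X^N -> exists k (d : D), a = d%:P * 'X^k.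
Proof.
move=> c0; elim: N a b => [|N IH] a b.
  rewrite expr0 mulr1 => e; have ab0 : a * b != 0 by rewrite e polyC_eq0.
  have [a0 b0] : a != 0 /\ b != 0 by apply/andP; move: ab0; rewrite mulf_eq0 negb_or.
  have := size_mul a0 b0; rewrite e size_polyC c0 => s.
  exists 0%N, a`_0; rewrite expr0 mulr1; apply: size1_polyC.
  by move: a0 b0; rewrite -!size_poly_gt0 => a0 b0; move: s a0 b0; lia.
move=> e; have : (a * b).[0] == 0.
  by rewrite e exprS !hornerM hornerX mul0r mulr0.
have X0 : 'X != 0 :> {poly D} by rewrite polyX_eq0.
rewrite hornerM mulf_eq0 => /orP[a0|b0].
  have /factor_theorem[s] : root a 0 := a0; rewrite polyC0 subr0 => es.
  have [|k [d ds]] := IH s b.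
    by apply: (mulIf X0); rewrite mulrAC -es e exprSr mulrA.
  by exists k.+1, d; rewrite es ds exprSr mulrA.
have /factor_theorem[s] : root b 0 := b0; rewrite polyC0 subr0 => es.
by apply: (IH a s); apply: (mulIf X0); rewrite -mulrA -es e exprSr mulrA.
Qed.

(** g (T X): the coefficient of T ^ d is the part of degree d. *)
Definition homog_parts : {mpoly C[n]} -> {poly {mpoly C[n]}} :=
  mmap (polyC \o @mpolyC n C) (fun i => ('X_i)%:P * 'X).

Lemma coef_homog_parts g d : (homog_parts g)`_d = pihomog mdeg d g.
Proof.
rewrite /homog_parts /mmap coef_sum pihomogE [RHS]big_mkcond; apply: eq_bigr => m _.
have -> : mmap1 (fun i => ('X_i)%:P * 'X) m = 'X_[m]%:P * 'X^(mdeg m) :> {poly {mpoly C[n]}}.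
  rewrite /mmap1 mdegE -prodrXr mpolyXE_id rmorph_prod -big_split.
  by apply: eq_bigr => i _; rewrite exprMn rmorphXn.
rewrite /= coefCM coefCM coefXn eq_sym mul_mpolyC.
by case: eqP => _; rewrite ?mulr1 ?mulr0 ?scaler0.
Qed.

(** A factor of a monomial c T ^ N in a polynomial ring over a domain is a
    monomial; apply this to the homogeneous parts. *)
Lemma dhomog_factor g h N : h != 0 -> h \is N.-homog -> (exists q, h = q * g) ->
  exists d, g \is d.-homog.
Proof.
move=> h0 hh [q e].
have eN : homog_parts h = h%:P * 'X^N.
  apply/polyP => d; rewrite coef_homog_parts coefCM coefXn.
  case: eqP => [->|/eqP ne]; first by rewrite mulr1 pihomog_dE.
  by rewrite mulr0 (pihomog_ne0 _ hh) // eq_sym.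
have [|k [d gk]] := @monomial_factor _ (homog_parts g) (homog_parts q) h N h0.
  by rewrite -eN e mulrC /homog_parts rmorphM.
exists k; suff -> : g = pihomog mdeg k g by apply: pihomogP.
rewrite [LHS](@pihomog_partitionE _ _ mdeg (maxn (msize g) k.+1)); last exact: leq_maxl.
have kk : (k < maxn (msize g) k.+1)%N by rewrite leq_max ltnSn orbT.
rewrite (bigD1 (Ordinal kk)) //= big1 ?addr0 // => i.
rewrite -val_eqE /= => ik; rewrite -coef_homog_parts gk coefCM coefXn.
by rewrite (negbTE ik) mulr0.
Qed.

Lemma dhomog_quotient (q g : {mpoly C[n]}) d N : g != 0 -> g \is d.-homog ->
  q * g \is N.-homog -> q != 0 -> (d <= N)%N /\ q \is (N - d).-homog.
Proof.
move=> g0 hg hqg q0; have qg0 : q * g != 0 by rewrite mulf_neq0.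
have [|e hq] := dhomog_factor qg0 hqg (g := q); first by exists g; rewrite mulrC.
have := dhomog_uniq qg0 hqg (dhomogM hq hg) => ->.
by rewrite leq_addl addnK.
Qed.
End HomogFactors.

Lemma dhomog0_const n (C : fieldType) (g : {mpoly C[n]}) :
  g \is 0.-homog -> g = (g@_0)%:MP.
Proof.
move=> hg; apply/mpolyP => m; rewrite mcoeffC.
have [->|m0] := eqVneq m 0%MM; first by rewrite mulr1.
by rewrite mulr0 (dhomog_nemf_coeff hg) // mdeg_eq0.
Qed.

Lemma mpoly_unitP n (C : fieldType) (g : {mpoly C[n]}) :
  reflect (exists2 c, c != 0 & g = c%:MP) (g \is a GRing.unit).
Proof.
apply: (iffP idP) => [|[c c0 ->]].
  by move=> /andP[/eqP e u]; exists g@_0; rewrite -?unitfE.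
by apply/andP; rewrite !mpolyCK eqxx unitfE.
Qed.

(** * Affine charts of the plane *)

Definition o0 : 'I_3 := ord0.
Definition o1 : 'I_3 := Ordinal (isT : 1 < 3)%N.
Definition o2 : 'I_3 := ord_max.

Lemma ord3P (i : 'I_3) : [\/ i = o0, i = o1 | i = o2].
Proof.
by case: i => -[|[|[|//]]] ilt; [apply: Or31 | apply: Or32 | apply: Or33];
  apply: val_inj.
Qed.

Lemma big_ord3 (R : Type) (idx : R) (op : Monoid.law idx) (F : 'I_3 -> R) :
  \big[op/idx]_(i < 3) F i = op (op (F o0) (F o1)) (F o2).
Proof.
rewrite !big_ord_recr big_ord0 /= Monoid.mul1m.
by congr (op (op (F _) (F _)) (F _)); apply: val_inj.
Qed.

Section Frame.
Variables (C : numClosedFieldType) (M : 'M[C]_3).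
Local Notation P := {poly {poly C}}.
Implicit Types (g h p : {mpoly C[3]}) (a : C * C).

(** The rows M o0, M o1, M o2 are a projective frame: a chart with origin M o0,
    axes through M o1 and M o2, and line at infinity spanned by these two. *)
Definition point a : 'I_3 -> C := fun j => M o0 j + a.1 * M o1 j + a.2 * M o2 j.

Definition tau (j : 'I_3) : P :=
  (M o0 j)%:P%:P + (M o1 j)%:P%:P * 'X%:P + (M o2 j)%:P%:P * 'X.

(** Dehomogenization in the chart given by the frame M: [aff h] is h at the
    generic point [point (x, y)]. *)
Definition aff : {mpoly C[3]} -> P := mmap (polyC \o polyC) tau.
HB.instance Definition _ := GRing.RMorphism.on aff.

Lemma affC c : aff c%:MP = c%:P%:P.
Proof. exact: mmapC. Qed.

Lemma affXi i : aff 'X_i = tau i.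
Proof. by rewrite /aff mmapX mmap1U. Qed.

Lemma affZ c h : aff (c *: h) = c%:P%:P * aff h.
Proof. exact: mmapZ. Qed.

Lemma ev_aff a h : ev a (aff h) = h.@[point a].
Proof.
elim/(@mpoly_generated 3 C) : h => [c|i|g h Hg Hh|g h Hg Hh].
- by rewrite affC mevalC evC hornerC.
- by rewrite affXi mevalXU !evD !evM !evC !hornerC hornerX evX /point; ring.
- by rewrite rmorphD evD mevalD Hg Hh.
- by rewrite rmorphM evM mevalM Hg Hh.
Qed.

Lemma deriv_aff h : (aff h)^`() = \sum_j aff h^`M(j) * (M o2 j)%:P%:P.
Proof.
rewrite /aff mmap_derivation => [|u v|u v|c].
- apply: eq_bigr => j _; congr (_ * _).
  by rewrite /tau !derivD !derivM derivX !derivC; ring.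
- exact: derivD.
- by rewrite derivM addrC [_ * v]mulrC.
- exact: derivC.
Qed.

Lemma dx_aff h : dx (aff h) = \sum_j aff h^`M(j) * (M o1 j)%:P%:P.
Proof.
rewrite /aff mmap_derivation => [|u v|u v|c].
- apply: eq_bigr => j _; congr (_ * _).
  by rewrite /tau !dxD !dxM !dxC dxX derivX !derivC; ring.
- exact: dxD.
- by rewrite dxM addrC [_ * v]mulrC.
- by rewrite dxC derivC polyC0.
Qed.

Lemma ev_deriv_aff a h : ev a (aff h)^`() = \sum_j M o2 j * h^`M(j).@[point a].
Proof.
rewrite deriv_aff ev_sum; apply: eq_bigr => j _.
by rewrite evM ev_aff evC hornerC mulrC.
Qed.

Lemma ev_dx_aff a h : ev a (dx (aff h)) = \sum_j M o1 j * h^`M(j).@[point a].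
Proof.
rewrite dx_aff ev_sum; apply: eq_bigr => j _.
by rewrite evM ev_aff evC hornerC mulrC.
Qed.

(** The restriction of h to the line at infinity. *)
Definition line_form h : {poly C} :=
  mmap polyC (fun j => (M o1 j)%:P + M o2 j *: 'X) h.

Lemma Phi_aff h :
  Phi (aff h) = mmap (polyC \o polyC)
    (fun j => (M o0 j)%:P%:P + ((M o1 j)%:P + M o2 j *: 'X)%:P * 'X) h.
Proof.
have PhiC c : Phi c%:P%:P = c%:P%:P :> {poly {poly C}}.
  by rewrite /Phi map_polyC hornerC /= map_polyC.
have PhiX : Phi 'X = 'X * 'X%:P :> {poly {poly C}} by rewrite /Phi map_polyX hornerX.
have PhiXC : Phi 'X%:P = 'X :> {poly {poly C}}.
  by rewrite /Phi map_polyC hornerC /= map_polyX.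
elim/(@mpoly_generated 3 C) : h => [c|i|g h Hg Hh|g h Hg Hh].
- by rewrite affC PhiC mmapC.
- rewrite affXi mmapX mmap1U /tau !PhiD !PhiM !PhiC PhiX PhiXC.
  by rewrite -mul_polyC polyCD polyCM; ring.
- by rewrite !rmorphD PhiD Hg Hh.
- by rewrite !rmorphM PhiM Hg Hh.
Qed.

Lemma size_lin (K : nzRingType) (a b : K) : (size (a%:P + b%:P * 'X)%R <= 2)%N.
Proof.
rewrite (leq_trans (size_polyD _ _)) // geq_max (leq_trans (size_polyC_leq1 _)) //=.
by rewrite mul_polyC (leq_trans (size_scale_leq _ _)) // size_polyX.
Qed.

Lemma coef_Phi_aff k h : h \is k.-homog ->
  (tsz (aff h) <= k.+1)%N /\ (Phi (aff h))`_k = line_form h.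
Proof.
move=> hh; rewrite /tsz Phi_aff.
have [|s c] := @homog_mmap_poly 3 C _ polyC (fun j => (M o0 j)%:P%:P +
  ((M o1 j)%:P + M o2 j *: 'X)%:P * 'X) k h _ hh; first by move=> i; apply: size_lin.
split=> //; rewrite c; apply: mmap_eq => j.
by rewrite coefD coefC coefCM coefX add0r mulr1.
Qed.

Lemma tsz_aff k h : h \is k.-homog -> (tsz (aff h) <= k.+1)%N.
Proof. by move=> /coef_Phi_aff[]. Qed.

Lemma coef_aff k h : h \is k.-homog ->
  (size (aff h) <= k.+1)%N /\ (aff h)`_k = (h.@[M o2])%:P.
Proof.
move=> hh.
have [|s c] := @homog_mmap_poly 3 C _ polyC tau k h _ hh.
  by move=> i; rewrite /tau -!polyCM -polyCD size_lin.
split=> //; rewrite /aff c /meval (mmap_comp _ polyC).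
apply: mmap_eq => j /=.
by rewrite /tau -!polyCM -polyCD coefD coefC coefCM coefX add0r mulr1.
Qed.

Lemma aff_monic k h : h \is k.-homog -> h.@[M o2] != 0 ->
  [/\ size (aff h) = k.+1, lead_coef (aff h) = (h.@[M o2])%:P &
      tsz (aff h) = k.+1].
Proof.
move=> hh h2; have [s c] := coef_aff hh.
have sE : size (aff h) = k.+1.
  apply/eqP; rewrite eqn_leq s ltnNge; apply/negP => /leq_sizeP/(_ k (leqnn k)).
  by move/eqP; rewrite c polyC_eq0 (negbTE h2).
split=> //; first by rewrite lead_coefE sE.
apply/eqP; rewrite eqn_leq (tsz_aff hh) ltnNge; apply/negP => /tszP/(_ 0%N k).
by move=> /(_ (leqnn _))/eqP; rewrite c coefC eqxx (negbTE h2).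
Qed.

(** If h does not vanish at the point M o2 at infinity of the y axis, the
    equation of the curve h = 0 in the chart can be made monic in y. *)
Definition naff h : P := (h.@[M o2])^-1%:P *: aff h.

Lemma naffP k h : h \is k.-homog -> h.@[M o2] != 0 ->
  [/\ naff h \is monic, size (naff h) = k.+1, tsz (naff h) = k.+1 &
      aff h = (h.@[M o2])%:P *: naff h].
Proof.
move=> hh h2; have [s l t] := aff_monic hh h2.
have c0 : (h.@[M o2])^-1%:P != 0 :> {poly C} by rewrite polyC_eq0 invr_eq0.
have a0 : aff h != 0 by rewrite -size_poly_eq0 s.
split.
- by apply/monicP; rewrite /naff lead_coefZ l -polyCM mulVf.
- by rewrite /naff size_scale.
- by rewrite /naff -mul_polyC tszM ?polyC_eq0 ?invr_eq0 ?tszC ?size_polyC ?invr_eq0 ?h2 ?t.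
- by rewrite /naff scalerA -polyCM mulfV // scale1r.
Qed.

Lemma eqp_naff h : h.@[M o2] != 0 -> naff h %= aff h.
Proof. by move=> h2; rewrite /naff eqp_scale // polyC_eq0 invr_eq0. Qed.

Hypothesis Mu : M \in unitmx.

(** The coordinate functions of the frame: [lform o0] is the equation of the
    line at infinity. *)
Definition lform (i : 'I_3) : {mpoly C[3]} := \sum_j invmx M j i *: 'X_j.

Lemma lform_homog i : lform i \is 1.-homog.
Proof. by apply: rpred_sum => j _; apply: dhomogZ; rewrite dhomogX /= mdeg1. Qed.

Lemma lform_eval i v : (lform i).@[v] = \sum_j invmx M j i * v j.
Proof.
rewrite /lform raddf_sum; apply: eq_bigr => j _.
by rewrite /= mevalZ mevalXU.
Qed.

Lemma lform_row i k : (lform i).@[M k] = (k == i)%:R.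
Proof.
rewrite lform_eval; have /matrixP/(_ k i) := mulmxV Mu.
by rewrite !mxE => <-; apply: eq_bigr => j _; rewrite mulrC.
Qed.

Lemma aff_lform i :
  aff (lform i) = (i == o0)%:R + (i == o1)%:R * 'X%:P + (i == o2)%:R * 'X.
Proof.
have H k : \sum_j (invmx M j i)%:P%:P * (M k j)%:P%:P = (i == k)%:R :> P.
  have /matrixP/(_ k i) := mulmxV Mu; rewrite !mxE eq_sym => e.
  transitivity ((i == k)%:R%:P%:P : P); last by case: (i == k); rewrite ?polyC1 ?polyC0.
  rewrite -e !rmorph_sum; apply: eq_bigr => j _.
  by rewrite /= !polyCM mulrC.
rewrite /lform rmorph_sum /= -!H !mulr_suml -!big_split.
by apply: eq_bigr => j _; rewrite affZ affXi /tau /=; ring.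
Qed.

Lemma point_lform v : (lform o0).@[v] != 0 ->
  v =1 fun j => (lform o0).@[v] * point ((lform o1).@[v] / (lform o0).@[v],
                                         (lform o2).@[v] / (lform o0).@[v]) j.
Proof.
move=> v0 j; rewrite /point /=; transitivity (\sum_i (lform i).@[v] * M i j).
  pose w : 'rV[C]_3 := \row_j v j.
  have /rowP/(_ j) := mulmxKV Mu w; rewrite !mxE => <-.
  apply: eq_bigr => i _; rewrite lform_eval !mxE; congr (_ * _).
  by apply: eq_bigr => l _; rewrite mxE mulrC.
by rewrite big_ord3 /=; field.
Qed.

Lemma lform_neq0 i : lform i != 0.
Proof.
apply: contraTneq isT => e; have := lform_row i i.
by rewrite e meval0 eqxx => /eqP; rewrite eq_sym oner_eq0.
Qed.

Lemma meval_homog_scale k h (s : C) v : h \is k.-homog ->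
  h.@[fun j => s * v j] = s ^+ k * h.@[v].
Proof. exact: mmap_homog_scale. Qed.

Lemma meval_point k h v : h \is k.-homog -> (lform o0).@[v] != 0 ->
  h.@[v] = (lform o0).@[v] ^+ k *
    ev ((lform o1).@[v] / (lform o0).@[v], (lform o2).@[v] / (lform o0).@[v]) (aff h).
Proof.
move=> hh v0; rewrite ev_aff -(meval_homog_scale _ _ hh); apply: meval_eq.
exact: point_lform.
Qed.

Lemma aff_eq0 k h : h \is k.-homog -> aff h = 0 -> h = 0.
Proof.
move=> hh h0; apply/eqP; rewrite -[_ == 0]orbF -(negbTE (lform_neq0 o0)) -mulf_eq0.
apply: contraT => /mpoly_nonroot[v]; rewrite mevalM.
have [->|v0] := eqVneq (lform o0).@[v] 0; first by rewrite mulr0 eqxx.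
by rewrite (meval_point hh v0) h0 /ev !horner0 mulr0 mul0r eqxx.
Qed.

Lemma aff_inj k g h : g \is k.-homog -> h \is k.-homog -> aff g = aff h -> g = h.
Proof.
move=> hg hh e; apply/eqP; rewrite -subr_eq0; apply/eqP.
by apply: (@aff_eq0 k); [apply: rpredB | rewrite rmorphB /= e subrr].
Qed.

(** The form of degree k which is s in the chart, if the total degree of s is at
    most k. *)
Definition homogenize (k : nat) (s : P) : {mpoly C[3]} :=
  \sum_(i < k.+1) \sum_(j < k.+1 | (i + j <= k)%N)
    s`_j`_i *: (lform o0 ^+ (k - i - j) * lform o1 ^+ i * lform o2 ^+ j).

Lemma monomial_homog k i j : (i + j <= k)%N ->
  lform o0 ^+ (k - i - j) * lform o1 ^+ i * lform o2 ^+ j \is k.-homog.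
Proof.
move=> ij; have e : (1 * (k - i - j) + 1 * i + 1 * j)%N = k by lia.
rewrite -[in X in _ \is X.-homog]e.
apply: dhomogM; [apply: dhomogM|]; apply: dhomogMn; exact: lform_homog.
Qed.

Lemma homogenize_homog k s : homogenize k s \is k.-homog.
Proof.
do 2!(apply: rpred_sum => ? ?); apply: dhomogZ; exact: monomial_homog.
Qed.

Lemma aff_monomial k i j :
  aff (lform o0 ^+ (k - i - j) * lform o1 ^+ i * lform o2 ^+ j) =
    'X^i%:P * 'X^j.
Proof.
rewrite !rmorphM !rmorphXn /= !aff_lform /= !mul0r !mul1r !addr0 !add0r.
by rewrite expr1n mul1r.
Qed.

Lemma aff_homogenize k s : (tsz s <= k.+1)%N -> aff (homogenize k s) = s.
Proof.
move=> /tszP ts; rewrite /homogenize rmorph_sum.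
apply/polyP => n; apply/polyP => m.
rewrite !coef_sum /= (eq_bigr (fun i : 'I_k.+1 => \sum_(j < k.+1 | (i + j <= k)%N)
   (if (m == i) && (n == j) then s`_j`_i else 0))) => [|i _]; last first.
  rewrite rmorph_sum !coef_sum; apply: eq_bigr => j _.
  rewrite /= affZ aff_monomial mulrA -polyCM coefCM coefXn.
  case: (n == j); last by rewrite mulr0 coef0 andbF.
  by rewrite mulr1 coefCM coefXn andbT; case: eqP; rewrite ?mulr1 ?mulr0.
have [nm|nm] := leqP (m + n) k; last first.
  rewrite ts //; apply: big1 => i _; apply: big1 => j ij.
  case: eqP => // mi; case: eqP => // nj.
  by move: nm; rewrite mi nj ltnNge ij.
have mk : (m < k.+1)%N by rewrite ltnS (leq_trans _ nm) ?leq_addr.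
have nk : (n < k.+1)%N by rewrite ltnS (leq_trans _ nm) ?leq_addl.
rewrite (bigD1 (Ordinal mk)) //= (bigD1 (Ordinal nk)) //= !eqxx /=.
rewrite big1 => [|j /andP[_]]; last first.
  by rewrite -val_eqE /= eq_sym => /negbTE ->.
rewrite big1 ?addr0 // => i; rewrite -val_eqE /= eq_sym => /negbTE -> /=.
exact: big1.
Qed.

End Frame.

(** * Charts in general position *)

Section Cross.
Variable C : numClosedFieldType.
Local Notation V := ('I_3 -> C).
Implicit Types u v w : V.

Definition cross u v : V := fun j =>
  if j == o0 then u o1 * v o2 - u o2 * v o1
  else if j == o1 then u o2 * v o0 - u o0 * v o2
  else u o0 * v o1 - u o1 * v o0.

Definition dot u v : C := \sum_j u j * v j.

Lemma dot3 u v : dot u v = u o0 * v o0 + u o1 * v o1 + u o2 * v o2.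
Proof. by rewrite /dot big_ord3. Qed.

Definition linear_form u : {mpoly C[3]} := \sum_j u j *: 'X_j.

Lemma linear_form_eval u v : (linear_form u).@[v] = dot u v.
Proof.
rewrite /linear_form raddf_sum; apply: eq_bigr => j _.
by rewrite /= mevalZ mevalXU.
Qed.

Lemma linear_form_neq0 u j : u j != 0 -> linear_form u != 0.
Proof.
apply: contraNneq => e; have := linear_form_eval u (fun i => (i == j)%:R).
rewrite e meval0 /dot (bigD1 j) //= eqxx mulr1 big1 ?addr0 => [->//|i /negbTE ->].
by rewrite mulr0.
Qed.

Lemma cross_neq0 u v i : u i != 0 -> (forall s, exists j, v j != s * u j) ->
  exists j, cross u v j != 0.
Proof.
move=> ui /(_ (v i / u i))[j]; apply: contraNP => /forallNP H; apply/eqP.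
have c k : cross u v k = 0 by apply/eqP; apply/negPn/negP; exact: H.
have swap k l : u k * v l = u l * v k.
  apply/eqP; rewrite -subr_eq0; apply/eqP.
  have := c o0; have := c o1; have := c o2; rewrite /cross /= => c2 c1 c0.
  by case: (ord3P k) => ->; case: (ord3P l) => ->; rewrite ?subrr //;
    apply/eqP; rewrite -oppr_eq0 opprB; apply/eqP.
by apply: (mulIf ui); rewrite [RHS]mulrAC divfK // mulrC swap mulrC.
Qed.

Lemma cross_frame (v0 v1 v2 : V) : dot (cross v1 v2) v0 != 0 ->
  exists M : 'M[C]_3, [/\ M \in unitmx, M o0 =1 v0, M o1 =1 v1, M o2 =1 v2 &
    forall w, (lform M o0).@[w] = dot (cross v1 v2) w / dot (cross v1 v2) v0 /\
              (lform M o1).@[w] = dot (cross v2 v0) w / dot (cross v1 v2) v0].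
Proof.
set d := dot _ v0 => d0.
pose r (i : 'I_3) : V := if i == o0 then v0 else if i == o1 then v1 else v2.
pose s (i : 'I_3) : V := if i == o0 then cross v1 v2
  else if i == o1 then cross v2 v0 else cross v0 v1.
pose M : 'M[C]_3 := \matrix_(i, j) r i j.
pose W : 'M[C]_3 := \matrix_(j, i) (s i j / d).
have dE := d0; rewrite /d dot3 /cross /= in dE.
have MW : M *m W = 1%:M.
  apply/matrixP => i k; rewrite !mxE big_ord3 !mxE /= /d dot3.
  by case: (ord3P i) => ->; case: (ord3P k) => ->; rewrite /r /s /cross /=; field.
have Mu : M \in unitmx by have [] := mulmx1_unit MW.
have We : invmx M = W by rewrite -[W]mul1mx -(mulVmx Mu) -mulmxA MW mulmx1.
exists M; split=> // [j|j|j|w]; rewrite ?mxE //.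
rewrite !lform_eval We !dot3 !big_ord3 !mxE /s /=.
by split; ring.
Qed.

(** The frame is chosen from the last vector to the first. M o2 avoids the curve
    f and the lines joining two of the points: projecting from M o2 separates
    the points. The line at infinity through M o2 avoids the points. *)
Lemma frame_exists (f : {mpoly C[3]}) (n : nat) (A : 'I_n -> V) :
  f != 0 -> (exists2 d, (0 < d)%N & f \is d.-homog) ->
  (forall a, f.@[A a] = 0) ->
  (forall a b, a != b -> exists j, cross (A a) (A b) j != 0) ->
  (forall a, exists j, A a j != 0) ->
  exists M : 'M[C]_3, [/\ M \in unitmx, f.@[M o2] != 0,
    forall a, (lform M o0).@[A a] != 0 &
    injective (fun a => (lform M o1).@[A a] / (lform M o0).@[A a])].
Proof.
move=> f0 [d d0 hf] fA Aab A0.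
pose D (ab : 'I_n * 'I_n) := linear_form (cross (A ab.1) (A ab.2)).
have : f * \prod_(ab : 'I_n * 'I_n | ab.1 != ab.2) D ab != 0.
  rewrite mulf_neq0 //; apply/prodf_neq0 => -[a b] /= ab.
  by have [j] := Aab _ _ ab; apply: linear_form_neq0.
(* v2 is neither on f nor on a line joining two points A. *)
move=> /mpoly_nonroot[v2]; rewrite mevalM mulf_eq0 negb_or => /andP[fv2 Dv2].
have Dv a b : a != b -> dot (cross (A a) (A b)) v2 != 0.
  move=> ab; apply: contraNneq Dv2 => e; rewrite (bigD1 (a, b)) //= mevalM.
  by rewrite linear_form_eval e mul0r.
have notv2 a s : exists j, v2 j != s * A a j.
  apply: contrapT => /forallNP H; have e : v2 =1 fun j => s * A a j.
    by move=> j; apply/eqP; apply/negPn/negP; exact: H.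
  move/negP: fv2; apply; rewrite (meval_eq _ e) (meval_homog_scale _ _ hf).
  by rewrite fA mulr0.
have [k v2k] : exists k, v2 k != 0.
  apply: contrapT => /forallNP H; have e : v2 =1 fun j => 0 * v2 j.
    by move=> j; rewrite mul0r; apply/eqP; apply/negPn/negP; exact: H.
  move/negP: fv2; apply; rewrite (meval_eq _ e) (meval_homog_scale _ _ hf).
  by rewrite expr0n; case: d d0 {hf} => // d _; rewrite mul0r.
have [w [j wj]] : exists w j, cross v2 w j != 0.
  by case: (ord3P k) v2k => -> v2k;
    [exists (fun i => (i == o1)%:R), o2 | exists (fun i => (i == o2)%:R), o0
    | exists (fun i => (i == o0)%:R), o1];
    rewrite /cross /= ?mulr0 ?mulr1 ?subr0 ?sub0r ?oppr_eq0.
pose E a := linear_form (cross v2 (A a)).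
have : linear_form (cross w v2) * \prod_a E a != 0.
  apply: mulf_neq0.
    apply: (@linear_form_neq0 _ j); move: wj; rewrite -oppr_eq0; congr (_ != 0).
    by case: (ord3P j) => ->; rewrite /cross /=; ring.
  apply/prodf_neq0 => a _; have [i Ai] := A0 a.
  have [l cl] := cross_neq0 Ai (notv2 a); apply: (@linear_form_neq0 _ l).
  move: cl; rewrite -oppr_eq0; congr (_ != 0).
  by case: (ord3P l) => ->; rewrite /cross /=; ring.
(* The line through v1 and v2 avoids the points A, and v1 differs from v2. *)
move=> /mpoly_nonroot[v1]; rewrite mevalM mulf_eq0 negb_or => /andP[wv1 Ev1].
have Ev a : dot (cross v1 v2) (A a) != 0.
  apply: contraNneq Ev1 => e; rewrite (bigD1 a) //= mevalM linear_form_eval.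
  rewrite (_ : dot _ _ = 0) ?mul0r // -[RHS]e !dot3 /cross /=; ring.
have [l cl] : exists l, cross v1 v2 l != 0.
  apply: contrapT => /forallNP H; move/negP: wv1; apply.
  have c0 i : cross v1 v2 i = 0 by apply/eqP; apply/negPn/negP; exact: H.
  rewrite linear_form_eval (_ : dot _ _ = - dot (cross v1 v2) w).
    by rewrite oppr_eq0 /dot big1 // => i _; rewrite c0 mul0r.
  by rewrite !dot3 /cross /=; ring.
pose v0 : V := fun i => (i == l)%:R.
have v00 : dot (cross v1 v2) v0 != 0.
  rewrite /dot (bigD1 l) //= big1 => [|i /negbTE il]; last by rewrite /v0 il mulr0.
  by rewrite /v0 eqxx mulr1 addr0.
have [M [Mu M0 M1 M2 HL]] := cross_frame v00.
exists M; split=> //.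
- by rewrite (meval_eq _ M2).
- by move=> a; have [-> _] := HL (A a); rewrite mulf_neq0 ?invr_eq0.
- move=> a b /=; have [-> ->] := HL (A a); have [-> ->] := HL (A b) => e.
  apply/eqP; apply: contraT => /Dv /eqP; case.
  move: e (Ev a) (Ev b) (v00).
  set da := dot (cross v1 v2) (A a); set db := dot (cross v1 v2) (A b).
  set na := dot (cross v2 v0) (A a); set nb := dot (cross v2 v0) (A b).
  set d' := dot _ v0 => e da0 db0 d'0.
  have e' : na * db - nb * da = 0.
    apply/eqP; rewrite subr_eq0; apply/eqP.
    have ea : na / d' / (da / d') = na / da by field; rewrite da0 d'0.
    have eb : nb / d' / (db / d') = nb / db by field; rewrite db0 d'0.
    rewrite ea eb in e.
    by rewrite -[na](divfK da0) e; field.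
  have : d' * dot (cross (A a) (A b)) v2 = 0.
    rewrite -[RHS]oppr0 -[in RHS]e' /d' /na /nb /da /db !dot3 /cross /=; ring.
  by move/eqP; rewrite mulf_eq0 (negbTE d'0) => /eqP.
Qed.
End Cross.

(** * Unique factorization of ternary forms *)

Section Prime.
Variable C : numClosedFieldType.
Local Notation P := {poly {poly C}}.
Local Notation S := {mpoly C[3]}.
Implicit Types (f g h p q a b : S).

(** [irreducible_form], over any algebraically closed numeric field. *)
Definition irreducible_mpoly p : Prop :=
  [/\ p != 0, p \isn't a GRing.unit
    & forall g h, p = g * h -> g \is a GRing.unit \/ h \is a GRing.unit].

Definition divides p a : Prop := exists q, a = q * p.

Lemma irreducible_degree d p : irreducible_mpoly p -> p \is d.-homog -> (0 < d)%N.
Proof.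
case=> p0 pu _ hp; rewrite lt0n; apply: contraNneq pu => d0.
rewrite d0 in hp; have e := dhomog0_const hp; apply/mpoly_unitP.
exists p@_0 => //; apply: contraNneq p0 => c0.
by rewrite e c0 mpolyC0.
Qed.

Lemma frame_through p : p != 0 -> (exists2 d, (0 < d)%N & p \is d.-homog) ->
  exists2 M : 'M[C]_3, M \in unitmx & p.@[M o2] != 0.
Proof.
move=> p0 hd.
have [|||M [Mu Mp _ _]] := @frame_exists C p 0 (fun _ _ => 0) p0 hd; try by case.
by exists M.
Qed.

Section InFrame.
Variable M : 'M[C]_3.
Hypothesis Mu : M \in unitmx.

(** A factorization of the affine equation homogenizes to one of p, the total
    degrees adding up. *)
Lemma irreducible_naff d p : irreducible_mpoly p -> p \is d.-homog ->
  p.@[M o2] != 0 -> irreducible_poly (naff M p).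
Proof.
move=> ip hp p2; have d0 := irreducible_degree ip hp.
case: ip => p0 pu pirr; have [mp sp tp ep] := naffP hp p2.
have n0 : naff M p != 0 by rewrite monic_neq0.
apply: gauss_irreducible => [|a b eab]; first by rewrite sp ltnS.
have [a0 b0] : a != 0 /\ b != 0.
  by apply/andP; move: n0; rewrite eab mulf_eq0 negb_or.
have ta : (tsz a).-1.+1 = tsz a by rewrite prednK // tsz_gt0.
have tb : (tsz b).-1.+1 = tsz b by rewrite prednK // tsz_gt0.
have dE : ((tsz a).-1 + (tsz b).-1)%N = d.
  by have := tszM a0 b0; rewrite -eab tp; lia.
pose ga := homogenize M (tsz a).-1 a; pose gb := homogenize M (tsz b).-1 b.
have aga : aff M ga = a by rewrite aff_homogenize ?ta.
have agb : aff M gb = b by rewrite aff_homogenize ?tb.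
have e : ga * gb = (p.@[M o2])^-1 *: p.
  apply: (aff_inj (k := d) Mu).
  - by rewrite -dE dhomogM // homogenize_homog.
  - exact: dhomogZ.
  by rewrite rmorphM /= aga agb affZ -eab /naff mul_polyC.
have unit_size g : g \is a GRing.unit -> size (aff M g) = 1%N.
  by move=> /mpoly_unitP[c c0 ->]; rewrite affC size_polyC polyC_eq0 c0.
have [|u|u] := pirr (p.@[M o2] *: ga) gb.
- by rewrite -scalerAl e scalerA mulfV // scale1r.
- left; rewrite -aga; apply: unit_size; move: u.
  by rewrite -mul_mpolyC unitrM => /andP[].
- by right; rewrite -agb; apply: unit_size.
Qed.

Lemma divides_aff_dvdp p a : divides p a -> aff M p %| aff M a.
Proof. by move=> [q ->]; rewrite rmorphM /= dvdp_mulIr. Qed.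

(** The quotient in the chart has the right total degree, because p is monic in
    y and of full total degree; homogenize it. *)
Lemma aff_dvdp_divides d k p a : p \is d.-homog -> p.@[M o2] != 0 ->
  a \is k.-homog -> aff M p %| aff M a -> divides p a.
Proof.
move=> hp p2 ha; have [mp sp tp ep] := naffP hp p2.
have [->|a0] := eqVneq a 0; first by exists 0; rewrite mul0r.
rewrite -(eqp_dvdl _ (eqp_naff p2)) => /(Pdiv.IdomainMonic.dvdpP mp)[s es].
have aa0 : aff M a != 0 by apply: contraNneq a0 => /(aff_eq0 Mu ha) ->.
have s0 : s != 0 by apply: contraNneq aa0 => z; rewrite es z mul0r.
have n0 : naff M p != 0 by rewrite monic_neq0.
have := tsz_aff M ha; rewrite es tszM // tp addnS /= => tk.
have s1 : (0 < tsz s)%N by rewrite tsz_gt0.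
exists ((p.@[M o2])^-1 *: homogenize M (k - d) s).
have ts : (tsz s <= (k - d).+1)%N by lia.
have kd : (k - d + d)%N = k by lia.
apply: (aff_inj (k := k) Mu) => //.
  by rewrite -[X in _ \is X.-homog]kd dhomogM // dhomogZ // homogenize_homog.
by rewrite rmorphM /= affZ aff_homogenize // es mulrAC mulrC /naff mul_polyC.
Qed.
End InFrame.

(** In a chart where p is monic in y, its equation is irreducible and thus prime
    in C(x)[y]. *)
Lemma form_prime d k l p a b : irreducible_mpoly p -> p \is d.-homog ->
  a \is k.-homog -> b \is l.-homog -> divides p (a * b) ->
  divides p a \/ divides p b.
Proof.
move=> ip hp ha hb pab; have d0 := irreducible_degree ip hp.
have [p0 _ _] := ip.
have [M Mu p2] := frame_through p0 (ex_intro2 _ _ d d0 hp).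
have := divides_aff_dvdp M pab; rewrite rmorphM /=.
rewrite -(eqp_dvdl _ (eqp_naff p2)) => /(irreducible_dvdpM (irreducible_naff Mu ip hp p2)).
rewrite !(eqp_dvdl _ (eqp_naff p2)) => /orP[pa|pb].
  by left; apply: (aff_dvdp_divides Mu hp p2 ha pa).
by right; apply: (aff_dvdp_divides Mu hp p2 hb pb).
Qed.

(** The normalization of the leading coefficient selects one form among its
    multiples, so that distinct factors are not associated. *)
Definition monic_factor p : Prop :=
  [/\ irreducible_mpoly p, mleadc p = 1 & exists d, p \is d.-homog].

Lemma form_factorization N f : f != 0 -> f \is N.-homog ->
  exists c (ps : seq S), [/\ c != 0, f = c *: \prod_(p <- ps) p &
    forall p, p \in ps -> monic_factor p].
Proof.
have [m] := ubnP N; elim: m => // m IH in N f *; rewrite ltnS => Nm f0 hf.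
have [u|nu] := boolP (f \is a GRing.unit).
  have [c c0 ->] := mpoly_unitP _ u.
  by exists c, [::]; split=> //; rewrite big_nil -mul_mpolyC mulr1.
case: (pselect (irreducible_mpoly f)) => [irr|nirr].
  have l0 : mleadc f != 0 by rewrite mleadc_eq0.
  exists (mleadc f), [:: (mleadc f)^-1 *: f]; split=> //.
    by rewrite big_seq1 scalerA mulfV // scale1r.
  move=> p; rewrite inE => /eqP ->; split; last by exists N; apply: dhomogZ.
    split.
    - by rewrite scaler_eq0 invr_eq0 negb_or l0.
    - rewrite -mul_mpolyC unitrM (negbTE nu) andbF //.
    - move=> g h e; have [_ _ /(_ (mleadc f *: g) h)] := irr.
      case; first by rewrite -scalerAl -e scalerA mulfV // scale1r.
        by rewrite -mul_mpolyC unitrM => /andP[_ ?]; left.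
      by right.
  by rewrite mleadZ_proper ?mleadcZ mulVf // oner_neq0.
have [g [h [e gu hu]]] : exists g h, [/\ f = g * h, g \isn't a GRing.unit
    & h \isn't a GRing.unit].
  apply: contrapT => H; apply: nirr; split=> // g h e.
  have [gu|gu] := boolP (g \is a GRing.unit); first by left.
  have [hu|hu] := boolP (h \is a GRing.unit); first by right.
  by exfalso; apply: H; exists g, h.
have [g0 h0] : g != 0 /\ h != 0 by apply/andP; move: f0; rewrite e mulf_eq0 negb_or.
have [|d hg] := dhomog_factor f0 hf (g := g); first by exists h; rewrite mulrC.
have [|d' hh] := dhomog_factor f0 hf (g := h); first by exists g.
have NE : N = (d + d')%N by apply: (dhomog_uniq f0 hf); rewrite e dhomogM.
have pos (s : S) k : s != 0 -> s \isn't a GRing.unit -> s \is k.-homog -> (0 < k)%N.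
  move=> s0 su hs; rewrite lt0n; apply: contraNneq su => k0; rewrite k0 in hs.
  have se := dhomog0_const hs; apply/mpoly_unitP; exists s@_0 => //.
  by apply: contraNneq s0 => c0; rewrite se c0 mpolyC0.
have d1 := pos g d g0 gu hg; have d2 := pos h d' h0 hu hh.
have [|c [ps [c0 ec psP]]] := IH d g _ g0 hg; first by lia.
have [|c' [ps' [c'0 ec' psP']]] := IH d' h _ h0 hh; first by lia.
exists (c * c'), (ps ++ ps'); split.
- by rewrite mulf_neq0.
- by rewrite e ec ec' big_cat /= -scalerAl -scalerAr scalerA.
- by move=> p; rewrite mem_cat => /orP[/psP|/psP'].
Qed.

Lemma monic_factor_eq p q : monic_factor p -> monic_factor q -> divides p q -> p = q.
Proof.
move=> [[p0 pu _] lp _] [[q0 _ iq] lq _] [s e].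
have [su|] := iq _ _ e; last by rewrite (negbTE pu).
have [c c0 es] := mpoly_unitP _ su.
have : mleadc q = c.
  by rewrite e es mul_mpolyC mleadZ_proper ?mleadcZ lp mulr1.
by rewrite lq => c1; rewrite e es -c1 mul1r.
Qed.

Lemma monic_factors_prod_homog (ps : seq S) :
  (forall q, q \in ps -> monic_factor q) -> exists k, \prod_(q <- ps) q \is k.-homog.
Proof.
elim: ps => [|q ps IH] H; first by exists 0%N; rewrite big_nil dhomog1.
have [|k hk] := IH; first by move=> r rs; apply: H; rewrite inE rs orbT.
have [_ _ [e he]] := H q (mem_head _ _).
by exists (e + k)%N; rewrite big_cons dhomogM.
Qed.

Lemma divides_prod p (ps : seq S) : monic_factor p ->
  (forall q, q \in ps -> monic_factor q) -> divides p (\prod_(q <- ps) q) -> p \in ps.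
Proof.
move=> mp; have [ip _ [d hp]] := mp.
elim: ps => [|q ps IH] H.
  rewrite big_nil => -[s e]; case: ip => _ /negP[].
  by apply/unitrP; exists s; rewrite [p * s]mulrC -e.
have Hps r : r \in ps -> monic_factor r by move=> rs; apply: H; rewrite inE rs orbT.
have mq := H q (mem_head _ _); have [iq _ [e he]] := mq.
have [k hk] := monic_factors_prod_homog Hps.
rewrite big_cons => /(form_prime ip hp he hk)[/(monic_factor_eq mp mq) ->|/(IH Hps) pps].
  exact: mem_head.
by rewrite inE pps orbT.
Qed.
End Prime.

(** * Transversal intersections of plane curves *)

Lemma det2 (K : comNzRingType) (B : 'M[K]_2) :
  \det B = B ord0 ord0 * B ord_max ord_max - B ord0 ord_max * B ord_max ord0.
Proof.
have e0 : lift ord0 ord0 = ord_max :> 'I_2 by apply: val_inj.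
have e1 : lift ord_max ord0 = ord0 :> 'I_2 by apply: val_inj.
rewrite (expand_det_row _ ord0) big_ord_recl big_ord1 /cofactor !det_mx11 !mxE.
by rewrite e0 e1 /= expr0 expr1; ring.
Qed.

Section ThreeSpace.
Variable C : numClosedFieldType.
Local Notation V := ('I_3 -> C).
Local Notation S := {mpoly C[3]}.
Local Notation P := {poly {poly C}}.

Lemma det_cross (M : 'M[C]_3) : \det M = dot (cross (M o1) (M o2)) (M o0).
Proof.
have e00 : lift o0 ord0 = o1 :> 'I_3 by apply: val_inj.
have e01 : lift o0 ord_max = o2 :> 'I_3 by apply: val_inj.
have e10 : lift o1 ord0 = o0 :> 'I_3 by apply: val_inj.
have e11 : lift o1 ord_max = o2 :> 'I_3 by apply: val_inj.
have e20 : lift o2 ord0 = o0 :> 'I_3 by apply: val_inj.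
have e21 : lift o2 ord_max = o1 :> 'I_3 by apply: val_inj.
rewrite (expand_det_row _ o0) big_ord3 /cofactor !det2 !mxE dot3 /cross /=.
rewrite e00 e01 e10 e11 e20 e21 expr0 expr1 ; ring.
Qed.

Definition grad (f : S) (v : V) : V := fun j => f^`M(j).@[v].

Lemma dhomog_mderiv (f : S) k i : f \is k.-homog -> f^`M(i) \is (k.-1).-homog.
Proof.
move=> /dhomogP hf; apply/dhomogP => m; rewrite mcoeff_msupp mcoeff_mderiv => m0.
have : (m + U_(i))%MM \in msupp f.
  by rewrite mcoeff_msupp; apply: contraNneq m0 => ->; rewrite mul0rn.
by move=> /hf /=; rewrite mdegD mdeg1 addn1 => <-.
Qed.

(** Differentiate f (T v) = T ^ k f (v) at T = 1. *)
Lemma euler (f : S) k (v : V) : f \is k.-homog -> dot (grad f v) v = k%:R * f.@[v].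
Proof.
move=> hf; pose t (j : 'I_3) : {poly C} := 'X * (v j)%:P.
have at1 g : (mmap polyC t g).[1] = g.@[v].
  rewrite -[LHS]/(horner_eval 1 _) mmap_comp; apply: etrans.
    apply: (mmap_eq _ _ (t' := v)) => j.
    by rewrite /= /horner_eval /t hornerM hornerX hornerC mul1r.
  by apply: eq_bigr => m _; rewrite /= /horner_eval hornerC.
have tE : mmap polyC t f = 'X^k * (f.@[v])%:P.
  by rewrite (mmap_homog_scale polyC (fun j => (v j)%:P) 'X hf) (mmap_comp _ polyC).
have DM (u w : {poly C}) : (u * w)^`() = u * w^`() + w * u^`().
  by rewrite derivM addrC [_ * w]mulrC.
have := @mmap_derivation 3 C _ polyC t (@deriv C) (@derivD C) DM (@derivC C) f.
rewrite tE derivM derivXn derivC mulr0 addr0.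
move=> /(congr1 (fun q : {poly C} => q.[1])); rewrite horner_sum.
rewrite hornerM hornerMn hornerXn hornerC expr1n => ->.
apply: eq_bigr => j _; rewrite hornerM at1 /t derivM derivX derivC mulr0 addr0 mul1r.
by rewrite hornerC.
Qed.

Lemma dotC u v : dot u v = dot v u :> C.
Proof. by apply: eq_bigr => j _; rewrite mulrC. Qed.

Lemma cross_orthogonal (u w v : V) : dot u v = 0 -> dot w v = 0 ->
  forall i j, cross u w i * v j = cross u w j * v i.
Proof.
move=> uv wv i j; apply/eqP; rewrite -subr_eq0; apply/eqP.
rewrite !dot3 in uv wv.
case: (ord3P i) => ->; case: (ord3P j) => ->; rewrite ?subrr // /cross /=.
- transitivity (w o2 * (u o0 * v o0 + u o1 * v o1 + u o2 * v o2) -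
    u o2 * (w o0 * v o0 + w o1 * v o1 + w o2 * v o2)); last by rewrite uv wv !mulr0 subrr.
  by ring.
- transitivity (u o1 * (w o0 * v o0 + w o1 * v o1 + w o2 * v o2) -
    w o1 * (u o0 * v o0 + u o1 * v o1 + u o2 * v o2)); last by rewrite uv wv !mulr0 subrr.
  by ring.
- transitivity (u o2 * (w o0 * v o0 + w o1 * v o1 + w o2 * v o2) -
    w o2 * (u o0 * v o0 + u o1 * v o1 + u o2 * v o2)); last by rewrite uv wv !mulr0 subrr.
  by ring.
- transitivity (w o0 * (u o0 * v o0 + u o1 * v o1 + u o2 * v o2) -
    u o0 * (w o0 * v o0 + w o1 * v o1 + w o2 * v o2)); last by rewrite uv wv !mulr0 subrr.
  by ring.
- transitivity (w o1 * (u o0 * v o0 + u o1 * v o1 + u o2 * v o2) -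
    u o1 * (w o0 * v o0 + w o1 * v o1 + w o2 * v o2)); last by rewrite uv wv !mulr0 subrr.
  by ring.
- transitivity (u o0 * (w o0 * v o0 + w o1 * v o1 + w o2 * v o2) -
    w o0 * (u o0 * v o0 + u o1 * v o1 + u o2 * v o2)); last by rewrite uv wv !mulr0 subrr.
  by ring.
Qed.

(** Both curves are smooth at v, with distinct tangent lines. *)
Definition transversal (p q : S) (v : V) : Prop :=
  exists j, cross (grad p v) (grad q v) j != 0.

(** By Euler's identity the gradients are orthogonal to the point v, so their
    cross product is a multiple of v, nonzero by transversality; the affine
    Jacobian is its pairing with M o1 x M o2, that is a nonzero multiple of det
    M. *)
Lemma transversal_jacobian (M : 'M[C]_3) a (p q : S) d e :
  M \in unitmx -> p \is d.-homog -> q \is e.-homog ->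
  p.@[point M a] = 0 -> q.@[point M a] = 0 -> transversal p q (point M a) ->
  ev a (dx (aff M p)) * ev a (aff M q)^`() -
    ev a (aff M p)^`() * ev a (dx (aff M q)) != 0.
Proof.
move=> Mu hp hq p0 q0 [i wi]; set v := point M a; set w := cross _ _ in wi.
have sumE h (k : 'I_3) : \sum_j M k j * h^`M(j).@[v] = dot (grad h v) (M k).
  by rewrite dotC.
rewrite !ev_dx_aff !ev_deriv_aff !sumE.
have -> : dot (grad p v) (M o1) * dot (grad q v) (M o2) -
    dot (grad p v) (M o2) * dot (grad q v) (M o1) = dot w (cross (M o1) (M o2)).
  by rewrite /w !dot3 /cross /=; ring.
have ep : dot (grad p v) v = 0 by rewrite (euler _ hp) p0 mulr0.
have eq : dot (grad q v) v = 0 by rewrite (euler _ hq) q0 mulr0.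
have prop : forall k j, w k * v j = w j * v k := cross_orthogonal ep eq.
apply: contraNneq wi => e0.
have : w i * dot v (cross (M o1) (M o2)) = v i * dot w (cross (M o1) (M o2)).
  rewrite /dot !mulr_sumr; apply: eq_bigr => j _.
  by rewrite !mulrA prop; congr (_ * _); exact: mulrC.
have -> : dot v (cross (M o1) (M o2)) = \det M.
  by rewrite det_cross !dot3 /v /point /cross /=; ring.
rewrite e0 mulr0 => /eqP; rewrite mulf_eq0 => /orP[//|].
by rewrite unitmxE unitfE in Mu; rewrite (negbTE Mu).
Qed.

Lemma lform0_point (M : 'M[C]_3) a : M \in unitmx -> (lform M o0).@[point M a] = 1.
Proof.
by move=> Mu; rewrite -ev_aff aff_lform // !evD !evM /= !evC /ev !horner0 !hornerC;
  rewrite /= !mul0r !addr0.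
Qed.

Lemma point_neq0 (M : 'M[C]_3) a : M \in unitmx -> exists j, point M a j != 0.
Proof.
move=> Mu; apply: contrapT => /forallNP H.
have := lform0_point a Mu; rewrite lform_eval big1.
  by move/eqP; rewrite eq_sym oner_eq0.
by move=> j _; have /negP := H j; rewrite negbK => /eqP ->; exact: mulr0.
Qed.

Lemma meval_prop k (h : S) (v w : V) (s : C) : h \is k.-homog -> v =1 (fun j => s * w j) ->
  h.@[v] = s ^+ k * h.@[w].
Proof. by move=> hh e; rewrite (meval_eq _ e) (meval_homog_scale _ _ hh). Qed.

Section CommonZeros.
Variables (p q : S) (d e : nat).
Hypotheses (ip : irreducible_mpoly p) (hp : p \is d.-homog) (hq : q \is e.-homog).
Hypothesis npq : ~ divides p q.
Variables (n : nat) (A : 'I_n -> V).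
Hypothesis pA : forall a, p.@[A a] = 0.
Hypothesis A0 : forall a, exists j, A a j != 0.
Hypothesis Aab : forall a b, a != b -> exists j, cross (A a) (A b) j != 0.
Hypothesis pqA : forall v, (exists j, v j != 0) -> p.@[v] = 0 -> q.@[v] = 0 ->
  exists a s, v =1 fun j => s * A a j.
Hypothesis trA : forall v, (exists j, v j != 0) -> p.@[v] = 0 -> q.@[v] = 0 ->
  transversal p q v.

(** Max Noether's theorem for a transversal intersection. In a chart whose line
    at infinity misses the common points, the affine ideal is radical
    ([transversal_radical]) and the cofactors have the expected degree because
    the leading forms are coprime ([in_ideal_bounded]). *)
Theorem vanishing_in_ideal m (h : S) : (d <= m)%N -> (e <= m)%N ->
  h \is m.-homog -> (forall a, h.@[A a] = 0) ->
  exists u v, [/\ u \is (m - d).-homog, v \is (m - e).-homog & h = p * u + q * v].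
Proof.
move=> dm em hh hA; have d0 := irreducible_degree ip hp; have [p0 _ _] := ip.
have q0 : q != 0 by apply/eqP => q0; apply: npq; exists 0; rewrite q0 mul0r.
have [|||M [Mu pq2 LA _]] := @frame_exists C (p * q) n A _ _ _ Aab A0.
- by rewrite mulf_neq0.
- by exists (d + e)%N; [rewrite addn_gt0 d0 | apply: dhomogM].
- by move=> a; rewrite mevalM pA mul0r.
have [p2 q2] : p.@[M o2] != 0 /\ q.@[M o2] != 0.
  by apply/andP; move: pq2; rewrite mevalM mulf_eq0 negb_or.
have [mp sp tp ep] := naffP hp p2; have [mq sq tq eq] := naffP hq q2.
have inn := irreducible_naff Mu ip hp p2.
have cop : coprimep (naff M p) (aff M q).
  apply: (irreducible_coprimep inn); rewrite (eqp_dvdl _ (eqp_naff p2)).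
  by apply/negP => /(aff_dvdp_divides Mu hp p2 hq).
have [R R0 IR] : exists2 R : {poly C}, R != 0 & in_ideal (naff M p) (aff M q) R%:P.
  have /Bezout_coprimepP[[u v] /= uv] := cop.
  have s1 : size (u * naff M p + v * aff M q) == 1%N by rewrite -size_poly_eq1 in uv *.
  have e1 := size1_polyC (eq_leq (eqP s1)).
  exists (u * naff M p + v * aff M q)`_0; last by exists u, v.
  by apply: contraTneq s1 => c0; rewrite e1 c0 polyC0 size_poly0.
have evn a (g : S) : ev a (naff M g) = (g.@[M o2])^-1 * g.@[point M a].
  by rewrite /naff -mul_polyC evM evC hornerC ev_aff.
have zero a : ev a (naff M p) = 0 -> p.@[point M a] = 0.
  rewrite evn => /eqP; rewrite mulf_eq0 invr_eq0 (negbTE p2) => /eqP //.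
have Ih : in_ideal (naff M p) (aff M q) (aff M h).
  apply: (transversal_radical mp R0 IR) => a /zero pa; rewrite ev_aff => qa.
    have := transversal_jacobian Mu hp hq pa qa (trA (point_neq0 a Mu) pa qa).
    apply: contraNneq; rewrite /naff -mul_polyC dxM dxC derivC polyC0 mul0r add0r.
    rewrite derivM derivC mul0r add0r !evM !evC !hornerC => H.
    have : (p.@[M o2])^-1 * (ev a (dx (aff M p)) * ev a (aff M q)^`() -
      ev a (aff M p)^`() * ev a (dx (aff M q))) = 0 by rewrite -[RHS]H; ring.
    by move/eqP; rewrite mulf_eq0 invr_eq0 (negbTE p2).
  rewrite ev_aff; have [b [s es]] := pqA (point_neq0 a Mu) pa qa.
  by rewrite (meval_prop hh es) hA mulr0.
have topE (g : S) k : g \is k.-homog -> tsz (aff M g) = k.+1 ->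
    top (aff M g) = line_form M g.
  move=> hg tg; rewrite /top lead_coefE -/(tsz _) tg /=.
  by have [] := coef_Phi_aff M hg.
(* A common root of the leading forms is a common zero v of p and q at
   infinity, where there is none. *)
have ctop : coprimep (top (naff M p)) (top (aff M q)).
  have -> : top (naff M p) = (p.@[M o2])^-1 *: top (aff M p).
    rewrite /naff -mul_polyC topM -mul_polyC; congr (_ * _).
    by rewrite /top /Phi map_polyC hornerC /= map_polyC lead_coefC.
  have [_ _ tap] := aff_monic hp p2; have [_ _ taq] := aff_monic hq q2.
  rewrite (topE _ _ hp tap) (topE _ _ hq taq) coprimepZl ?invr_eq0 //.
  apply: contrapT => /negP nc.
  have /closed_rootP[t] : size (gcdp (line_form M p) (line_form M q)) != 1%N.
    by rewrite -coprimep_def.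
  rewrite root_gcd => /andP[/rootP pt /rootP qt].
  pose v : V := fun j => M o1 j + t * M o2 j.
  have lE g : (line_form M g).[t] = g.@[v].
    rewrite -[LHS]/(horner_eval t _) mmap_comp; apply: etrans.
      apply: (mmap_eq _ _ (t' := v)) => j.
      by rewrite /= /horner_eval hornerD hornerZ hornerX hornerC mulrC.
    by apply: eq_bigr => i _; rewrite /= /horner_eval hornerC.
  rewrite !lE in pt qt.
  have l0v : (lform M o0).@[v] = 0.
    transitivity ((lform M o0).@[M o1] + t * (lform M o0).@[M o2]).
      rewrite !lform_eval mulr_sumr -big_split; apply: eq_bigr => j _.
      by rewrite /v /=; ring.
    by rewrite !lform_row //= mulr0 addr0.
  have l1v : (lform M o1).@[v] = 1.
    transitivity ((lform M o1).@[M o1] + t * (lform M o1).@[M o2]).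
      rewrite !lform_eval mulr_sumr -big_split; apply: eq_bigr => j _.
      by rewrite /v /=; ring.
    by rewrite !lform_row //= mulr0 addr0.
  have nzv : exists j, v j != 0.
    apply: contrapT => /forallNP H; move: l1v; rewrite lform_eval big1.
      by move/eqP; rewrite eq_sym oner_eq0.
    move=> j _; have /negP := H j; rewrite negbK => /eqP ->; exact: mulr0.
  have [b [s es]] := pqA nzv pt qt.
  move: l0v; rewrite (meval_prop (lform_homog M o0) es) expr1 => /eqP.
  rewrite mulf_eq0 (negbTE (LA b)) orbF => /eqP s0.
  by have [j] := nzv; rewrite es s0 mul0r eqxx.
have [|u [v [eh sv tu tv]]] := in_ideal_bounded mp _ ctop Ih; first by rewrite tp sp.
have thm := tsz_aff M hh.
have degree_bound k t l : (k <= m)%N -> ((t + k.+1).-1 <= l)%N -> (l <= m.+1)%N ->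
    (t <= (m - k).+1)%N by clear; lia.
have tu' : (tsz u <= (m - d).+1)%N.
  have [->|u0] := eqVneq u 0; first by rewrite tsz0.
  apply: (degree_bound _ _ _ dm _ thm).
  by rewrite -tp -(tszM u0 (monic_neq0 mp)).
have aq0 : aff M q != 0 by rewrite -size_poly_gt0; have [-> _ _] := aff_monic hq q2.
have tv' : (tsz v <= (m - e).+1)%N.
  have [->|v0] := eqVneq v 0; first by rewrite tsz0.
  apply: (degree_bound _ _ _ em _ thm).
  by have [_ _ <-] := aff_monic hq q2; rewrite -(tszM v0 aq0).
exists ((p.@[M o2])^-1 *: homogenize M (m - d) u), (homogenize M (m - e) v).
split; [by rewrite dhomogZ // homogenize_homog | exact: homogenize_homog |].
have h1 : p * ((p.@[M o2])^-1 *: homogenize M (m - d) u) \is (d + (m - d)).-homog.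
  by rewrite dhomogM // dhomogZ // homogenize_homog.
have h2 : q * homogenize M (m - e) v \is (e + (m - e)).-homog.
  by rewrite dhomogM // homogenize_homog.
rewrite subnKC // in h1; rewrite subnKC // in h2.
apply: (aff_inj (k := m) Mu) => //; first exact: rpredD.
rewrite eh rmorphD !rmorphM /= affZ !aff_homogenize // /naff -mul_polyC.
by rewrite [v * _]mulrC; congr (_ + _); ring.
Qed.
End CommonZeros.
End ThreeSpace.

(** * Singular points of a reduced curve *)

Section SingularForms.
Variable C : numClosedFieldType.
Local Notation V := ('I_3 -> C).
Local Notation S := {mpoly C[3]}.
Local Notation P := {poly {poly C}}.

Definition form_relation (n : nat) (A : 'I_n -> V) (k : nat) (l : 'I_n -> C) :=
  forall h : S, h \is k.-homog -> \sum_a l a * h.@[A a] = 0.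

Lemma coprime_naff_prod (M : 'M[C]_3) (p : S) (ps : seq S) : M \in unitmx ->
  monic_factor p -> (forall q, q \in ps -> monic_factor q) -> p \notin ps ->
  p.@[M o2] != 0 -> coprimep (aff M p) (aff M (\prod_(q <- ps) q)).
Proof.
move=> Mu mp mps nps p2; have [ip _ [d hp]] := mp.
apply: contraNT nps => nc; apply: divides_prod => //.
have [k hk] := monic_factors_prod_homog mps.
apply: (aff_dvdp_divides Mu hp p2 hk); apply: contraNT nc.
rewrite -(eqp_dvdl _ (eqp_naff p2)) -(eqp_coprimepl _ (eqp_naff p2)).
exact: (irreducible_coprimep (irreducible_naff Mu ip hp p2)).
Qed.

Lemma prod_naff_dvdp (M : 'M[C]_3) (ps : seq S) (h : P) : M \in unitmx -> uniq ps ->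
  (forall q, q \in ps -> monic_factor q) -> (forall q, q \in ps -> q.@[M o2] != 0) ->
  (forall q, q \in ps -> aff M q %| h) -> aff M (\prod_(q <- ps) q) %| h.
Proof.
move=> Mu; elim: ps => [|p ps IH] /=.
  by move=> _ _ _ _; rewrite big_nil rmorph1 dvd1p.
move=> /andP[nps us] mps p2 ph; rewrite big_cons rmorphM /=.
have sub (Q : S -> Prop) : (forall q, q \in p :: ps -> Q q) -> forall q, q \in ps -> Q q.
  by move=> H q qs; apply: H; rewrite inE qs orbT.
rewrite Gauss_dvdp; first by rewrite ph ?mem_head //= IH //; apply: sub.
by apply: coprime_naff_prod => //; [exact: mps (mem_head _ _) | exact: sub
  | exact: p2 (mem_head _ _)].
Qed.

Variables (f : S) (N : nat) (c : C) (ps : seq S).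
Hypotheses (f0 : f != 0) (hf : f \is N.-homog) (N0 : (0 < N)%N).
Hypotheses (ef : f = c *: \prod_(p <- ps) p) (ups : uniq ps).
Hypothesis mps : forall p, p \in ps -> monic_factor p.
Variables (n : nat) (A : 'I_n -> V).
Hypothesis fA : forall a, f.@[A a] = 0.
Hypothesis dfA : forall a j, f^`M(j).@[A a] = 0.
Hypothesis A0 : forall a, exists j, A a j != 0.
Hypothesis Aab : forall a b, a != b -> exists j, cross (A a) (A b) j != 0.

(** The results on affine curves, in a chart in general position with respect to
    the points A. *)
Lemma affine_singular_points : exists2 M : 'M[C]_3, M \in unitmx &
  exists X Y : 'I_n -> C,
  [/\ forall a, (lform M o0).@[A a] != 0,
      forall a, X a = (lform M o1).@[A a] / (lform M o0).@[A a],
      forall a, Y a = (lform M o2).@[A a] / (lform M o0).@[A a] &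
      [/\ (forall l, relation X Y N.+1 l -> l =1 fun=> 0) &
      forall (m : nat) (l : 'I_m -> 'I_n -> C),
        (forall i, relation X Y N (l i)) ->
        (forall u : 'I_m -> C, (forall a, \sum_i u i * l i a = 0) -> u =1 fun=> 0) ->
        (m < size ps)%N]].
Proof.
have [|M [Mu f2 LA Xinj]] := @frame_exists C f n A f0 _ fA Aab A0.
  by exists N.
exists M => //.
pose X a := (lform M o1).@[A a] / (lform M o0).@[A a].
pose Y a := (lform M o2).@[A a] / (lform M o0).@[A a].
exists X, Y; split=> //.
have [mf sf tf eaf] := naffP hf f2.
have tf' : (tsz (naff M f) <= N.+1)%N by rewrite tf.
have evA k (g : S) a : g \is k.-homog -> g.@[A a] = 0 -> ev (X a, Y a) (aff M g) = 0.
  move=> hg; rewrite (meval_point Mu hg (LA a)) => /eqP.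
  by rewrite mulf_eq0 expf_eq0 (negbTE (LA a)) andbF => /eqP.
have evn a (g : S) : ev a (naff M g) = (g.@[M o2])^-1 * ev a (aff M g).
  by rewrite /naff -mul_polyC evM evC hornerC.
have f0' a : ev (X a, Y a) (naff M f) = 0 by rewrite evn (evA N) // mulr0.
have der0 a (j i : 'I_3) : M j i * f^`M(i).@[point M (X a, Y a)] = 0.
  by rewrite -ev_aff (evA (N.-1)) ?mulr0 //; apply: dhomog_mderiv.
have sp a := ev_split (a := (X a, Y a)) (split_at (f0' a)).
have Q0 a : ev (X a, Y a) (quoY (naff M f) Y a) = 0.
  have [_ <-] := sp a; rewrite /naff -mul_polyC derivM derivC mul0r add0r evM.
  by rewrite ev_deriv_aff big1 ?mulr0.
have k0 a : (quoX (naff M f) X Y a).[X a] = 0.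
  have [] := sp a; rewrite evC => <- _.
  rewrite /naff -mul_polyC dxM dxC derivC polyC0 mul0r add0r evM.
  by rewrite ev_dx_aff big1 ?mulr0.
have c0 : c != 0 by apply: contraNneq f0 => z; rewrite ef z scale0r.
have prod2 : \prod_(p <- ps) p.@[M o2] != 0.
  move: f2; rewrite ef mevalZ mulf_eq0 negb_or => /andP[_].
  by rewrite (big_morph _ (mevalM _) (meval1 _)).
have p2 p : p \in ps -> p.@[M o2] != 0.
  by move=> pps; apply: contraNneq prod2 => z; rewrite (big_rem p pps) /= z mul0r.
pose q (t : 'I_(size ps)) := naff M ps`_t.
have memt (t : 'I_(size ps)) : ps`_t \in ps by apply: mem_nth.
have q_irr t : irreducible_poly (q t).
  have [ip _ [d hp]] := mps (memt t).
  by apply: (irreducible_naff Mu ip hp); apply: p2.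
have eaff : naff M f %= aff M (\prod_(p <- ps) p).
  rewrite (eqp_ltrans (eqp_naff f2)) ef affZ mul_polyC eqp_scale //.
  by rewrite polyC_eq0.
have q_f t : q t %| naff M f.
  rewrite (eqp_dvdr _ eaff) (eqp_dvdl _ (eqp_naff (p2 _ (memt t)))).
  by apply: divides_aff_dvdp; exists (\prod_(p <- rem ps`_t ps) p);
    rewrite (big_rem _ (memt t)) /= mulrC.
have f_q (h : P) : (forall t, q t %| h) -> naff M f %| h.
  move=> H; rewrite (eqp_dvdl _ eaff); apply: prod_naff_dvdp => // p pps.
  have ip : (index p ps < size ps)%N by rewrite index_mem.
  have := H (Ordinal ip); rewrite /q /= nth_index //.
  by rewrite (eqp_dvdl _ (eqp_naff (p2 _ pps))).
split.
  move=> l; exact: (relation_succ_eq0 mf sf tf' Xinj f0' Q0 k0 q_irr q_f f_q N0).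
move=> m l; exact: (independent_relations_ltn mf sf tf' Xinj f0' Q0 k0 q_irr q_f f_q N0).
Qed.

(** Homogenizing the monomials rescales the relation by the values of the
    equation of the line at infinity. *)
Lemma form_relation_affine (M : 'M[C]_3) (X Y : 'I_n -> C) k m l : M \in unitmx ->
  (forall a, (lform M o0).@[A a] != 0) ->
  (forall a, X a = (lform M o1).@[A a] / (lform M o0).@[A a]) ->
  (forall a, Y a = (lform M o2).@[A a] / (lform M o0).@[A a]) ->
  form_relation A k l -> (m <= k + 3)%N ->
  relation X Y m (fun a => l a * (lform M o0).@[A a] ^+ k).
Proof.
move=> Mu LA EX EY rl mk i j ijm; have ij : (i + j <= k)%N by lia.
rewrite -[RHS](rl _ (monomial_homog Mu ij)); apply: eq_bigr => a _.
rewrite !mevalM !rmorphXn /= EX EY -[LHS]mulrA; congr (_ * _).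
rewrite !expr_div_n -{1}(subnK ij) exprD exprD subnDA; field.
by rewrite !expf_neq0.
Qed.

Theorem singular_points_independent k l : (N <= k + 2)%N ->
  form_relation A k l -> l =1 fun=> 0.
Proof.
move=> Nk rl; have [M Mu [X [Y [LA EX EY [H _]]]]] := affine_singular_points.
have Nk3 : (N.+1 <= k + 3)%N by lia.
move=> a; have /eqP := H _ (form_relation_affine Mu LA EX EY rl Nk3) a.
by rewrite mulf_eq0 expf_eq0 (negbTE (LA a)) andbF orbF => /eqP.
Qed.

Theorem singular_relations_ltn (m : nat) (l : 'I_m -> 'I_n -> C) :
  (forall k i, (k + 3)%N = N -> form_relation A k (l i)) ->
  (forall u : 'I_m -> C, (forall a, \sum_i u i * l i a = 0) -> u =1 fun=> 0) ->
  (m < size ps)%N.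
Proof.
move=> rl fl; have [M Mu [X [Y [LA EX EY [_ H]]]]] := affine_singular_points.
pose w a := (lform M o0).@[A a] ^+ (N - 3).
have w0 a : w a != 0 by rewrite expf_neq0.
apply: (H m (fun i a => l i a * w a)) => [i|u ul].
  have [N3|N3] := leqP 3 N; last by move=> i' j ij; lia.
  have e : (N - 3 + 3)%N = N by rewrite subnK.
  by apply: (form_relation_affine Mu LA EX EY (rl _ i e)); rewrite e.
apply: fl => a; apply: (mulIf (w0 a)); rewrite mul0r -[RHS](ul a) mulr_suml.
by apply: eq_bigr => i _; rewrite mulrA.
Qed.
End SingularForms.

(** * Points of the projective plane and the defect *)

Local Open Scope complex_scope.

Section Points.
Variable R : realType.
Local Notation C := (R[i]).
Local Notation V := ('I_3 -> C).
Implicit Types (a b : P2 R).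

Lemma hcoord_neq0 a : exists j, hcoord a j != 0.
Proof.
have v0 : vpick (val a) != 0 by rewrite vpick0 -dimv_eq0 (eqP (valP a)).
by have /rV0Pn := v0.
Qed.

Lemma P2_vline a (v : 'rV[C]_3) : v != 0 -> v \in val a -> val a = <[v]>%VS.
Proof.
move=> v0 va; apply/esym/eqP; rewrite eqEdim -memvE va dim_vline v0.
by rewrite (eqP (valP a)).
Qed.

Lemma hcoord_independent a b : a != b -> exists j, cross (hcoord a) (hcoord b) j != 0.
Proof.
move=> ab; have [i ai] := hcoord_neq0 a; apply: (cross_neq0 ai) => s.
apply: contrapT => /forallNP H; move/eqP: ab; apply; apply: val_inj.
have e : vpick (val b) = s *: vpick (val a).
  apply/rowP => j; rewrite mxE; apply/eqP; apply/negPn/negP; exact: H.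
have v0 (c : P2 R) : vpick (val c) != 0 by rewrite vpick0 -dimv_eq0 (eqP (valP c)).
rewrite (P2_vline (v0 b) (memv_pick _)) /=.
by apply: (P2_vline (v0 b)); rewrite e memvZ // memv_pick.
Qed.

Lemma enum_hcoord_independent (A : {fset P2 R}) (i j : 'I_(size (enum_fset A))) :
  i != j -> exists t, cross (hcoord (tnth (in_tuple (enum_fset A)) i))
                            (hcoord (tnth (in_tuple (enum_fset A)) j)) t != 0.
Proof.
move=> ij; apply: hcoord_independent; apply: contraNneq ij => e.
have us : uniq (enum_fset A) by apply: fset_uniq.
pose x0 := tnth (in_tuple (enum_fset A)) i.
rewrite -val_eqE -(nth_uniq x0 (ltn_ord i) (ltn_ord j) us); apply/eqP.
by move: e; rewrite !(tnth_nth x0).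
Qed.

(** The points being lines of the vector space, their coordinates are only
    determined up to the factor s. *)
Lemma P2_exists (v : V) : (exists j, v j != 0) ->
  exists a s, s != 0 /\ v =1 fun j => s * hcoord a j.
Proof.
move=> [i vi]; pose w : 'rV[C]_3 := \row_j v j.
have w0 : w != 0 by apply/rV0Pn; exists i; rewrite mxE.
have dw : \dim <[w]>%VS == 1%N by rewrite dim_vline w0.
pose a : P2 R := exist _ <[w]>%VS dw.
have /vlineP[s es] : vpick (val a) \in <[w]>%VS by apply: memv_pick.
have v0 : vpick (val a) != 0 by rewrite vpick0 -dimv_eq0 (eqP (valP a)).
have s0 : s != 0 by apply: contraNneq v0 => z; rewrite es z scale0r.
exists a, s^-1; split=> [|j]; first by rewrite invr_eq0.
by rewrite /hcoord es !mxE mulrA mulVf // mul1r.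
Qed.
End Points.

Section Defect.
Variable R : realType.
Local Notation C := (R[i]).
Implicit Types (A : {fset P2 R}).

Lemma dim_forms k : \dim {:dhomog 3 C k} = 'C(k + 2, k).
Proof. by rewrite dimvf. Qed.

Lemma vanishing_onP k A (h : dhomog 3 C k) :
  reflect (forall a, a \in A -> (mpoly_of_dhomog h).@[hcoord a] = 0)
          (h \in vanishing_on k A).
Proof.
have -> : (h \in vanishing_on k A) =
    all (fun a => h \in lker (linfun (@eval_at R k a))) (enum_fset A).
  rewrite /vanishing_on; elim: (enum_fset A) => [|a s IH]; first by rewrite big_nil memvf.
  by rewrite big_cons memv_cap IH.
apply: (iffP allP) => H a aA.
  by have := H a aA; rewrite memv_ker lfunE /= => /eqP.
by rewrite memv_ker lfunE /= /eval_at H.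
Qed.

(** With F the evaluation at the points of A, the defect is the dimension
    |A| - rank F of the space of relations, here a basis of the left kernel of
    the matrix of a basis of the image of F. *)
Lemma defect_relations k A : exists m (l : 'I_m -> P2 R -> C),
  [/\ forall i h, h \is k.-homog -> \sum_(a <- enum_fset A) l i a * h.@[hcoord a] = 0,
      forall u : 'I_m -> C, (forall a, a \in A -> \sum_i u i * l i a = 0) ->
        u =1 fun=> 0 &
      0 <= defect k A <= m%:Z].
Proof.
set s := enum_fset A; set n := size s.
have us : uniq s by apply: fset_uniq.
pose a0 (i : 'I_n) : P2 R := tnth (in_tuple s) i.
pose phi (h : dhomog 3 C k) : 'rV[C]_n := \row_i eval_at (a0 i) h.
have phi_lin : linear phi.
  by move=> c g h; apply/rowP => i; rewrite !mxE linearP.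
pose phiL : {linear dhomog 3 C k -> 'rV[C]_n} :=
  HB.pack phi (GRing.isLinear.Build _ _ _ _ phi phi_lin).
pose F := linfun phiL.
have kerF : lker F = vanishing_on k A.
  apply/vspaceP => h; rewrite memv_ker lfunE /=.
  apply/eqP/vanishing_onP => [/rowP H a aA|H].
    have ia : (index a s < n)%N by rewrite index_mem.
    have := H (Ordinal ia); rewrite !mxE /a0 (tnth_nth a) /= nth_index //.
  apply/rowP => i; rewrite !mxE /eval_at H //; exact: mem_tnth.
set d := \dim (limg F).
have dE : (\dim {:dhomog 3 C k} = \dim (vanishing_on k A) + d)%N.
  by rewrite -kerF -(limg_ker_dim F {:_}) capfv.
have dn : (d <= n)%N.
  by have := dimvS (subvf (limg F)); rewrite dimvf dim_matrix mul1r.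
pose b := vbasis (limg F).
pose B : 'M[C]_(n, d) := \matrix_(i, j) (tnth b j) 0 i.
pose m := \rank (kermx B).
have nm : (n - d <= m)%N by rewrite /m mxrank_ker leq_sub2l // rank_leq_col.
pose l (i : 'I_m) (a : P2 R) : C :=
  if insub (index a s) is Some j then row_base (kermx B) i j else 0.
have lE i j : l i (a0 j) = row_base (kermx B) i j.
  by rewrite /l /a0 (tnth_nth (a0 j)) index_uniq //= valK.
have sumE (G : P2 R -> C) : \sum_(a <- s) G a = \sum_j G (a0 j).
  by rewrite [LHS](big_tnth _ _ s).
have relB i j : \sum_t row_base (kermx B) i t * B t j = 0.
  have /sub_kermxP/matrixP/(_ i j) : (row_base (kermx B) <= kermx B)%MS.
    by rewrite eq_row_base.
  by rewrite !mxE.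
exists m, l; split=> [i h hh|u ul|].
- rewrite sumE; pose g : dhomog 3 C k := DHomog hh.
  have gF : F g \in limg F by rewrite memv_img ?memvf.
  have ge j : h.@[hcoord (a0 j)] = (F g) 0 j by rewrite lfunE /= mxE.
  under eq_bigr => j _ do rewrite ge (coord_vbasis gF) summxE mulr_sumr.
  rewrite exchange_big big1 //= => t _.
  transitivity (coord b t (F g) * \sum_j row_base (kermx B) i j * B j t).
    rewrite mulr_sumr; apply: eq_bigr => j _.
    by rewrite lE !mxE (tnth_nth 0); ring.
  by rewrite relB mulr0.
- have : (\row_i u i) *m row_base (kermx B) = 0.
    apply/rowP => j; rewrite !mxE -[RHS](ul (a0 j)); last exact: mem_tnth.
    by apply: eq_bigr => i _; rewrite mxE lE.
  move=> /eqP; rewrite mulmx_free_eq0 ?row_base_free // => /eqP/rowP H i.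
  by have := H i; rewrite !mxE.
have cE : #|` A| = n by [].
rewrite /defect /codim_vanishing cE dE.
by apply/andP; split; lia.
Qed.

End Defect.

(** * Components and the upper bound for the defect *)

Import Order.TTheory Num.Theory.

Section Nodal.
Variable R : realType.
Local Notation C := (R[i]).
Local Notation S := {mpoly C[3]}.
Implicit Types (A : {fset P2 R}).

Lemma not_uniq_split (T : eqType) (s : seq T) : ~~ uniq s ->
  exists x s', perm_eq s (x :: x :: s').
Proof.
elim: s => //= y s IH; rewrite negb_and negbK => /orP[ys|/IH[x [s' e]]].
  by exists y, (rem y s); rewrite perm_cons perm_to_rem.
exists x, (y :: s'); rewrite -(perm_cons y) in e; apply: (perm_trans e).
by rewrite -[y :: x :: x :: s']/([:: y] ++ [:: x; x] ++ s') perm_catCA.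
Qed.

(** A repeated factor would contradict reducedness. *)
Lemma nodal_factorization N (f : S) : nodal_curve N f ->
  exists c (ps : seq S), [/\ c != 0, f = c *: \prod_(p <- ps) p, uniq ps &
    forall p, p \in ps -> monic_factor p].
Proof.
case=> N0 f0 hf red _; have [c [ps [c0 ef mps]]] := form_factorization f0 hf.
exists c, ps; split=> //; apply: contraT => /not_uniq_split[p [s e]].
have [[_ pu _] _ _] : monic_factor p by apply: mps; rewrite (perm_mem e) mem_head.
have := red p (c *: \prod_(q <- s) q); rewrite (negbTE pu) ef.
rewrite (perm_big _ e) !big_cons -scalerAr expr2 -mulrA => H.
by have := H erefl.
Qed.

Section Factored.
Variables (N : nat) (f : S) (c : C) (ps : seq S).
Hypotheses (nf : nodal_curve N f) (c0 : c != 0) (ef : f = c *: \prod_(p <- ps) p).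
Hypotheses (ups : uniq ps) (mps : forall p, p \in ps -> monic_factor p).

Lemma component_mem p : component f p <-> p \in ps.
Proof.
have [N0 f0 hf _ _] := nf; split=> [[ip lp pf]|pps].
  have mp : monic_factor p.
    by split=> //; apply: (dhomog_factor f0 hf).
  apply: divides_prod => //; case: pf => q e; exists (c^-1 *: q).
  by rewrite -scalerAl -e ef scalerA mulVf // scale1r.
have [ip lp _] := mps pps; split=> //; exists (c *: \prod_(q <- rem p ps) q).
by rewrite ef (big_rem p pps) /= -scalerAl mulrC.
Qed.

Lemma ncomponentsE : ncomponents f = size ps.
Proof.
rewrite /ncomponents.
have -> : [set p | component f p]%classic = [set` [fset p in ps]%fset]%classic.
  by apply/seteqP; split=> p /=; rewrite inE => /component_mem.
by rewrite set_fsetK card_fseq undup_id.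
Qed.

(** The points may be any set of singular points; this is used before the set of
    all of them is known to be finite. *)
Lemma defect_upper A : (forall a, a \in A -> singular_point f a) ->
  (forall k : nat, (N <= k + 2)%N -> defect k A = 0) /\
  defect (N%:Z - 3) A < (size ps)%:Z.
Proof.
move=> sA; have [N0 f0 hf _ _] := nf.
set s := enum_fset A; set n := size s.
have us : uniq s by apply: fset_uniq.
pose a0 (i : 'I_n) : P2 R := tnth (in_tuple s) i.
have memA i : a0 i \in A by apply: mem_tnth.
have sumE (G : P2 R -> C) : \sum_(a <- s) G a = \sum_j G (a0 j).
  by rewrite [LHS](big_tnth _ _ s).
have fA i : f.@[hcoord (a0 i)] = 0 by have [] := sA _ (memA i).
have dfA i j : f^`M(j).@[hcoord (a0 i)] = 0 by have [_ ->] := sA _ (memA i).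
have A0 i := hcoord_neq0 (a0 i).
have Aab i j : i != j -> exists t, cross (hcoord (a0 i)) (hcoord (a0 j)) t != 0.
  exact: enum_hcoord_independent.
have relE k (l : P2 R -> C) :
    (forall h, h \is k.-homog -> \sum_(a <- s) l a * h.@[hcoord a] = 0) ->
    form_relation (fun i => hcoord (a0 i)) k (l \o a0).
  by move=> H h hh; rewrite -[RHS](H h hh) sumE.
have freeE m (l : 'I_m -> P2 R -> C) :
    (forall u : 'I_m -> C, (forall a, a \in A -> \sum_i u i * l i a = 0) ->
        u =1 fun=> 0) ->
    forall u : 'I_m -> C, (forall j, \sum_i u i * (l i \o a0) j = 0) -> u =1 fun=> 0.
  move=> H u ul; apply: H => a aA.
  have ia : (index a s < n)%N by rewrite index_mem.
  by have := ul (Ordinal ia); rewrite /= /a0 (tnth_nth a) /= nth_index.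
split=> [k Nk|].
  have [m [l [rl fl /andP[d0 dm]]]] := defect_relations k A.
  case: m l rl fl dm => [|m] l rl fl dm; first by apply/eqP; rewrite eq_le dm d0.
  pose u (i : 'I_m.+1) : C := (i == ord0)%:R.
  have u0 : u =1 fun=> 0.
    apply: (freeE _ _ fl) => j; rewrite (bigD1 ord0) //= big1 => [|i /negbTE i0].
      have := singular_points_independent f0 hf N0 ef ups mps fA dfA A0 Aab Nk
        (relE _ _ (rl ord0)) j.
      by rewrite /= => ->; rewrite mulr0 addr0.
    by rewrite /u i0 mul0r.
  by have /eqP := u0 ord0; rewrite /u eqxx oner_eq0.
have [N3|N3] := leqP 3 N.
  have -> : N%:Z - 3 = (N - 3)%N by lia.
  have [m [l [rl fl /andP[d0 dm]]]] := defect_relations (N - 3) A.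
  apply: (le_lt_trans dm); rewrite ltz_nat.
  apply: (singular_relations_ltn f0 hf N0 ef ups mps fA dfA A0 Aab _ (freeE _ _ fl)).
  by move=> k i kN; rewrite -kN addnK in rl *; exact: (relE _ _ (rl i)).
have -> : defect (N%:Z - 3) A = n%:Z.
  have : N%:Z - 3 < 0 by lia.
  by rewrite /defect; case: (N%:Z - 3) => // j _ /=; rewrite subr0.
rewrite ltz_nat.
apply: (singular_relations_ltn f0 hf N0 ef ups mps fA dfA A0 Aab
  (l := fun i j => (i == j)%:R)) => [k i|u H i]; first by lia.
have := H i; rewrite (bigD1 i) //= eqxx mulr1 big1 ?addr0 // => j /negbTE ->.
exact: mulr0.
Qed.

Lemma node_singular a : node f a <-> singular_point f a.
Proof. by split=> [[]//|]; have [_ _ _ _ H] := nf; apply: H. Qed.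

(** The defect is zero in degree N for all finite sets of nodes, whose size is
    therefore at most the dimension of the space of forms of degree N. *)
Lemma nodes_finite : finite_set [set a : P2 R | node f a]%classic.
Proof.
apply: contrapT => inf.
have [B sB nB] := infinite_set_fset (\dim {:dhomog 3 C N}).+1 inf.
have [H _] : _ /\ _ := @defect_upper B (fun a aB => proj1 (node_singular a) (sB a aB)).
have := H N; rewrite leq_addr => /(_ isT)/eqP; rewrite /defect /= subr_eq0 => /eqP e.
have : (#|` B|)%:Z <= (\dim {:dhomog 3 C N})%:Z by rewrite e lerBlDr lerDl.
by rewrite lez_nat leqNgt nB.
Qed.

(** Without finiteness [nodes f] could be the default value, the empty set. *)
Lemma in_nodes a : (a \in nodes f) <-> singular_point f a.
Proof.
rewrite -node_singular /nodes (in_fset_set nodes_finite).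
by split=> [/set_mem//|H]; apply/mem_set.
Qed.
End Factored.
End Nodal.

(** * The lower bound for the defect *)

Lemma bin_forms k : ('C(k + 2, k) * 2 = (k + 2) * (k + 1))%N.
Proof.
elim: k => // k IH; rewrite addSn binS mulnDl IH.
have -> : 'C(k + 2, k.+1) = k.+2 by rewrite addn2 binSn.
by clear; nia.
Qed.

Section MulForm.
Variable C : numClosedFieldType.
Local Notation S := {mpoly C[3]}.

(** Multiplication by a form g of degree m - k; the projection to degree m only
    serves to make this linear map total. *)
Definition mulh (m k : nat) (g : S) (h : dhomog 3 C k) : dhomog 3 C m :=
  DHomog (pihomogP mdeg m (g * h)).

Lemma mulh_is_linear m k g : linear (@mulh m k g).
Proof.
move=> c u v; apply: val_inj; rewrite /= mulrDr -scalerAr.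
by rewrite linearP.
Qed.

HB.instance Definition _ m k g :=
  GRing.isLinear.Build C (dhomog 3 C k) (dhomog 3 C m) _ (@mulh m k g)
    (@mulh_is_linear m k g).

Lemma mulhE m k e g (h : dhomog 3 C k) : g \is e.-homog -> (e + k)%N = m ->
  mpoly_of_dhomog (mulh m g h) = g * h.
Proof.
move=> hg <-; rewrite /mulh /= pihomog_dE //.
by apply: dhomogM => //; exact: dhomog_is_dhomog.
Qed.

Lemma mulh_inj m k e g (U : {vspace (dhomog 3 C k)}) : g \is e.-homog -> g != 0 ->
  (e + k)%N = m -> \dim (linfun (@mulh m k g) @: U) = \dim U.
Proof.
move=> hg g0 em; apply: limg_dim_eq; apply/eqP; rewrite -subv0; apply/subvP => h.
rewrite memv_cap memv_ker lfunE /= => /andP[_ /eqP/(congr1 (@mpoly_of_dhomog _ _ _))].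
rewrite (mulhE _ hg em) /= => /eqP; rewrite mulf_eq0 (negbTE g0) /= => /eqP h0.
by rewrite memv0; apply/eqP/val_inj.
Qed.
End MulForm.

Section ProductHessian.
Variable C : numClosedFieldType.
Local Notation S := {mpoly C[3]}.
Variables (p q s : S) (v : 'I_3 -> C).
Hypotheses (p0 : p.@[v] = 0) (q0 : q.@[v] = 0).

Lemma meval_product_singular :
  (p * q * s).@[v] = 0 /\ forall j, (p * q * s)^`M(j).@[v] = 0.
Proof.
split=> [|j]; first by rewrite !mevalM p0 !mul0r.
by rewrite !mderivM !mevalD !mevalM mevalD !mevalM p0 q0 !mul0r !mulr0 !addr0 mul0r.
Qed.

(** At a common zero of p and q the Hessian of p q s is the symmetrized product
    of the two gradients. *)
Lemma meval_product_hessian j k :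
  (p * q * s)^`M(j)^`M(k).@[v] =
    s.@[v] * (p^`M(j).@[v] * q^`M(k).@[v] + p^`M(k).@[v] * q^`M(j).@[v]).
Proof.
rewrite (mderivM j (p * q)) mderivD !(mderivM k) (mderivM j p q).
rewrite mderivD !(mderivM k) !mevalD !mevalM !mevalD !mevalM p0 q0.
by rewrite !mul0r !mulr0 !add0r !mul0r !addr0 mulrC.
Qed.

(** The principal minors of the Hessian matrix, one of which is nonzero at a
    node. *)
Definition hessian_minor (f : S) j k : C :=
  f^`M(j)^`M(j).@[v] * f^`M(k)^`M(k).@[v] - f^`M(j)^`M(k).@[v] * f^`M(k)^`M(j).@[v].

(** The principal minors of the symmetrized product of two gradients are, up to
    a factor - s (v) ^ 2, the squares of the entries of their cross product. *)
Lemma hessian_minor_transversal j k :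
  hessian_minor (p * q * s) j k != 0 -> transversal p q v.
Proof.
rewrite /hessian_minor !meval_product_hessian => H; apply: contrapT => /forallNP nt.
have c0 i : cross (grad p v) (grad q v) i = 0.
  by apply/eqP/negPn/negP; exact: nt.
move/negP: H; apply; apply/eqP.
have sw : p^`M(j).@[v] * q^`M(k).@[v] = p^`M(k).@[v] * q^`M(j).@[v].
  have := c0 o0; have := c0 o1; have := c0 o2; rewrite /cross /= /grad => c2 c1 c00.
  apply/eqP; rewrite -subr_eq0; apply/eqP.
  by case: (ord3P j) => ->; case: (ord3P k) => ->; rewrite ?subrr //;
    apply/eqP; rewrite -oppr_eq0 opprB; apply/eqP.
move: sw; move: (p^`M(j).@[v]) (p^`M(k).@[v]) (q^`M(j).@[v]) (q^`M(k).@[v]) s.@[v].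
move=> pj pk qj qk t sw.
transitivity (- (t ^+ 2 * (pj * qk - pk * qj) ^+ 2)); first by ring.
by rewrite sw subrr expr0n mulr0 oppr0.
Qed.

Lemma hessian_minor_singular j k :
  (forall i, p^`M(i).@[v] = 0) -> hessian_minor (p * q * s) j k = 0.
Proof.
move=> dp0; rewrite /hessian_minor !meval_product_hessian !dp0.
by rewrite !mul0r !addr0 !mulr0 subrr.
Qed.
End ProductHessian.

Lemma transversal_scale (C : numClosedFieldType) (p q : {mpoly C[3]}) d e
    (v w : 'I_3 -> C) t :
  p \is d.-homog -> q \is e.-homog -> t != 0 -> v =1 (fun j => t * w j) ->
  transversal p q w -> transversal p q v.
Proof.
move=> hp hq t0 vw [j wj]; exists j.
have gE (g : {mpoly C[3]}) k i : g \is k.-homog -> grad g v i = t ^+ k.-1 * grad g w i.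
  by move=> hg; apply: meval_prop vw; apply: dhomog_mderiv.
have pE i := gE p d i hp; have qE i := gE q e i hq.
move: pE qE wj; rewrite /cross; move: (grad p v) (grad q v) (grad p w) (grad q w).
move=> pv qv pw qw pE qE; rewrite !pE !qE.
set x := t ^+ d.-1; set y := t ^+ e.-1 => H.
have xy : x * y != 0 by rewrite mulf_neq0 ?expf_neq0.
have E a b c' d' : x * a * (y * b) - x * c' * (y * d') = x * y * (a * b - c' * d').
  by ring.
by move: H; case: (ord3P j) => -> /= H; rewrite E mulf_neq0.
Qed.

Definition singular_at (C : numClosedFieldType) (f : {mpoly C[3]}) (v : 'I_3 -> C) :=
  f.@[v] = 0 /\ forall j, f^`M(j).@[v] = 0.

Lemma singular_at_mul (C : numClosedFieldType) (p q : {mpoly C[3]}) v :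
  singular_at (p * q) v <->
  [\/ singular_at p v, singular_at q v | p.@[v] = 0 /\ q.@[v] = 0].
Proof.
have der j : (p * q)^`M(j).@[v] = p^`M(j).@[v] * q.@[v] + p.@[v] * q^`M(j).@[v].
  by rewrite mderivM mevalD !mevalM.
split=> [[pq dpq]|[[p0 dp]|[q0 dq]|[p0 q0]]].
- rewrite mevalM in pq.
  have [p0|pn] := eqVneq p.@[v] 0; have [q0|qn] := eqVneq q.@[v] 0.
  + by apply: Or33.
  + apply: Or31; split=> // j; have /eqP := dpq j.
    by rewrite der p0 mul0r addr0 mulf_eq0 (negbTE qn) orbF => /eqP.
  + apply: Or32; split=> // j; have /eqP := dpq j.
    by rewrite der q0 mulr0 add0r mulf_eq0 (negbTE pn) => /eqP.
  + by move/eqP: pq; rewrite mulf_eq0 (negbTE pn) (negbTE qn).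
- by split=> [|j]; rewrite ?der ?mevalM p0 ?dp !mul0r ?addr0.
- by split=> [|j]; rewrite ?der ?mevalM q0 ?dq !mulr0 ?addr0.
- by split=> [|j]; rewrite ?der ?mevalM p0 ?q0 !mul0r ?mulr0 ?addr0.
Qed.

Section Lower.
Variable R : realType.
Local Notation C := (R[i]).
Local Notation S := {mpoly C[3]}.
Implicit Types (A : {fset P2 R}).

Variables (N : nat) (f : S).
Hypothesis nf : nodal_curve N f.

Let Z := nodes f.

Definition sing (g : S) : {fset P2 R} := [fset a in Z | `[< singular_point g a >]]%fset.
Definition common (p q : S) : {fset P2 R} :=
  [fset a in Z | (p.@[hcoord a] == 0) && (q.@[hcoord a] == 0)]%fset.

Lemma memZ a : (a \in Z) <-> singular_point f a.
Proof.
by have [c [ps [c0 ef ups mps]]] := nodal_factorization nf; exact: (in_nodes nf c0 ef ups mps a).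
Qed.

Lemma Z_node a : a \in Z -> node f a.
Proof. by move=> /memZ; have [_ _ _ _ H] := nf; apply: H. Qed.

Lemma mem_sing g a : (a \in sing g) <-> (a \in Z) /\ singular_point g a.
Proof.
by rewrite /sing !inE; split=> [/andP[aZ /asboolP]|[-> sa]]; last exact/asboolP.
Qed.

Lemma node_minor a : a \in Z -> exists j k : 'I_3, hessian_minor (hcoord a) f j k != 0.
Proof.
move=> /Z_node[_ H]; have [i ai] := hcoord_neq0 a.
have := H i ai; rewrite det2 !mxE => H'.
by exists (lift i ord0), (lift i ord_max).
Qed.

Lemma common_singular (p q s : S) a : f = p * q * s ->
  p.@[hcoord a] = 0 -> q.@[hcoord a] = 0 -> a \in Z.
Proof.
by move=> e p0 q0; apply/memZ; rewrite e; exact: (meval_product_singular _ p0 q0).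
Qed.

Lemma common_transversal (p q s : S) a : f = p * q * s ->
  p.@[hcoord a] = 0 -> q.@[hcoord a] = 0 -> transversal p q (hcoord a).
Proof.
move=> e p0 q0; have [j [k]] := node_minor (common_singular e p0 q0).
by rewrite e; apply: hessian_minor_transversal.
Qed.

Lemma sing_common_disjoint (p q s : S) a : f = p * q * s ->
  singular_point p a -> q.@[hcoord a] = 0 -> False.
Proof.
move=> e [p0 dp0] q0; have [j [k]] := node_minor (common_singular e p0 q0).
by rewrite e (hessian_minor_singular s p0 q0 j k dp0) eqxx.
Qed.

Section Pair.
Variables (p q s : S) (d e : nat).
Hypotheses (ef : f = p * q * s).
Hypotheses (ip : irreducible_mpoly p) (hp : p \is d.-homog) (hq : q \is e.-homog).
Hypothesis npq : ~ divides p q.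

Let q0 : q != 0.
Proof. by apply/eqP => q0; apply: npq; exists 0; rewrite q0 mul0r. Qed.
Let p0 : p != 0. Proof. by case: ip. Qed.

Lemma mem_common a : (a \in common p q) = (p.@[hcoord a] == 0) && (q.@[hcoord a] == 0).
Proof.
rewrite !inE; apply: andb_idl => /andP[/eqP pa /eqP qa].
exact: common_singular ef pa qa.
Qed.

(** Let U1 and U2 be the multiples of p and of q in degree m = d + e. The forms
    vanishing on the common points are in U1 + U2, and p q is in both U1 and U2.
    So the codimension of the forms vanishing there, at most the number of
    common points, is at least dim S_m - dim S_e - dim S_d + 1 = d e. *)
Lemma bezout_lower : (d * e <= #|` common p q|)%N.
Proof.
pose D := common p q; set n := #|` D|.
pose a0 (i : 'I_n) : P2 R := tnth (in_tuple (enum_fset D)) i.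
have memD i : a0 i \in D by apply: mem_tnth.
have pA i : p.@[hcoord (a0 i)] = 0.
  by have := memD i; rewrite mem_common => /andP[/eqP].
have qA i : q.@[hcoord (a0 i)] = 0.
  by have := memD i; rewrite mem_common => /andP[_ /eqP].
have A0 i := hcoord_neq0 (a0 i).
have Aab i j : i != j -> exists t, cross (hcoord (a0 i)) (hcoord (a0 j)) t != 0.
  exact: enum_hcoord_independent.
have scale (g : S) k v a t : g \is k.-homog -> t != 0 -> v =1 (fun j => t * hcoord a j) ->
    g.@[v] = 0 -> g.@[hcoord a] = 0.
  move=> hg t0 va; rewrite (meval_prop hg va) => /eqP.
  by rewrite mulf_eq0 expf_eq0 (negbTE t0) andbF => /eqP.
have pqA v : (exists j, v j != 0) -> p.@[v] = 0 -> q.@[v] = 0 ->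
    exists i t, v =1 fun j => t * hcoord (a0 i) j.
  move=> /P2_exists[a [t [t0 va]]] pv qv.
  have aD : a \in D.
    by rewrite mem_common (scale p d v a t) // (scale q e v a t) // eqxx.
  have ia : (index a (enum_fset D) < n)%N by rewrite index_mem.
  exists (Ordinal ia), t => j; rewrite va /a0 (tnth_nth a) /= nth_index //.
have trA v : (exists j, v j != 0) -> p.@[v] = 0 -> q.@[v] = 0 -> transversal p q v.
  move=> /P2_exists[a [t [t0 va]]] pv qv; apply: (transversal_scale hp hq t0 va).
  by apply: (common_transversal ef); [apply: (scale p d v a t) | apply: (scale q e v a t)].
pose m := (d + e)%N.
pose U1 := (linfun (@mulh C m e p) @: fullv)%VS.
pose U2 := (linfun (@mulh C m d q) @: fullv)%VS.
have dU1 : \dim U1 = 'C(e + 2, e) by rewrite (mulh_inj _ hp p0 erefl) dim_forms.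
have dU2 : \dim U2 = 'C(d + 2, d) by rewrite (mulh_inj _ hq q0 (addnC e d)) dim_forms.
have sub : (vanishing_on m D <= U1 + U2)%VS.
  apply/subvP => h /vanishing_onP hD.
  have [|u [v [hu hv E]]] := vanishing_in_ideal ip hp hq npq pA A0 Aab pqA trA
    (leq_addr e d) (leq_addl d e) (dhomog_is_dhomog h).
    by move=> i; apply: hD.
  rewrite addKn in hu; rewrite addnK in hv.
  have -> : h = mulh m p (DHomog hu) + mulh m q (DHomog hv).
    apply: val_inj; rewrite /= [LHS]E; congr (_ + _); rewrite pihomog_dE //.
      exact: dhomogM.
    by rewrite /m addnC; exact: dhomogM.
  by apply: memv_add; rewrite -[mulh _ _ _]lfunE memv_img ?memvf.
have cap : (0 < \dim (U1 :&: U2))%N.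
  rewrite lt0n dimv_eq0; apply/eqP => cap0.
  have : mulh m p (DHomog hq) \in (U1 :&: U2)%VS.
    rewrite memv_cap; apply/andP; split.
      by rewrite -[mulh _ _ _]lfunE memv_img ?memvf.
    have -> : mulh m p (DHomog hq) = mulh m q (DHomog hp).
      by apply: val_inj; rewrite /= mulrC.
    by rewrite -[mulh _ _ _]lfunE memv_img ?memvf.
  rewrite cap0 memv0 => /eqP/(congr1 (@mpoly_of_dhomog _ _ _)).
  rewrite (mulhE _ hp) //= => /eqP; rewrite mulf_eq0.
  by rewrite (negbTE p0) (negbTE q0).
have dsum := dimv_sum_cap U1 U2; have dle := dimvS sub.
have [m' [l [_ _ /andP[d0 _]]]] := defect_relations m D.
move: d0; rewrite /defect /= dim_forms -/n => d0.
have b1 := bin_forms e; have b2 := bin_forms d; have b3 := bin_forms m.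
rewrite dU1 dU2 in dsum.
have key (s1 s2 s3 v cc t : nat) : (0 < cc)%N -> (t + cc = s1 + s2)%N -> (v <= t)%N ->
   (0:int) <= n%:Z - (s3%:Z - v%:Z) -> (s1 * 2 = (e + 2) * (e + 1))%N ->
   (s2 * 2 = (d + 2) * (d + 1))%N ->
   (s3 * 2 = (d + e + 2) * (d + e + 1))%N -> (d * e <= n)%N.
  by clear; nia.
exact: (key _ _ _ _ _ _ cap dsum dle d0 b1 b2 b3).
Qed.

Definition vdim (m : int) A : nat := if m is Posz k then \dim (vanishing_on k A) else 0.
Definition sdim (m : int) : nat := if m is Posz k then 'C(k + 2, k) else 0.

Lemma defectE m A : defect m A = (#|` A|)%:Z - ((sdim m)%:Z - (vdim m A)%:Z).
Proof. by case: m => k; rewrite /defect /codim_vanishing /= ?dim_forms. Qed.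

Lemma sdim_shift k : (0 < k)%N -> (sdim (k%:Z - 3) * 2 = k.-1 * k.-2)%N.
Proof.
case: k => // -[|[|k]] _ //.
have -> : k.+3%:Z - 3 = k by lia.
by rewrite /sdim bin_forms addn2 addn1 mulnC.
Qed.

(** The two summands of the embedding in [vdim_product] are of this kind. The
    factor u is kept as a polynomial because l - 3 may be negative, where only
    u = 0 is left. *)
Lemma multiples_space (k m : nat) (g : S) l A : g \is k.-homog -> g != 0 ->
  (0 < l)%N -> (k + l)%:Z - 3 = m ->
  exists2 W : {vspace dhomog 3 C m}, \dim W = vdim (l%:Z - 3) A &
    forall h, h \in W -> exists u, [/\ mpoly_of_dhomog h = g * u,
      forall a, a \in A -> u.@[hcoord a] = 0 &
      u = 0 \/ exists2 j, (j < l)%N & u \is j.-homog].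
Proof.
move=> hg g0 l0 klm; have [l3|l3] := leqP 3 l; last first.
  exists 0%VS; first by rewrite dimv0; have -> : l%:Z - 3 = Negz (2 - l) by lia.
  move=> h; rewrite memv0 => /eqP ->; exists 0.
  by split; [rewrite mulr0 | move=> a _; rewrite meval0 | left].
have el : l%:Z - 3 = (l - 3)%N by lia.
have em : (k + (l - 3))%N = m by lia.
rewrite el /=; exists (linfun (@mulh C m (l - 3) g) @: vanishing_on (l - 3) A)%VS.
  exact: (mulh_inj _ hg g0 em).
move=> h /memv_imgP[u /vanishing_onP uA ->]; exists (mpoly_of_dhomog u).
rewrite lfunE /= pihomog_dE; last by rewrite -em; exact: (dhomogM hg (dhomog_is_dhomog u)).
split=> //; right; exists (l - 3)%N; last exact: dhomog_is_dhomog.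
by rewrite ltn_subrL; lia.
Qed.

(** The three sets are disjoint: a singular point of p on the curve q = 0 would
    make the Hessian of f zero. *)
Lemma sing_product_card :
  (#|` sing p| + #|` sing q| + #|` common p q| <= #|` sing (p * q)|)%N.
Proof.
have ef' : f = q * p * s by rewrite (mulrC q).
have d1 : (sing p `&` sing q = fset0)%fset.
  apply/fsetP => a; rewrite in_fsetI in_fset0.
  apply/negP => /andP[/mem_sing[_ sp] /mem_sing[_ [qa _]]].
  exact: (sing_common_disjoint ef sp qa).
have d2 : ((sing p `|` sing q) `&` common p q = fset0)%fset.
  apply/fsetP => a; rewrite in_fsetI in_fsetU mem_common in_fset0.
  apply/negP => /andP[/orP[] /mem_sing[_ sp] /andP[/eqP pa /eqP qa]].
    exact: (sing_common_disjoint ef sp qa).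
  exact: (sing_common_disjoint ef' sp pa).
rewrite -cardfsUI d1 cardfs0 addn0 -cardfsUI d2 cardfs0 addn0.
apply: fsubset_leq_card; apply/fsubsetP => a.
rewrite 2!in_fsetU mem_common => /orP[/orP[]|].
- by move=> /mem_sing[aZ sa]; apply/mem_sing; split; [exact: aZ | apply/singular_at_mul/Or31; exact: sa].
- by move=> /mem_sing[aZ sa]; apply/mem_sing; split; [exact: aZ | apply/singular_at_mul/Or32; exact: sa].
- move=> /andP[/eqP pa /eqP qa]; apply/mem_sing; split.
    exact: common_singular ef pa qa.
  by apply/singular_at_mul/Or33.
Qed.

Hypotheses (d0 : (0 < d)%N) (e0 : (0 < e)%N).

(** q u + p v vanishes on the nodes of p q if u, v vanish on those of p, q. The
    sum is direct, because q u = p v makes p divide u, whose degree is less than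
    d. *)
Lemma vdim_product :
  (vdim (d%:Z - 3) (sing p) + vdim (e%:Z - 3) (sing q) <=
   vdim ((d + e)%:Z - 3) (sing (p * q)))%N.
Proof.
have [de3|de3] := leqP 3 (d + e); last first.
  have [d1 e1] : d = 1%N /\ e = 1%N by clear -de3 d0 e0; lia.
  have ed : d%:Z - 3 = Negz 1 by rewrite d1.
  have ee : e%:Z - 3 = Negz 1 by rewrite e1.
  by apply: (@leq_trans 0); rewrite // ed ee.
have em : (d + e)%:Z - 3 = (d + e - 3)%N by lia.
have [|W1 <- W1P] := @multiples_space e (d + e - 3) q d (sing p) hq q0 d0.
  by rewrite addnC.
have [W2 <- W2P] := @multiples_space d (d + e - 3) p e (sing q) hp p0 e0 em.
rewrite em /=; rewrite -dimv_disjoint_sum; last first.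
  apply/eqP; rewrite -subv0; apply/subvP => h; rewrite memv_cap memv0.
  move=> /andP[/W1P[u [hu _ ud]] /W2P[v [hv _ _]]].
  suff u0 : u = 0 by apply/eqP/val_inj; rewrite /= hu u0 mulr0.
  case: ud => // -[j jd uj]; apply/eqP; apply: contraT => un.
  have [//|[t et]] : divides p q \/ divides p u.
    apply: (form_prime ip hp hq uj); exists v; rewrite -hu hv mulrC //.
  have tn : t != 0 by apply: contraNneq un => z; rewrite et z mul0r.
  have tpj : t * p \is j.-homog by rewrite -et.
  have [dj _] := dhomog_quotient p0 hp tpj tn.
  by move: jd; rewrite ltnNge dj.
apply: dimvS; apply/subvP => h /memv_addP[h1 /W1P[u [hu uA _]] [h2 /W2P[v [hv vA _]] ->]].
apply/vanishing_onP => a /mem_sing[aZ sa].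
rewrite /= mevalD; have aS g : singular_point g a -> a \in sing g.
  by move=> sg; apply/mem_sing.
rewrite hu hv !mevalM.
have /singular_at_mul[sp|sq|[pa qa]] : singular_at (p * q) (hcoord a) := sa.
- by have [pa _] := sp; rewrite pa (uA _ (aS p sp)) mulr0 mul0r addr0.
- by have [qa _] := sq; rewrite qa (vA _ (aS q sq)) mulr0 mul0r addr0.
- by rewrite pa qa !mul0r addr0.
Qed.

Lemma defect_product :
  defect (d%:Z - 3) (sing p) + defect (e%:Z - 3) (sing q) + 1 <=
  defect ((d + e)%:Z - 3) (sing (p * q)).
Proof.
rewrite !defectE.
have de0 : (0 < d + e)%N by rewrite addn_gt0 d0.
have s1 := sdim_shift d0; have s2 := sdim_shift e0; have s3 := sdim_shift de0.
have c1 := sing_product_card; have c2 := vdim_product; have c3 := bezout_lower.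
have arith (k l nd ne nc n sd se s' vd ve v : nat) : (0 < k)%N -> (0 < l)%N ->
    (sd * 2 = k.-1 * k.-2)%N -> (se * 2 = l.-1 * l.-2)%N ->
    (s' * 2 = (k + l).-1 * (k + l).-2)%N -> (nd + ne + nc <= n)%N ->
    (vd + ve <= v)%N -> (k * l <= nc)%N ->
    nd%:Z - (sd%:Z - vd%:Z) + (ne%:Z - (se%:Z - ve%:Z)) + 1 <= n%:Z - (s'%:Z - v%:Z).
  clear; move=> k0 l0 h1 h2 h3 h4 h5 h6.
  have : (s' + 1 = sd + se + k * l)%N.
    case: k k0 h1 h3 h6 => // k _; case: l l0 h2 => // l _.
    by case: k => [|k]; case: l => [|l] /=; clear; nia.
  lia.
exact: (arith _ _ _ _ _ _ _ _ _ _ _ _ d0 e0 s1 s2 s3 c1 c2 c3).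
Qed.
End Pair.

(** Induction on the number of components; a single one has a defect which is at
    least 0. *)
Theorem defect_lower (ps : seq S) c : c != 0 -> f = c *: \prod_(p <- ps) p -> uniq ps ->
  (forall p, p \in ps -> monic_factor p) ->
  (size ps)%:Z - 1 <= defect (N%:Z - 3) Z.
Proof.
move=> c0 ef ups mps; have [N0 f0 hf _ _] := nf.
have key (l : seq S) s : l != [::] -> uniq l -> (forall p, p \in l -> monic_factor p) ->
    f = \prod_(p <- l) p * s ->
    exists d, [/\ (0 < d)%N, \prod_(p <- l) p \is d.-homog &
      (size l)%:Z - 1 <= defect (d%:Z - 3) (sing (\prod_(p <- l) p))].
  elim: l s => [//|p l IH] s _ /= /andP[pl ul] ml el.
  have mp := ml p (mem_head _ _); have [ip _ [d hp]] := mp.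
  have d0 := irreducible_degree ip hp.
  have dge g k : 0 <= defect (k%:Z - 3) (sing g).
    case: (k%:Z - 3) => j; last by rewrite /defect /= subr0.
    by have [m [t [_ _ /andP[]]]] := defect_relations j (sing g).
  case: l IH pl ul ml el => [|q l] IH pl ul ml el.
    exists d; rewrite big_seq1; split=> //=; exact: dge.
  have ml' r : r \in q :: l -> monic_factor r by move=> rl; apply: ml; rewrite inE rl orbT.
  have [||e [e0 hl le]] := IH (p * s) _ ul ml' => //.
    by rewrite el big_cons mulrA [_ * p]mulrC.
  have npl : ~ divides p (\prod_(r <- q :: l) r).
    by move=> /(divides_prod mp ml'); rewrite (negbTE pl).
  exists (d + e)%N; rewrite big_cons; split; [by rewrite addn_gt0 d0 | exact: dhomogM |].
  have ef' : f = p * (\prod_(r <- q :: l) r) * s by rewrite el big_cons.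
  apply: le_trans (defect_product ef' ip hp hl npl d0 e0).
  have := dge p d; move: le; rewrite /=.
  set x := defect _ _; set y := defect _ _; lia.
have psn : ps != [::].
  apply: contraTneq N0 => p0; move: hf; rewrite ef p0 big_nil -mul_mpolyC mulr1 => hc.
  rewrite lt0n negbK; apply/eqP; apply: (dhomog_uniq _ hc).
    by rewrite mpolyC_eq0.
  by rewrite -[c%:MP]mulr1 mul_mpolyC; apply: dhomogZ; apply: dhomog1.
have fE : f = \prod_(p <- ps) p * c%:MP by rewrite ef -mul_mpolyC mulrC.
have [d [d0 hd le]] := key ps _ psn ups mps fE.
have pn : \prod_(p <- ps) p != 0 by apply: contraNneq f0 => z; rewrite ef z scaler0.
have hfd : f \is d.-homog by rewrite ef; apply: dhomogZ.
have dN : d = N := dhomog_uniq f0 hfd hf.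
rewrite dN in le; suff -> : Z = sing (\prod_(p <- ps) p) by [].
apply/fsetP => a; apply/idP/idP => [aZ|/mem_sing[]//]; apply/mem_sing; split=> //.
have /memZ[fa dfa] := aZ; split=> [|j].
  by move/eqP: fa; rewrite ef mevalZ mulf_eq0 (negbTE c0) => /eqP.
by have /eqP := dfa j; rewrite ef mderivZ mevalZ mulf_eq0 (negbTE c0) => /eqP.
Qed.
End Lower.

(** * Valuation rings of a function field *)

Section Valuation.
Variables (C : closedFieldType) (K : fieldType) (c : {rmorphism C -> K}) (O : set K).
Hypothesis vO : valuation_ring_over c O.
Implicit Types u v : K.

Lemma O_const a : O (c a). Proof. by case: vO. Qed.
Lemma O_sub u v : O u -> O v -> O (u - v).
Proof. by case: vO => _ H _ _ Ou Ov; case: (H u v Ou Ov). Qed.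
Lemma O_mul u v : O u -> O v -> O (u * v).
Proof. by case: vO => _ H _ _ Ou Ov; case: (H u v Ou Ov). Qed.
Lemma O_val u : O u \/ O u^-1. Proof. by case: vO. Qed.
Lemma O_0 : O 0. Proof. by rewrite -(rmorph0 c); apply: O_const. Qed.
Lemma O_1 : O 1. Proof. by rewrite -(rmorph1 c); apply: O_const. Qed.
Lemma O_opp u : O u -> O (- u).
Proof. by move=> Ou; rewrite -sub0r; apply: O_sub => //; exact: O_0. Qed.
Lemma O_add u v : O u -> O v -> O (u + v).
Proof. by move=> Ou Ov; rewrite -[v]opprK; apply: O_sub => //; exact: O_opp. Qed.
Lemma O_exp u n : O u -> O (u ^+ n).
Proof.
by move=> Ou; elim: n => [|n IH]; rewrite ?expr0 ?exprS; [exact: O_1 | exact: O_mul].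
Qed.

Definition O_unit u : Prop := exists v, O v /\ u * v = 1.
(** The maximal ideal of O, as the set of its nonunits. *)
Definition O_max u : Prop := O u /\ ~ O_unit u.

Lemma O_unit_neq0 u : O_unit u -> u != 0.
Proof. by case=> v [_ e]; apply: contra_eq_neq e => ->; rewrite mul0r eq_sym oner_eq0. Qed.

Lemma O_unit_inv u : O_unit u -> O u^-1.
Proof.
move=> Uu; have u0 := O_unit_neq0 Uu; case: Uu => v [Ov e].
by rewrite -[u^-1]mulr1 -e mulrA mulVf // mul1r.
Qed.

Lemma O_unit_const a : a != 0 -> O_unit (c a).
Proof.
by move=> a0; exists (c a^-1); split; [exact: O_const | rewrite -rmorphM mulfV // rmorph1].
Qed.

Lemma O_unitM u v : O_unit u -> O_unit v -> O_unit (u * v).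
Proof.
move=> [u' [Ou e]] [v' [Ov e']]; exists (u' * v'); split; first exact: O_mul.
by rewrite mulrACA e e' mul1r.
Qed.

Lemma O_unit_divl u v : O v -> O_unit (u * v) -> O_unit u.
Proof.
by move=> Ov [w [Ow e]]; exists (v * w); split; [exact: O_mul | rewrite mulrA].
Qed.

Lemma O_maxM u v : O u -> O_max v -> O_max (u * v).
Proof.
move=> Ou [Ov nv]; split; first exact: O_mul.
by rewrite mulrC => /(O_unit_divl Ou).
Qed.

(** The ideal property of the nonunits: of u / v and v / u one is in O. *)
Lemma O_maxD u v : O_max u -> O_max v -> O_max (u + v).
Proof.
have side a b : O_max a -> O_max b -> O (b / a) -> a != 0 -> O_max (a + b).
  move=> [Oa na] [Ob nb] Oq a0; split; first exact: O_add.
  have -> : a + b = a * (1 + b / a) by rewrite mulrDr mulr1 mulrCA mulfV // mulr1.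
  by move=> /O_unit_divl - /(_ (O_add O_1 Oq)).
move=> mu mv; have [->|u0] := eqVneq u 0; first by rewrite add0r.
have [->|v0] := eqVneq v 0; first by rewrite addr0.
have [q|q] := O_val (v / u); first exact: side.
by rewrite addrC; apply: side => //; rewrite invfM invrK mulrC in q.
Qed.

Lemma O_max_prod (I : Type) (r : seq I) (F : I -> K) :
  O_max (\prod_(i <- r) F i) -> (forall i, O (F i)) -> exists i, O_max (F i).
Proof.
move=> + OF; elim: r => [|i r IH]; rewrite ?big_nil ?big_cons => -[Op np].
  by exfalso; apply: np; exists 1; rewrite mulr1; split=> //; exact: O_1.
case: (pselect (O_unit (F i))) => [Ui|ni]; last by exists i.
apply: IH; split.
  have := O_mul (O_unit_inv Ui) Op.
  by rewrite mulrA mulVf ?mul1r //; apply: O_unit_neq0.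
by move=> U; apply: np; apply: O_unitM.
Qed.

(** If u is not in O then u^-1 is, and dividing the equation by a power of u
    shows that u is in O. *)
Lemma O_integral (s : {poly K}) u : s \is monic -> (forall i, O s`_i) -> root s u -> O u.
Proof.
move=> sm Os /rootP su; have [//|Ou] := O_val u.
have [->|u0] := eqVneq u 0; first exact: O_0.
have s0 : (0 < size s)%N by rewrite size_poly_gt0 monic_neq0.
case E: (size s) s0 => [//|d] _.
have sd : s`_d = 1 by move/monicP: sm; rewrite lead_coefE E.
move: su; rewrite horner_coef E big_ord_recr /= sd mul1r => /eqP.
case: d E sd => [|d] E sd.
  by rewrite big_ord0 add0r expr0 oner_eq0.
rewrite addrC addr_eq0 => /eqP e.
have -> : u = - \sum_(i < d.+1) s`_i * u^-1 ^+ (d - i).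
  have ud : u ^+ d != 0 by rewrite expf_neq0.
  apply: (mulIf ud); rewrite -exprS e mulNr mulr_suml; congr (- _).
  apply: eq_bigr => i _; rewrite -mulrA; congr (_ * _).
  have -> : u ^+ d = u ^+ (d - i) * u ^+ i by rewrite -exprD subnK // -ltnS.
  by rewrite exprVn mulrA mulVf ?mul1r // expf_neq0.
apply: O_opp; apply: (big_ind O); [exact: O_0 | exact: O_add |].
by move=> i _; apply: O_mul => //; apply: O_exp.
Qed.
End Valuation.

Section EvalK.
Variables (C : closedFieldType) (K : fieldType) (c : {rmorphism C -> K}) (x y : K).
Local Notation P := {poly {poly C}}.

Definition evx : {poly C} -> K := horner_eval x \o map_poly c.
HB.instance Definition _ := GRing.RMorphism.on evx.
(** The map to the function field from the coordinate ring of the plane chart, x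
    and y being the two coordinate functions on the curve. *)
Definition evK : P -> K := horner_eval y \o map_poly evx.
HB.instance Definition _ := GRing.RMorphism.on evK.

Lemma evxC a : evx a%:P = c a.
Proof. by rewrite /evx /= map_polyC /horner_eval hornerC. Qed.
Lemma evxX : evx 'X = x.
Proof. by rewrite /evx /= map_polyX /horner_eval hornerX. Qed.
Lemma evKC s : evK s%:P = evx s.
Proof. by rewrite /evK /= map_polyC /horner_eval hornerC. Qed.
Lemma evKX : evK 'X = y.
Proof. by rewrite /evK /= map_polyX /horner_eval hornerX. Qed.

Lemma evKD s t : evK (s + t) = evK s + evK t. Proof. exact: rmorphD. Qed.
Lemma evKB s t : evK (s - t) = evK s - evK t. Proof. exact: rmorphB. Qed.
Lemma evKM s t : evK (s * t) = evK s * evK t. Proof. exact: rmorphM. Qed.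
Lemma evKXsubC a : evK ('X - a%:P)%:P = x - c a.
Proof. by rewrite evKC rmorphB /= evxX evxC. Qed.
Lemma evKYsubC a : evK ('X - a%:P%:P) = y - c a.
Proof. by rewrite evKB evKX evKC evxC. Qed.

Lemma evK_derivation (D : K -> K) (s : P) : derivation_over c D ->
  D (evK s) = evK (dx s) * D x + evK s^`() * D y.
Proof.
case=> DD DM DC.
have Dx (q : {poly C}) : D (evx q) = evx q^`() * D x.
  elim/poly_ind: q => [|q a IH].
    by rewrite deriv0 rmorph0 -(rmorph0 c) DC rmorph0 mul0r.
  rewrite derivD derivM derivC derivX addr0 mulr1 !rmorphD !rmorphM /= evxX evxC.
  by rewrite DD DM DC IH; ring.
elim/poly_ind: s => [|s a IH].
  by rewrite deriv0 /dx map_poly0 !rmorph0 -(rmorph0 c) DC rmorph0 !mul0r addr0.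
rewrite dxD dxM dxC dxX derivD derivM derivC derivX addr0 mulr1 mulr0 addr0.
rewrite !rmorphD !rmorphM /= !evKX !evKC DD DM Dx IH; ring.
Qed.
End EvalK.
Arguments evx : simpl never.
Arguments evK : simpl never.

(** * Differentials in an affine chart of a curve *)

Lemma evK_aff (C : numClosedFieldType) (K : fieldType) (c : {rmorphism C -> K})
    (x y : K) (M : 'M[C]_3) (h : {mpoly C[3]}) :
  evK c x y (aff M h) = mmap c (fun j => evK c x y (tau M j)) h.
Proof.
elim/(@mpoly_generated 3 C) : h => [a|i|g h Hg Hh|g h Hg Hh].
- by rewrite affC evKC evxC mmapC.
- by rewrite affXi mmapX mmap1U.
- by rewrite !rmorphD /= Hg Hh.
- by rewrite !rmorphM /= Hg Hh.
Qed.

(** On p = 0 the derivatives satisfy p_x x' + p_y y' = 0, so that the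
    differential (h / q) dx / p_y equals (v dx - u dy) / e as soon as e h = q (u
    p_x + v p_y). *)
Lemma regular_identity (K : fieldType) (e h q px py u v x' y' : K) :
  e != 0 -> q != 0 -> py != 0 -> e * h = q * (u * px + v * py) ->
  px * x' + py * y' = 0 -> h / (q * py) * x' = v / e * x' + - u / e * y'.
Proof.
move=> e0 q0 py0 key rel.
have ey : y' = - (px * x') / py.
  by apply: (mulIf py0); rewrite divfK // mulrC; apply/eqP; rewrite -addr_eq0 addrC rel.
have eh : h = q * (u * px + v * py) / e by rewrite -key mulrAC mulfV // mul1r.
by rewrite ey eh; field; rewrite e0 q0 py0.
Qed.

Section FunctionField.
Variables (C : numClosedFieldType) (K : fieldType) (c : {rmorphism C -> K}).
Variable (t : 'I_3 -> K).
Local Notation S := {mpoly C[3]}.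
Local Notation P := {poly {poly C}}.
Variables (p : S) (d : nat).
Hypotheses (ip : irreducible_mpoly p) (hp : p \is d.-homog).
Hypothesis generic : forall k (g : S), g \is k.-homog -> (mmap c t g = 0 <-> divides p g).
Hypothesis fractions : forall u : K, exists k (g h : S),
  [/\ g \is k.-homog, h \is k.-homog, mmap c t h != 0 & u = mmap c t g / mmap c t h].

Section Chart.
Variable M : 'M[C]_3.
Hypotheses (Mu : M \in unitmx) (p2 : p.@[M o2] != 0).

Let L i := mmap c t (lform M i).
Let x := L o1 / L o0.
Let y := L o2 / L o0.
Local Notation E := (evK c x y).

(** A multiple of p of degree 1 would be a constant multiple of p, but p does
    not vanish at M o2 whereas the form does. *)
Lemma lform_generic_neq0 i : i != o2 -> mmap c t (lform M i) != 0.
Proof.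
move=> i2; apply/eqP => /(generic (lform_homog M i))[s es].
have p0 : p != 0 by case: ip.
have d0 := irreducible_degree ip hp.
have s0 : s != 0 by apply: contraNneq (lform_neq0 Mu i) => z; rewrite es z mul0r.
have [|d1 hs] := dhomog_quotient p0 hp _ s0 (N := 1); first by rewrite -es lform_homog.
have d1' : (1 - d = 0)%N by lia.
rewrite d1' in hs; have ec := dhomog0_const hs.
have := lform_row Mu i o2; rewrite es mevalM eq_sym (negbTE i2) => /eqP.
rewrite mulf_eq0 (negbTE p2) orbF ec mevalC => /eqP z.
by move: s0; rewrite ec z mpolyC0 eqxx.
Qed.

(** The generic point t of the curve is L o0 times the point of the chart with
    coordinates (x, y). *)
Lemma mmap_chart k (h : S) : h \is k.-homog -> mmap c t h = L o0 ^+ k * E (aff M h).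
Proof.
move=> hh; have L0 : L o0 != 0 by apply: lform_generic_neq0.
pose v (j : 'I_3) : K := E (tau M j).
have tE j : t j = L o0 * v j.
  have LE i : L i = \sum_l c (invmx M l i) * t l.
    rewrite /L /lform rmorph_sum; apply: eq_bigr => l _.
    by rewrite /= mmapZ mmapX mmap1U.
  transitivity (\sum_i c (M i j) * L i).
    under eq_bigr => i _ do rewrite LE mulr_sumr.
    rewrite exchange_big /=.
    have WM := mulVmx Mu.
    transitivity (\sum_l c ((invmx M *m M) l j) * t l).
      rewrite WM (bigD1 j) //= mxE eqxx rmorph1 mul1r big1 ?addr0 // => l /negbTE lj.
      by rewrite mxE lj rmorph0 mul0r.
    apply: eq_bigr => l _; rewrite mxE rmorph_sum mulr_suml; apply: eq_bigr => i _.
    by rewrite rmorphM; ring.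
  rewrite big_ord3 /v /tau !rmorphD !rmorphM /= !evKC evKX !evxC evxX /=.
  by rewrite /x /y; field.
rewrite (mmap_eq _ _ tE) (mmap_homog_scale _ _ _ hh); congr (_ * _).
by rewrite evK_aff.
Qed.

(** A polynomial vanishing at the generic point homogenizes to a form vanishing
    there, hence divisible by p. *)
Lemma chart_eq0 s : (E s = 0) <-> naff M p %| s.
Proof.
have L0 : L o0 != 0 by apply: lform_generic_neq0.
have [mp sp tp ep] := naffP hp p2.
split=> [es|/(Pdiv.IdomainMonic.dvdpP mp)[q ->]].
  have ts : (tsz s <= (tsz s).+1)%N by [].
  have hk := homogenize_homog Mu (tsz s) s.
  have : mmap c t (homogenize M (tsz s) s) = 0.
    by rewrite (mmap_chart hk) aff_homogenize // es mulr0.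
  move=> /(generic hk)/(divides_aff_dvdp M).
  by rewrite aff_homogenize // (eqp_dvdl _ (eqp_naff p2)).
have := mmap_chart hp; have -> : mmap c t p = 0.
  by apply/(generic hp); exists 1; rewrite mul1r.
move=> /esym/eqP; rewrite mulf_eq0 expf_eq0 (negbTE L0) andbF /= => /eqP ap.
have -> : E (q * naff M p) = E (q * ((p.@[M o2])^-1%:P)%:P) * E (aff M p).
  by rewrite -evKM /naff -mul_polyC mulrA.
by rewrite ap mulr0.
Qed.

Lemma chart_fraction u : exists G H : P, E H != 0 /\ u = E G / E H.
Proof.
have L0 : L o0 != 0 by apply: lform_generic_neq0.
have [k [g [h [hg hh h0 ->]]]] := fractions u.
exists (aff M g), (aff M h); rewrite (mmap_chart hg); move: h0; rewrite (mmap_chart hh).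
rewrite mulf_eq0 negb_or => /andP[Lk h0]; split=> //.
by rewrite invfM mulrACA mulfV // mul1r.
Qed.

Lemma naff_irreducible : irreducible_poly (naff M p).
Proof. exact (irreducible_naff Mu ip hp p2). Qed.

Section Regular.
Variable O : set K.
Hypothesis vO : valuation_ring_over c O.
Hypothesis Ox : O x.

Lemma O_evx q : O (evx c x q).
Proof.
elim/poly_ind: q => [|q a IH]; first by rewrite rmorph0; apply: O_0 vO.
rewrite rmorphD rmorphM /= evxX evxC; apply: (O_add vO).
  exact: (O_mul vO).
exact: (O_const vO).
Qed.

Lemma O_y : O y.
Proof.
have [mp sp tp ep] := naffP hp p2.
apply: (O_integral vO (s := map_poly (evx c x) (naff M p))).
- by rewrite monic_map.
- by move=> i; rewrite coef_map; apply: O_evx.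
- by apply/rootP; have /chart_eq0 : naff M p %| naff M p by [].
Qed.

Lemma O_E s : O (E s).
Proof.
elim/poly_ind: s => [|s q IH]; first by rewrite rmorph0; apply: O_0 vO.
rewrite evKD evKM evKX evKC; apply: (O_add vO); last exact: O_evx.
by apply: (O_mul vO) => //; exact: O_y.
Qed.

(** The valuation ring O contains C[x, y], so its maximal ideal meets C[x] in a
    maximal ideal: if all x - a were units, the whole function field, which is
    algebraic over C(x), would be in O. Then y reduces to one of the roots of p
    (a, y), by the integrality of y. *)
Lemma chart_center : exists a : C * C,
  O_max O (x - c a.1) /\ O_max O (y - c a.2).
Proof.
have OxC a : O (x - c a) by apply: (O_sub vO) => //; apply: (O_const vO).
have OyC a : O (y - c a) by apply: (O_sub vO); [apply: O_y | apply: (O_const vO)].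
have [a xa] : exists a, O_max O (x - c a).
  apply: contrapT => /forallNP H.
  have U a : O_unit O (x - c a).
    by apply: contrapT => nU; apply: (H a).
  (* All nonzero polynomials in x, and then all nonzero functions, are units
     of O: the eliminant q of y from p and H' is a multiple of H'. *)
  have UR (q : {poly C}) : q != 0 -> O_unit O (evx c x q).
    move=> q0; have [rs ->] := closed_field_poly_normal q.
    rewrite -mul_polyC rmorphM rmorph_prod /= evxC; apply: (O_unitM vO).
      by apply: (O_unit_const vO); rewrite lead_coef_eq0.
    apply: (big_ind (O_unit O)).
    - by exists 1; rewrite mulr1; split=> //; apply: O_1 vO.
    - by move=> u v; apply: (O_unitM vO).
    - by move=> r _; rewrite rmorphB /= evxX evxC.
  have [_ _ _ [u nu]] := vO; apply: nu.
  have [G [H' [H0 ->]]] := chart_fraction u.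
  apply: (O_mul vO); first exact: O_E.
  have cop : coprimep (naff M p) H'.
    apply: (irreducible_coprimep naff_irreducible).
    by apply: contraNN H0 => /chart_eq0 ->.
  have /Bezout_coprimepP[[u1 v1] /= uv] := cop.
  have s1 : size (u1 * naff M p + v1 * H') == 1%N by rewrite -size_poly_eq1 in uv *.
  have e1 := size1_polyC (eq_leq (eqP s1)).
  set q := (u1 * naff M p + v1 * H')`_0 in e1.
  have q0 : q != 0 by apply: contraTneq s1 => c0; rewrite e1 c0 polyC0 size_poly0.
  have Ev : E v1 * E H' = evx c x q.
    have := congr1 E e1; rewrite evKD !evKM evKC => <-.
    have /chart_eq0 : naff M p %| naff M p by [].
    by move=> ->; rewrite mulr0 add0r.
  have -> : (E H')^-1 = E v1 * (evx c x q)^-1.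
    have E0 : E v1 * E H' != 0 by rewrite Ev; apply: O_unit_neq0 (UR _ q0).
    rewrite -Ev invfM mulrA mulfV ?mul1r //.
    by apply: contraNneq E0 => ->; rewrite mul0r.
  exact (O_mul vO (O_E v1) (O_unit_inv (UR _ q0))).
pose pa : {poly C} := map_poly (horner_eval a) (naff M p).
have [mp sp tp ep] := naffP hp p2.
have [s es] : exists s : P, naff M p = map_poly polyC pa + ('X - a%:P)%:P * s.
  have [|s es] := @linear_content C (naff M p - map_poly polyC pa) a.
    rewrite rmorphB /= -/pa -map_poly_comp map_poly_id ?subrr // => r _ /=.
    by rewrite /horner_eval hornerC.
  by exists s; rewrite mul_polyC -es addrC subrK.
have mpa : pa \is monic by rewrite monic_map.
have [ys epa] := closed_field_poly_normal pa; rewrite (monicP mpa) scale1r in epa.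
have Ez z : E (map_poly polyC ('X - z%:P)) = y - c z.
  have -> : map_poly polyC ('X - z%:P) = 'X - z%:P%:P :> P.
    by rewrite rmorphB /= map_polyX map_polyC.
  exact: evKYsubC.
have Epa : E (map_poly polyC pa) = \prod_(z <- ys) (y - c z).
  by rewrite epa !rmorph_prod; apply: eq_bigr => z _; exact: Ez.
have : O_max O (\prod_(z <- ys) (y - c z)).
  have /chart_eq0 e0 : naff M p %| naff M p by [].
  have -> : \prod_(z <- ys) (y - c z) = - E s * (x - c a).
    move: e0; rewrite {1}es evKD evKM Epa evKXsubC => /eqP; rewrite addr_eq0.
    by move=> /eqP ->; rewrite mulNr mulrC.
  by apply: (O_maxM vO) => //; apply: (O_opp vO); apply: O_E.
by move=> /(O_max_prod vO)[|b yb]; [move=> z; apply: OyC | exists (a, b)].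
Qed.

(** s - s (a) is in the maximal ideal of the centre a, hence in that of O. *)
Lemma center_unit a s : O_max O (x - c a.1) -> O_max O (y - c a.2) ->
  ev a s != 0 -> O_unit O (E s).
Proof.
move=> xa ya sa.
have e0 : ev (a.1, a.2) (s - (ev a s)%:P%:P) = 0.
  by rewrite evB [X in _ - X]evC hornerC -surjective_pairing subrr.
have [s1 [s2 es]] : exists s1 s2 : P, s - (ev a s)%:P%:P =
    s1 * ('X - a.1%:P)%:P + s2 * ('X - a.2%:P%:P).
  by do 2!eexists; exact: (split_at e0).
have := congr1 E es; rewrite evKB evKD !evKM evKXsubC evKYsubC evKC evxC => e.
apply: contrapT => nU.
have mE : O_max O (E s) by split=> //; apply: O_E.
have : O_max O (c (ev a s)).
  have -> : c (ev a s) = E s + - (E s1 * (x - c a.1) + E s2 * (y - c a.2)).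
    by rewrite -e opprB addrC subrK.
  apply: (O_maxD vO) => //; rewrite -mulN1r; apply: (O_maxM vO).
    by apply: (O_opp vO); apply: O_1 vO.
  apply: (O_maxD vO); apply: (O_maxM vO) => //; exact: O_E.
by case=> _; apply; apply: (O_unit_const vO).
Qed.

Lemma center_on_curve a : O_max O (x - c a.1) -> O_max O (y - c a.2) ->
  ev a (naff M p) = 0.
Proof.
move=> xa ya; apply/eqP; apply: contraT => /(center_unit xa ya)/O_unit_neq0.
have /chart_eq0 -> : naff M p %| naff M p by [].
by rewrite eqxx.
Qed.

Lemma chart_derivation D (s : P) : derivation_over c D ->
  D (E s) = E (dx s) * D x + E s^`() * D y.
Proof. exact: evK_derivation. Qed.

(** The hypothesis is the adjoint condition at each point of the curve p q = 0
    on p = 0: locally h is in the ideal generated by the partial derivatives of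
    p q. At the centre of O it lets the differential be written with numerators
    and denominators regular at O ([regular_identity]). *)
Lemma chart_regular (q h : P) :
  E q != 0 -> E (naff M p)^`() != 0 ->
  (forall a, ev a (naff M p) = 0 -> exists e u v : P, ev a e != 0 /\
     naff M p * q %| e * h - (u * dx (naff M p * q) + v * (naff M p * q)^`())) ->
  regular_at c O [:: (E h / (E q * E (naff M p)^`()), x)].
Proof.
move=> q0 py0 adj; have [a [xa ya]] := chart_center.
have [e [u [v [ea]]]] := adj a (center_on_curve xa ya).
have p0 : E (naff M p) = 0 by apply/chart_eq0.
have [mp sp tp ep] := naffP hp p2.
move=> dv; have : E (e * h - (u * dx (naff M p * q) + v * (naff M p * q)^`())) = 0.
  by apply/chart_eq0; apply: dvdp_trans dv; apply: dvdp_mulIl.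
rewrite dxM derivM evKB evKD !evKM !evKD !evKM p0 !mul0r !addr0 ?add0r.
move=> /eqP; rewrite subr_eq0 => /eqP key0.
have key : E e * E h = E q * (E u * E (dx (naff M p)) + E v * E (naff M p)^`()).
  by rewrite key0; ring.
have Ue := center_unit xa ya ea; have e0 := O_unit_neq0 Ue.
exists [:: (E v / E e, x); (- E u / E e, y)]; split.
  move=> uv; rewrite !inE => /orP[] /eqP -> /=; split; [|exact: Ox| |exact: O_y].
    by apply: (O_mul vO); [apply: O_E | exact: (O_unit_inv Ue)].
  by apply: (O_mul vO); [apply: (O_opp vO); apply: O_E | exact: (O_unit_inv Ue)].
move=> D der; rewrite /contract !big_cons !big_nil /= !addr0.
have rel : E (dx (naff M p)) * D x + E (naff M p)^`() * D y = 0.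
  rewrite -chart_derivation // p0; case: der => _ _ DC.
  by have := DC 0; rewrite rmorph0.
apply: (regular_identity e0 q0 py0 key rel).
Qed.
End Regular.
End Chart.
End FunctionField.

(** * The adjoint condition at a node *)

Section Adjoint.
Variable C : numClosedFieldType.
Local Notation S := {mpoly C[3]}.
Local Notation P := {poly {poly C}}.
Variables (M : 'M[C]_3) (f h : S) (N : nat).
Hypotheses (Mu : M \in unitmx) (hf : f \is N.-homog).

Definition directional (i : 'I_3) : S := \sum_j M i j *: f^`M(j).

Lemma directional_homog i : directional i \is (N.-1).-homog.
Proof.
by apply: rpred_sum => j _; apply: dhomogZ; apply: dhomog_mderiv.
Qed.

Lemma directional_eval i v : (directional i).@[v] = dot (M i) (grad f v).
Proof.
by rewrite /directional raddf_sum; apply: eq_bigr => j _; rewrite /= mevalZ.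
Qed.

Lemma dx_directional : dx (aff M f) = aff M (directional o1).
Proof.
rewrite dx_aff /directional rmorph_sum; apply: eq_bigr => j _.
by rewrite /= affZ mulrC.
Qed.

Lemma deriv_directional : (aff M f)^`() = aff M (directional o2).
Proof.
rewrite deriv_aff /directional rmorph_sum; apply: eq_bigr => j _.
by rewrite /= affZ mulrC.
Qed.

Lemma frame_decomposition (j k : 'I_3) : \sum_i invmx M j i * M i k = (j == k)%:R.
Proof. by have /matrixP/(_ j k) := mulVmx Mu; rewrite !mxE. Qed.

(** The derivatives along the two axes of the chart vanish, and so does the one
    along the position vector, by Euler's identity. *)
Lemma directional_singular a : f.@[point M a] = 0 ->
  (directional o1).@[point M a] = 0 -> (directional o2).@[point M a] = 0 ->
  forall j, f^`M(j).@[point M a] = 0.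
Proof.
rewrite !directional_eval; set P0 := point M a; set g := grad f P0 => f0 d1 d2.
have gP : dot g P0 = 0 by rewrite (euler _ hf) f0 mulr0.
have d0 : dot (M o0) g = 0.
  transitivity (dot g P0 - a.1 * dot (M o1) g - a.2 * dot (M o2) g).
    by rewrite !dot3 /P0 /point; ring.
  by rewrite gP d1 d2 !mulr0 !subr0.
move=> j; transitivity (\sum_i invmx M j i * dot (M i) g); last first.
  by rewrite big_ord3 /= d0 d1 d2 !mulr0 !addr0.
under eq_bigr => i _ do rewrite /dot mulr_sumr.
rewrite exchange_big /= (bigD1 j) //= [X in _ + X]big1 ?addr0 => [|k kj].
  under eq_bigr => i _ do rewrite mulrA.
  by rewrite -mulr_suml frame_decomposition eqxx mul1r.
under eq_bigr => i _ do rewrite mulrA.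
by rewrite -mulr_suml frame_decomposition eq_sym (negbTE kj) mul0r.
Qed.

(** At a singular point the Hessian matrix has the position vector in its
    kernel, so its rows are combinations of the gradients of the two derivatives
    along the axes of the chart. If these were parallel it would have rank at
    most 1, and no nonzero minor of size 2. *)
Lemma directional_transversal a j k : (forall i, f^`M(i).@[point M a] = 0) ->
  hessian_minor (point M a) f j k != 0 ->
  transversal (directional o1) (directional o2) (point M a).
Proof.
set v := point M a => df0 mjk.
pose g i := grad f^`M(i) v; pose G i := grad (directional i) v.
have GE i l : G i l = \sum_m M i m * g m l.
  by rewrite /G /g /grad /directional !big_ord3 /= !mderivD !mderivZ !mevalD !mevalZ.
have gP l : \sum_m v m * g m l = 0.
  have e := euler v (dhomog_mderiv l hf); rewrite df0 mulr0 in e; rewrite -[RHS]e.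
  by apply: eq_bigr => m _; rewrite /g /grad mderiv_comm mulrC.
have G0 l : G o0 l = - a.1 * G o1 l - a.2 * G o2 l.
  rewrite !GE; apply/eqP; rewrite -subr_eq0 -[X in _ == X](gP l).
  by rewrite !big_ord3 /= /v /point; apply/eqP; ring.
pose b i := invmx M i o1 - a.1 * invmx M i o0.
pose c i := invmx M i o2 - a.2 * invmx M i o0.
have gE i l : g i l = b i * G o1 l + c i * G o2 l.
  transitivity (\sum_m invmx M i m * G m l).
    under [RHS]eq_bigr => m _ do rewrite GE mulr_sumr.
    rewrite exchange_big /= (bigD1 i) //= [X in _ + X]big1 ?addr0 => [|m mi].
      under eq_bigr => m _ do rewrite mulrA.
      by rewrite -mulr_suml frame_decomposition eqxx mul1r.
    under eq_bigr => n _ do rewrite mulrA.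
    by rewrite -mulr_suml frame_decomposition eq_sym (negbTE mi) mul0r.
  by rewrite big_ord3 /= G0 /b /c; ring.
apply: contrapT => /forallNP nt.
have c0 i : cross (G o1) (G o2) i = 0 by apply/eqP/negPn/negP; exact: nt.
move/negP: mjk; apply; apply/eqP.
have -> : hessian_minor v f j k = g j j * g k k - g j k * g k j by [].
rewrite !gE; have := c0 o0; have := c0 o1; have := c0 o2; rewrite /cross /=.
move: (b j) (b k) (c j) (c k) => bj bk cj ck c2 c1 c00.
have sw : G o1 j * G o2 k = G o1 k * G o2 j.
  move: c2 c1 c00; move: (G o1) (G o2) => u w c2 c1 c00.
  apply/eqP; rewrite -subr_eq0; apply/eqP.
  by case: (ord3P j) => ->; case: (ord3P k) => ->; rewrite ?subrr //;
    apply/eqP; rewrite -oppr_eq0 opprB; apply/eqP.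
transitivity ((bj * ck - cj * bk) * (G o1 j * G o2 k - G o1 k * G o2 j)).
  by ring.
by rewrite sw subrr mulr0.
Qed.

Hypothesis adjoint : forall v, (exists j, v j != 0) -> f.@[v] = 0 ->
  (forall j, f^`M(j).@[v] = 0) -> h.@[v] = 0 /\ exists j k, hessian_minor v f j k != 0.

(** Where one of the derivatives along the axes is nonzero it is the unit e. At
    a singular point these derivatives meet transversally, so Cramer's rule
    expresses x - a1 and y - a2, and with them h, by the two derivatives up to
    the unit given by their Jacobian determinant. *)
Lemma adjoint_local a : f.@[point M a] = 0 -> exists e u v : P, ev a e != 0 /\
  e * aff M h = u * dx (aff M f) + v * (aff M f)^`().
Proof.
move=> f0; rewrite dx_directional deriv_directional.
set F1 := directional o1; set F2 := directional o2.
have [d1|n1] := eqVneq F1.@[point M a] 0; last first.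
  by exists (aff M F1), (aff M h), 0; rewrite ev_aff; split=> //; ring.
have [d2|n2] := eqVneq F2.@[point M a] 0; last first.
  by exists (aff M F2), 0, (aff M h); rewrite ev_aff; split=> //; ring.
have df0 := directional_singular f0 d1 d2.
have [h0 [j [k mjk]]] := adjoint (point_neq0 a Mu) f0 df0.
have tr := directional_transversal df0 mjk.
have jac := transversal_jacobian Mu (directional_homog o1) (directional_homog o2) d1 d2 tr.
have split (g : S) : g.@[point M a] = 0 -> exists s1 s2 : P,
    aff M g = s1 * ('X - a.1%:P)%:P + s2 * ('X - a.2%:P%:P).
  move=> g0; have e : ev (a.1, a.2) (aff M g) = 0.
    by rewrite -surjective_pairing ev_aff.
  by do 2!eexists; exact: (split_at e).
have [s11 [s12 e1]] := split _ d1; have [s21 [s22 e2]] := split _ d2.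
have [h1 [h2 eh]] := split _ h0.
have [x1 y1] := ev_split e1; have [x2 y2] := ev_split e2.
exists (s11 * s22 - s12 * s21), (h1 * s22 - h2 * s21), (h2 * s11 - h1 * s12).
split; first by rewrite evB !evM -x1 -x2 -y1 -y2.
rewrite eh e1 e2; move: ('X - a.1%:P)%:P ('X - a.2%:P%:P) => X Y; ring.
Qed.
End Adjoint.

(** * Derivations of the function field *)

Section DerivationExists.
Variables (C : numClosedFieldType) (K : fieldType) (c : {rmorphism C -> K}) (x y : K).
Local Notation P := {poly {poly C}}.
Local Notation E := (evK c x y).
Variable p : P.
Hypothesis kerE : forall s : P, E s = 0 -> exists q, s = q * p.
Hypothesis pE : E p = 0.
Hypothesis fracE : forall u : K, exists GH : P * P, E GH.2 != 0 /\ u = E GH.1 / E GH.2.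

Let delta (s : P) : K := E (dx s) * E p^`() - E s^`() * E (dx p).

Lemma deltaD s t : delta (s + t) = delta s + delta t.
Proof. by rewrite /delta dxD derivD !evKD; ring. Qed.
Lemma deltaM s t : delta (s * t) = E s * delta t + E t * delta s.
Proof. by rewrite /delta dxM derivM !evKD !evKM; ring. Qed.
Lemma delta_ker s t : E s = E t -> delta s = delta t.
Proof.
move=> st; have [|q e] := kerE (s := s - t); first by rewrite evKB st subrr.
have -> : s = t + q * p by rewrite -e addrC subrK.
rewrite deltaD deltaM pE mul0r addr0 {2}/delta.
by rewrite [_ * E p^`()]mulrC subrr mulr0 addr0.
Qed.

Let fr (u : K) : P * P := projT1 (cid (fracE u)).
Let D (u : K) : K := (delta (fr u).1 - u * delta (fr u).2) / E (fr u).2.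

Lemma fracD (G H : P) : E H != 0 ->
  D (E G / E H) = (delta G - E G / E H * delta H) / E H.
Proof.
move=> H0; rewrite /D /fr; case: (cid _) => [[G' H'] /= [H'0 e]].
have e1 : E (G * H') = E (G' * H).
  by rewrite !evKM; apply: (mulIf (mulf_neq0 (invr_neq0 H0) (invr_neq0 H'0)));
    move: e; set a := E G; set b := E G' => e; transitivity (a / E H);
    [by field; rewrite H0 H'0 | rewrite e; field; rewrite H0 H'0].
have := delta_ker e1; rewrite !deltaM => e2.
move: e2 e H0 H'0; move: (delta G) (delta G') (delta H) (delta H') (E G) (E G') (E H) (E H').
move=> dG dG' dH dH' a a' b b' e2 e b0 b'0.
set u := a / b in e *.
have ea : a = u * b by rewrite /u divfK.
have ea' : a' = u * b' by rewrite e divfK.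
apply: (mulIf (mulf_neq0 b0 b'0)); rewrite ea ea' in e2.
transitivity ((dG' - u * dH') * b); first by field.
transitivity ((dG - u * dH) * b'); last by field.
have -> : (dG - u * dH) * b' = (u * b * dH' + b' * dG) - u * b * dH' - u * b' * dH by ring.
by rewrite e2; ring.
Qed.

(** The derivation s |-> s_x p_y - s_y p_x of C[x, y] kills p, hence descends to
    the curve and extends to fractions. It shows that a differential w dx with w
    p_y nonzero is not zero. *)
Theorem derivation_exists : exists D : K -> K, derivation_over c D /\
  D x = E p^`() /\ D y = - E (dx p).
Proof.
have E1 : E 1 = 1 by rewrite rmorph1.
have D1 (G : P) : D (E G) = delta G.
  have := fracD G (H := 1); rewrite E1 oner_neq0 !divr1 => -> //.
  by rewrite /delta -polyC1 dxC !derivC polyC0 rmorph0 !mul0r subrr mulr0 subr0.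
have E0 : E 0 = 0 by rewrite rmorph0.
exists D; split; last first.
  split.
    have := D1 'X%:P; rewrite {1}evKC evxX => ->.
    by rewrite /delta dxC derivX derivC polyC1 E1 E0 mul1r mul0r subr0.
  have := D1 'X; rewrite {1}evKX => ->.
  by rewrite /delta dxX derivX E1 E0 mul1r mul0r sub0r.
split=> [u v|u v|a].
- have [[G H] /= [H0 ->]] := fracE u; have [[G' H'] /= [H'0 ->]] := fracE v.
  have HH : E (H * H') != 0 by rewrite evKM mulf_neq0.
  have -> : E G / E H + E G' / E H' = E (G * H' + G' * H) / E (H * H').
    by rewrite evKD !evKM; field; rewrite H0 H'0.
  rewrite !fracD // deltaD !deltaM evKD !evKM; field; rewrite H0 H'0 //.
- have [[G H] /= [H0 ->]] := fracE u; have [[G' H'] /= [H'0 ->]] := fracE v.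
  have HH : E (H * H') != 0 by rewrite evKM mulf_neq0.
  have -> : E G / E H * (E G' / E H') = E (G * G') / E (H * H').
    by rewrite !evKM; field; rewrite H0 H'0.
  rewrite !fracD // !deltaM !evKM; field; rewrite H0 H'0 //.
- have := D1 a%:P%:P; rewrite {1}evKC evxC => ->.
  by rewrite /delta dxC !derivC polyC0 E0 !mul0r subrr.
Qed.
End DerivationExists.

(** * Curves of genus zero have no adjoints *)

Section GenusZero.
Variables (C : numClosedFieldType) (K : fieldType) (c : {rmorphism C -> K}).
Variable (t : 'I_3 -> K).
Local Notation S := {mpoly C[3]}.
Local Notation P := {poly {poly C}}.
Variables (p q h : S) (d e m : nat).
Hypotheses (ip : irreducible_mpoly p) (hp : p \is d.-homog).
Hypotheses (hq : q \is e.-homog) (npq : ~ divides p q).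
Hypotheses (hh : h \is m.-homog) (nph : ~ divides p h) (dem : (d + e = m + 3)%N).
Hypothesis generic : forall k (g : S), g \is k.-homog -> (mmap c t g = 0 <-> divides p g).
Hypothesis fractions : forall u : K, exists k (g h : S),
  [/\ g \is k.-homog, h \is k.-homog, mmap c t h != 0 & u = mmap c t g / mmap c t h].
Hypothesis adjoint : forall v, (exists j, v j != 0) -> (p * q).@[v] = 0 ->
  (forall j, (p * q)^`M(j).@[v] = 0) ->
  h.@[v] = 0 /\ exists j k, hessian_minor v (p * q) j k != 0.

Section Chart.
Variable M : 'M[C]_3.
Hypotheses (Mu : M \in unitmx) (p2 : p.@[M o2] != 0).
Let L i := mmap c t (lform M i).
Local Notation x := (L o1 / L o0).
Local Notation y := (L o2 / L o0).
Local Notation E := (evK c x y).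

(** The cofactor of the monic equation of p in the equation of p q. *)
Definition cofactor_poly : P := (p.@[M o2])%:P%:P * aff M q.

(** The coefficient of dx in the residue (h / q) dx / p_y of h / (p q) along p. *)
Definition chart_coefficient : K :=
  E (aff M h) / (E cofactor_poly * E (naff M p)^`()).

Lemma chart_equation : naff M p * cofactor_poly = aff M (p * q).
Proof.
have [_ _ _ ep] := naffP hp p2.
rewrite rmorphM /= ep /cofactor_poly -mul_polyC.
by move: (naff M p) (aff M q) (_%:P) => u v w; ring.
Qed.

Lemma cofactor_neq0 : E cofactor_poly != 0.
Proof.
apply/eqP => /(chart_eq0 ip hp generic Mu p2); rewrite /cofactor_poly.
rewrite mul_polyC dvdpZr ?polyC_eq0 // (eqp_dvdl _ (eqp_naff p2)).
by move=> /(aff_dvdp_divides Mu hp p2 hq).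
Qed.

Lemma numerator_neq0 : E (aff M h) != 0.
Proof.
apply/eqP => /(chart_eq0 ip hp generic Mu p2); rewrite (eqp_dvdl _ (eqp_naff p2)).
by move=> /(aff_dvdp_divides Mu hp p2 hh).
Qed.

Lemma deriv_neq0 : E (naff M p)^`() != 0.
Proof.
have d0 := irreducible_degree ip hp.
have [mp sp tp ep] := naffP hp p2.
apply/eqP => /(chart_eq0 ip hp generic Mu p2) /dvdp_leq.
have cd : (naff M p)^`()`_d.-1 != 0.
  rewrite coef_deriv (prednK d0); have := monicP mp; rewrite lead_coefE sp /= => ->.
  by rewrite -polyC1 -polyCMn polyC_eq0 pnatr_eq0 -lt0n.
have n0 : (naff M p)^`() != 0 by apply: contraNneq cd => ->; rewrite coef0.
move=> /(_ n0); rewrite leqNgt lt_size_deriv // monic_neq0 //.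
Qed.

(** The expression depends on the frame only through L o0 and the last axis.
    This is how the charts with L o0 and L o1 exchanged are compared: d
    (1 / x) = - dx / x ^ 2 absorbs the change of L o0, precisely because h has
    degree d + e - 3. *)
Lemma chart_coefficient_homog : chart_coefficient =
  mmap c t h / (mmap c t q * mmap c t (directional M p o2)) * L o0 ^+ 2.
Proof.
have d0 := irreducible_degree ip hp.
have L0 : L o0 != 0 := lform_generic_neq0 ip hp generic Mu p2 (i := o0) isT.
have q0 := cofactor_neq0; have py0 := deriv_neq0.
rewrite /chart_coefficient; rewrite /cofactor_poly evKM evKC evxC in q0 *.
have pyE : E (naff M p)^`() = c (p.@[M o2])^-1 * E (aff M (directional M p o2)).
  rewrite /naff -mul_polyC derivM derivC mul0r add0r evKM evKC evxC.
  by rewrite deriv_directional.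
rewrite pyE in py0 *.
rewrite (mmap_chart ip hp generic Mu p2 hh) (mmap_chart ip hp generic Mu p2 hq).
rewrite (mmap_chart ip hp generic Mu p2 (directional_homog M hp o2)).
move: q0 py0; rewrite [in X in X -> _]mulf_eq0 negb_or => /andP[c0 q0].
rewrite mulf_eq0 negb_or => /andP[ci0 f0].
move: L0 q0 f0; rewrite -/(L o0).
move: (evK c x y (aff M h)) (evK c x y (aff M q)) (evK c x y (aff M (directional M p o2))).
move: (L o0) => l H Q F l0 Q0 F0.
rewrite fmorphV; move: c0; move: (c p.@[M o2]) => cp cp0.
have -> : l ^+ m * H / (l ^+ e * Q * (l ^+ d.-1 * F)) * l ^+ 2 =
    (l ^+ m * l ^+ 2) / (l ^+ e * l ^+ d.-1) * (H / (Q * F)).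
  by field; rewrite Q0 F0 !expf_neq0.
have -> : l ^+ m * l ^+ 2 = l ^+ e * l ^+ d.-1.
  rewrite -!exprD; congr (_ ^+ _); move: dem d0; clear; lia.
by rewrite mulfV ?mulf_neq0 ?expf_neq0 // mul1r; field; rewrite Q0 F0 cp0.
Qed.

Lemma chart_form_regular (O : set K) : valuation_ring_over c O -> O x ->
  regular_at c O [:: (chart_coefficient, x)].
Proof.
move=> vO Ox.
apply: (chart_regular ip hp generic fractions Mu p2 vO Ox cofactor_neq0 deriv_neq0).
move=> a pa; rewrite chart_equation.
have fa : (p * q).@[point M a] = 0.
  by rewrite -ev_aff -chart_equation evM pa mul0r.
have [e' [u [v [ea E']]]] := adjoint_local Mu (dhomogM hp hq) adjoint fa.
by exists e', u, v; split=> //; rewrite E' subrr dvdp0.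
Qed.

Lemma chart_form_nonzero : exists D : K -> K, derivation_over c D /\
  contract D [:: (chart_coefficient, x)] != 0.
Proof.
have [mp sp tp ep] := naffP hp p2.
have [||u|D [der [Dx Dy]]] := @derivation_exists C K c x y (naff M p).
- move=> s /(chart_eq0 ip hp generic Mu p2)/(Pdiv.IdomainMonic.dvdpP mp)[w ->].
  by exists w.
- by apply/(chart_eq0 ip hp generic Mu p2).
- have [G [H [H0 e0]]] := chart_fraction ip hp generic fractions Mu p2 u.
  by exists (G, H).
exists D; split=> //; rewrite /contract big_seq1 /= Dx /chart_coefficient.
rewrite !mulf_neq0 ?invr_eq0 ?deriv_neq0 ?numerator_neq0 //.
by rewrite mulf_neq0 ?cofactor_neq0 ?deriv_neq0.
Qed.
End Chart.

(** The frame of the chart in which x becomes 1 / x. *)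
Lemma swapped_frame (M : 'M[C]_3) : M \in unitmx -> exists2 M' : 'M[C]_3,
  M' \in unitmx & [/\ M' o2 =1 M o2, lform M' o0 = lform M o1 & lform M' o1 = lform M o0].
Proof.
move=> Mu; pose s (i : 'I_3) := if i == o0 then o1 else if i == o1 then o0 else o2.
have s_inj : injective s.
  by move=> i j; case: (ord3P i) => ->; case: (ord3P j) => ->.
pose M' : 'M[C]_3 := \matrix_(i, j) M (s i) j.
pose W' : 'M[C]_3 := \matrix_(j, i) invmx M j (s i).
have MW : M' *m W' = 1%:M.
  apply/matrixP => i k; have /matrixP/(_ (s i) (s k)) := mulmxV Mu.
  rewrite !mxE (inj_eq s_inj) => <-; apply: eq_bigr => j _.
  by rewrite !mxE.
have M'u : M' \in unitmx by have [] := mulmx1_unit MW.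
have We : invmx M' = W' by rewrite -[W']mul1mx -(mulVmx M'u) -mulmxA MW mulmx1.
exists M' => //; split; first by move=> j; rewrite mxE.
  by apply: eq_bigr => j _; rewrite We mxE.
by apply: eq_bigr => j _; rewrite We mxE.
Qed.

(** A valuation ring contains x or 1 / x, and the two charts given by
    [swapped_frame] define the same differential up to sign. It is regular
    everywhere, so in genus 0 it is equal to the empty sum; but some derivation
    does not kill it. *)
Theorem genus_zero_no_adjoint : has_genus c 0 -> False.
Proof.
have d0 := irreducible_degree ip hp; have [p0 _ _] := ip.
have [M Mu p2] := frame_through p0 (ex_intro2 _ _ d d0 hp).
have [M' M'u [Ms L0' L1']] := swapped_frame Mu.
have p2' : p.@[M' o2] != 0 by rewrite (meval_eq _ Ms).
have X0 : mmap c t (lform M o0) != 0 := lform_generic_neq0 ip hp generic Mu p2 (i := o0) isT.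
have X1 : mmap c t (lform M o1) != 0 := lform_generic_neq0 ip hp generic Mu p2 (i := o1) isT.
set x := mmap c t (lform M o1) / mmap c t (lform M o0).
pose w := [:: (chart_coefficient M, x)].
case=> b [_ basis].
have reg : regular_differential c w.
  move=> O vO; have [Ox|Oxi] := O_val vO x; first exact: chart_form_regular.
  have := chart_form_regular M'u p2' vO; rewrite L0' L1'.
  have -> : mmap c t (lform M o0) / mmap c t (lform M o1) = x^-1 by rewrite /x invf_div.
  move=> /(_ Oxi)[w' [Ow' ew']].
  exists [seq (- uv.1, uv.2) | uv <- w']; split.
    move=> uv /mapP[uv' /Ow'[O1 O2] ->]; split=> //; exact: (O_opp vO).
  move=> D der; have := ew' D der.
  have -> : contract D [seq (- uv.1, uv.2) | uv <- w'] = - contract D w'.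
    rewrite /contract big_map -sumrN; apply: eq_bigr => uv _.
    by rewrite mulNr.
  move=> <-; rewrite /contract !big_seq1 /=.
  have x0 : x != 0 by rewrite mulf_neq0 ?invr_eq0.
  have Dxi : D x^-1 = - (D x / x ^+ 2).
    case: der => DD DM DC.
    have D1 : D 1 = 0 by have := DC 1; rewrite rmorph1.
    have := DM x x^-1; rewrite mulfV // D1 => /esym/eqP; rewrite addr_eq0 => /eqP e1.
    by apply: (mulfI x0); rewrite e1; field.
  rewrite Dxi !chart_coefficient_homog //.
  have -> : directional M' p o2 = directional M p o2.
    by apply: eq_bigr => j _; rewrite Ms.
  rewrite L0' mulrN opprK /x.
  move: (D (_ / _)) => Dx.
  have key (l0 l1 w0 : K) : l0 != 0 -> l1 != 0 ->
    w0 * l1 ^+ 2 * (Dx / (l1 / l0) ^+ 2) = w0 * l0 ^+ 2 * Dx.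
    by move=> l00 l10; field; rewrite l00 l10.
  by rewrite key.
have [l [eq0 _]] := basis w reg.
have [D [der nz]] := chart_form_nonzero Mu p2.
move/negP: nz; apply; apply/eqP; have := eq0 D der; rewrite -/x -/w => ->.
have -> : enum 'I_0 = [::] by apply: size0nil; rewrite size_enum_ord.
by rewrite /contract big_nil.
Qed.
End GenusZero.

(** * Rational nodal curves *)

Section Scaling.
Variable C : numClosedFieldType.
Local Notation S := {mpoly C[3]}.

Lemma hessian_minor_scale N (f : S) (v w : 'I_3 -> C) s j k : f \is N.-homog ->
  v =1 (fun i => s * w i) ->
  hessian_minor v f j k = (s ^+ N.-2) ^+ 2 * hessian_minor w f j k.
Proof.
move=> hf vw; have sc i l : f^`M(i)^`M(l).@[v] = s ^+ N.-2 * f^`M(i)^`M(l).@[w].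
  exact: meval_prop (dhomog_mderiv l (dhomog_mderiv i hf)) vw.
by rewrite /hessian_minor !sc; ring.
Qed.

(** The factors are pairwise coprime: if all of them divide h, so does their
    product f, whose degree is too large. *)
Lemma factor_not_dividing N k (f h : S) c (ps : seq S) : f != 0 -> f \is N.-homog ->
  c != 0 -> f = c *: \prod_(p <- ps) p -> uniq ps ->
  (forall p, p \in ps -> monic_factor p) ->
  h != 0 -> h \is k.-homog -> (k < N)%N -> exists2 p, p \in ps & ~ divides p h.
Proof.
move=> f0 hf c0 ef ups mps h0 hh kN; apply: contrapT => H.
have all_div p : p \in ps -> divides p h.
  by move=> pps; apply: contrapT => np; apply: H; exists p.
have N0 : (0 < N)%N by apply: leq_ltn_trans kN.
have [M Mu f2] := frame_through f0 (ex_intro2 _ _ N N0 hf).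
have P2 : (\prod_(p <- ps) p).@[M o2] != 0.
  by move: f2; rewrite ef mevalZ mulf_eq0 negb_or => /andP[].
have p2 p : p \in ps -> p.@[M o2] != 0.
  by move=> pps; apply: contraNneq P2 => z; rewrite (big_rem p pps) /= mevalM z mul0r.
have hP : \prod_(p <- ps) p \is N.-homog.
  have -> : \prod_(p <- ps) p = c^-1 *: f by rewrite ef scalerA mulVf // scale1r.
  exact: dhomogZ.
have [|q eq_h] := aff_dvdp_divides Mu hP P2 hh.
  by apply: prod_naff_dvdp => // p pps; apply: divides_aff_dvdp; apply: all_div.
have q0 : q != 0 by apply: contraNneq h0 => z; rewrite eq_h z mul0r.
have Pn : \prod_(p <- ps) p != 0 by apply: contraNneq P2 => ->; rewrite meval0.
rewrite eq_h in hh; have [] := dhomog_quotient Pn hP hh q0.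
by rewrite leqNgt kN.
Qed.

Lemma varX_neq0 i : 'X_i != 0 :> S.
Proof.
apply/eqP => /(congr1 (meval (fun=> 1)))/eqP.
by rewrite mevalXU meval0 oner_eq0.
Qed.

Lemma singular_linear_form (f : S) v : f \is 1.-homog ->
  (forall j, f^`M(j).@[v] = 0) -> f = 0.
Proof.
move=> hf df; have df0 j : f^`M(j) = 0.
  have e := dhomog0_const (dhomog_mderiv j hf).
  by have := df j; rewrite e mevalC => ->; rewrite mpolyC0.
apply/eqP; apply: contraT => /mpoly_nonroot[w]; have := euler w hf.
rewrite mul1r => <-; rewrite /dot big1 ?eqxx // => j _.
by rewrite /grad df0 meval0 mul0r.
Qed.
End Scaling.

Section Rational.
Variable R : realType.
Local Notation C := (R[i]).
Local Notation S := {mpoly C[3]}.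
Variables (N : nat) (f : S).
Hypotheses (nf : nodal_curve N f) (rf : rational_curve f).

(** Multiplying by a power of a coordinate, one may assume that h has degree
    N - 3. *)
Lemma rational_no_adjoint k (h : S) : (k + 3 <= N)%N -> h \is k.-homog ->
  (forall a, a \in nodes f -> h.@[hcoord a] = 0) -> h = 0.
Proof.
move=> kN hh hA; apply/eqP; apply: contraT => h0.
have [N0 f0 hf _ _] := nf.
have [c [ps [c0 ef ups mps]]] := nodal_factorization nf.
pose h' : S := h * 'X_o0 ^+ (N - 3 - k).
have hh' : h' \is (N - 3).-homog.
  have -> : (N - 3 = k + 1 * (N - 3 - k))%N by move: kN; clear; lia.
  by apply: dhomogM => //; apply: dhomogMn; rewrite dhomogX; apply/eqP; exact: mdeg1.
have h'0 : h' != 0 by rewrite mulf_neq0 // expf_neq0 // varX_neq0.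
have [|p pps np] := factor_not_dividing f0 hf c0 ef ups mps h'0 hh'.
  by move: kN N0; clear; lia.
have mp := mps p pps; have [ip _ [d hp]] := mp.
have [K [cK [t [[gen frac] g0]]]] := rf (proj2 (component_mem nf c0 ef mps p) pps).
pose q : S := c *: \prod_(r <- rem p ps) r.
have fpq : f = p * q by rewrite ef (big_rem p pps) /= -scalerAr.
have p0 : p != 0 by case: ip.
have q0 : q != 0 by apply: contraNneq f0 => z; rewrite fpq z mulr0.
have hqp : q * p \is N.-homog by rewrite mulrC -fpq.
have [dN hq] := dhomog_quotient p0 hp hqp q0.
have npq : ~ divides p q.
  case=> u eu; have : p \in rem p ps.
    apply: (divides_prod mp); first by move=> r /mem_rem; apply: mps.
    by exists (c^-1 *: u); rewrite -scalerAl -eu scalerA mulVf // scale1r.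
  by rewrite mem_rem_uniq // !inE eqxx.
have dem : (d + (N - d) = N - 3 + 3)%N by move: dN kN; clear; lia.
apply: False_rect.
apply: (genus_zero_no_adjoint ip hp hq npq hh' np dem gen frac _ g0) => v v0.
rewrite -fpq => fv dfv; have [a [s [s0 vE]]] := P2_exists v0.
have sa : singular_point f a.
  split=> [|j].
    move/eqP: fv; rewrite (meval_prop hf vE) mulf_eq0 expf_eq0 (negbTE s0) andbF.
    by move/eqP.
  move/eqP: (dfv j); rewrite (meval_prop (dhomog_mderiv j hf) vE).
  by rewrite mulf_eq0 expf_eq0 (negbTE s0) andbF => /eqP.
have aZ : a \in nodes f by apply/(in_nodes nf c0 ef ups mps).
split.
  by rewrite mevalM (meval_prop hh vE) (hA a aZ) mulr0 mul0r.
have [j [l mjl]] := node_minor nf aZ; exists j, l.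
by rewrite (hessian_minor_scale j l hf vE) mulf_neq0 // !expf_neq0.
Qed.

Lemma rational_defect k : (k + 3 <= N)%N ->
  defect k (nodes f) = (#|` nodes f|)%:Z - (\dim {:dhomog 3 C k})%:Z.
Proof.
move=> kN; rewrite /defect /codim_vanishing.
have -> : vanishing_on k (nodes f) = 0%VS.
  apply/eqP; rewrite -subv0; apply/subvP => h /vanishing_onP hA; rewrite memv0.
  by apply/eqP/val_inj; apply: (rational_no_adjoint kN) hA; case: h.
by rewrite dimv0 subr0.
Qed.
End Rational.

Lemma defect_negz (R : realType) n (A : {fset P2 R}) : defect (Negz n) A = #|` A|%:Z.
Proof. by rewrite /defect /= subr0. Qed.

Lemma nodal_defect_eq0 (R : realType) N (f : {mpoly R[i][3]}) (k : int) :
  nodal_curve N f -> N%:Z - 3 < k -> defect k (nodes f) = 0.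
Proof.
move=> nf; have [c [ps [c0 ef ups mps]]] := nodal_factorization nf.
have [N0 f0 hf _ _] := nf.
have [up up3] := defect_upper nf c0 ef ups mps
  (fun a aZ => proj1 (in_nodes nf c0 ef ups mps a) aZ).
case: k => [k|n] Nk; first by apply: up; move: Nk; clear; lia.
(* The only negative degree above N - 3 is -1, for a line, which is smooth. *)
have N1 : N = 1%N by move: Nk N0; clear; lia.
rewrite N1 in hf; rewrite defect_negz.
have -> : nodes f = fset0; last by rewrite cardfs0.
apply/fsetP => a; rewrite inE; apply/negP => /(in_nodes nf c0 ef ups mps)[_ dfa].
by move/eqP: f0; apply; exact: singular_linear_form hf dfa.
Qed.

Theorem corollary1p6 (R : realType) (N : nat) :
  (forall f : {mpoly R[i][3]}, nodal_curve N f ->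
     (forall k : int, N%:Z - 3 < k -> defect k (nodes f) = 0) /\
     defect (N%:Z - 3) (nodes f) = (ncomponents f)%:Z - 1) /\
  (forall f1 f2 : {mpoly R[i][3]},
     nodal_curve N f1 -> nodal_curve N f2 ->
     rational_curve f1 -> rational_curve f2 ->
     #|` nodes f1| = #|` nodes f2| ->
     forall k : int, defect k (nodes f1) = defect k (nodes f2)).
Proof.
split=> [f nf|f1 f2 nf1 nf2 rf1 rf2 card_eq k].
  have [c [ps [c0 ef ups mps]]] := nodal_factorization nf.
  split=> [k|]; first exact: nodal_defect_eq0.
  rewrite (ncomponentsE nf c0 ef ups mps).
  have [_ up] := defect_upper nf c0 ef ups mps
    (fun a aZ => proj1 (in_nodes nf c0 ef ups mps a) aZ).
  have lo := defect_lower nf c0 ef ups mps.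
  have squeeze (x : int) (n : nat) : x < n%:Z -> n%:Z - 1 <= x -> x = n%:Z - 1.
    by clear; lia.
  exact: squeeze up lo.
have [kN|Nk] := leP k (N%:Z - 3); last first.
  exact: etrans (nodal_defect_eq0 nf1 Nk) (esym (nodal_defect_eq0 nf2 Nk)).
case: k kN => [k|n] kN.
  have kN' : (k + 3 <= N)%N by move: kN; clear; lia.
  apply: etrans (rational_defect nf1 rf1 kN') _; rewrite card_eq.
  exact: esym (rational_defect nf2 rf2 kN').
apply: etrans (defect_negz _ _) _; rewrite card_eq.
exact: esym (defect_negz _ _).
Qed.
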